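(* Let $\delta\in\{\pm1\}$ and let $r\ge3$ be an integer congruent modulo $8$ to $\delta$ or to $2\delta$. Let $\Gamma$ be a weakly negative definite plumbing graph with invertible matrix $B$, $M$ the rational homology $3$-sphere obtained by integral surgery, and $\omega\in H^1(M;\mathbb C/2\mathbb Z)$ a sufficiently generic class (in particular $\omega(\mathfrak m_v)\notin\mathsf X$ for the meridian $\mathfrak m_v$ of every vertex $v$). Assume the Regularization Hypothesis stated in the context. Then $$N_r^{\mathfrak{osp}(1|2)}(M,\omega)=\lim_{\mathbf q\to e^{4\pi\sqrt{-1}/r}}\ \sum_{\mathfrak s\in\mathrm{Spin}^c(M)}c_{\omega,\mathfrak s}\,\widehat Z^{\mathfrak{osp}(1|2)}_{\mathfrak s}(M;\mathbf q),$$ where, for $\mathfrak s=\sigma(b,s)$ with $b\in H_1(M;\mathbb Z)$ and $s\in\mathrm{Spin}(M)$, $$c_{\omega,\sigma(b,s)}=\frac{e^{\pi\sqrt{-1}\mu(M,s)}\,\mathcal T(M,[4\omega])}{|H_1(M;\mathbb Z)|}\sum_{a,f\in H_1(M;\mathbb Z)}e^{2\pi\sqrt{-1}\left(-\frac{r-\delta}8\ell k(a,a)-\ell k(a,b+f)+2\delta\,\ell k(f,f)-\frac12\omega(a)\right)}$$ if $r\equiv\delta\bmod8$, and $$c_{\omega,\sigma(b,s)}=\frac{e^{-\delta\frac{\pi\sqrt{-1}}2\mu(M,s)}\,\mathcal T(M,[2\omega])}{|H_1(M;\mathbb Z)|}\sum_{a,f\in H_1(M;\mathbb Z)}e^{2\pi\sqrt{-1}\left(-\frac{r-2\delta}8\ell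 k(a,a)-\ell k(a,b+\delta f)+\delta\,\ell k(f,f)-\frac12\omega(a)\right)}$$ if $r\equiv2\delta\bmod8$.
   Context: **Topology.** A plumbing graph is a finite tree $\Gamma$ with vertex set $V$ and integer weights $f_v$; $B_{vv'}=1$ for edges, $B_{vv}=f_v$, $0$ otherwise, assumed invertible. It is weakly negative definite if $B^{-1}$ restricted to vertices of degree $>2$ is negative definite. $M$ is surgery on the link with an $f_v$-framed unknot per vertex, Hopf linked exactly when adjacent. $b_\pm$: numbers of positive/negative eigenvalues of $B$; $\sigma=b_+-b_-$; $\mathbf 1=(1,\dots,1)^t$. $H_1(M;\mathbb Z)=\mathbb Z^V/B\mathbb Z^V$; $\ell k(a,b)=a^tB^{-1}b\bmod1$. $\omega$ corresponds to $\alpha=(\alpha_v)\in(\mathbb C/2\mathbb Z)^V$ with $B\alpha=0$, $\alpha_v=\omega(\mathfrak m_v)$ (choose lifts $\alpha_v\in\mathbb C$); $\frac12\omega(a)=\frac12a^t\alpha\bmod1$. $\mathrm{Spin}(M)=\{s\in(\mathbb Z/2)^V\mid\sum_jB_{ij}s_j\equiv B_{ii}\bmod2\}$; $\mathrm{Spin}^c(M)=\{K\in\mathbb Z^V/2B\mathbb Z^V\mid K_i\equiv B_{ii}\bmod2\}$; $\sigma(b,s)=2b+B\tilde s$ with $\tilde s$ an integral lift of $s$. $\mu(M,s)\in\mathbb Z/16$ is the Rokhlin invariant, which satisfies $\mu(M,s)\equiv\sigma-\tilde s^tB\tilde s\bmod4$. $\mathcal T$ is Reidemeister torsion normalized so that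 $\mathcal T(M,[n\omega])=(-1)^{b_+}\prod_{v}\big(e^{\pi\sqrt{-1}n\alpha_v}-e^{-\pi\sqrt{-1}n\alpha_v}\big)^{\deg v-2}$. **$\widehat Z$.** $F^+(x)=\prod_v(x_v+x_v^{-1})^{2-\deg v}=\sum_{l\in\mathbb Z^V}F^+_l\prod_vx_v^{l_v}$, each factor expanded as the average of its Laurent expansions at $0$ and $\infty$. $\widehat Z^{\mathfrak{osp}(1|2)}_{\sigma(b,s)}(M;\mathbf q)=\mathbf q^{\frac{3\sigma-\mathrm{tr}B}4}\sum_{l}F^+_l\mathbf q^{-\frac14l^tB^{-1}l}$, sum over $l\in2b+B(\tilde s-\mathbf 1)+2B\mathbb Z^V$; it converges for $|\mathbf q|<1$. Fractional powers in the limit are interpreted by $\mathbf q^x\to e^{4\pi\sqrt{-1}x/r}$. **The invariant $N_r$.** Let $q=e^{2\pi\sqrt{-1}/r}$, $q^z=e^{2\pi\sqrt{-1}z/r}$, $[[n]]=\frac{q^{-n}-(-q)^n}{q+q^{-1}}$, $[[n]]!=\prod_{i=1}^n[[i]]$, $r_0=2r$ if $r$ is odd and $r_0=r$ if $r\equiv2\bmod4$, $r'=r/\gcd(2,r)$, $I_r=\{-r_0+1+2i\mid0\le i\le r'-1\}$. $\mathcal C$ is the category of finite dimensional weight modules ($H$ semisimple, $K=q^H$; parity preserving maps) over the Hopf superalgebra $U$ with even generators $H,K^{\pm1}$, odd generators $E,F$, relations $KK^{-1}=K^{-1}K=1$, $HK=KH$, $[H,E]=2E$, $[H,F]=-2F$,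 $KE=q^2EK$, $KF=q^{-2}FK$, $EF+FE=\frac{K-K^{-1}}{q-q^{-1}}$, $E^{r_0}=F^{r_0}=0$, $\Delta H=H\otimes1+1\otimes H$, $\Delta K=K\otimes K$, $\Delta E=1\otimes E+E\otimes K$, $\Delta F=K^{-1}\otimes F+F\otimes1$. It is ribbon with braiding $c=\tau\Upsilon\tilde R$, $\tilde R=\sum_{l=0}^{r_0-1}(-1)^l\frac{q^{l(l-1)/2}(q-q^{-1})^l}{[[l]]!}E^l\otimes F^l$, $\Upsilon(v\otimes w)=q^{\lambda_v\lambda_w/2}v\otimes w$, $\tau$ the super flip, and right evaluation $\overrightarrow{\mathrm{ev}}(v\otimes f)=(-1)^{\bar f\bar v}f(K^{1-r_0}v)$. $V_{(\lambda,\bar p)}$ is the Verma module generated by a vector of parity $\bar p$ and weight $\lambda+r_0-1$ killed by $E$; $\lambda$ is atypical if it is not simple; $\mathsf X\subset\mathbb C/2\mathbb Z$ is the image of $\{\lambda\mid\lambda-r_0+1\text{ atypical}\}$. The modified trace $\mathsf{tr}$ on projectives has $\mathsf d(V_{(\lambda,\bar p)})=(-1)^{\bar p}\mathsf d(\lambda)$, $\mathsf d(\lambda)=\frac{q^\lambda+q^{-\lambda}}{q^{r_0\lambda}-q^{-r_0\lambda}}$. Kirby colours: $\Omega_{\bar\lambda}=\sum_{j\in\lambda+I_r}\mathsf d(V_{(j,\bar0)})V_{(j,\bar0)}$. $\Delta_\pm\in\mathbb C$ are given by $\sum_{W\in\Theta}\mathsf d(W)\,\mathrm{ptr}_{W^\vee}(\theta^{\pm1}_{V\otimes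 W^\vee})=\Delta_\pm\mathrm{id}_V$ for $\Theta=\{V_{(j,\bar0)}\mid j\in\lambda+I_r\}$ and $V$ of degree $\bar\lambda\notin\mathsf X$ (weights congruent to $\lambda$ modulo $2$), $\mathrm{ptr}$ being right partial trace. Then $N_r^{\mathfrak{osp}(1|2)}(M,\omega)=\Delta_+^{-b_+}\Delta_-^{-b_-}F'(L)$, where $L$ is the plumbing link with component $v$ coloured by $\Omega_{\alpha_v}$ and $F'$ is the renormalized Reshetikhin–Turaev invariant (apply $\mathsf{tr}$ after cutting one edge). Explicitly, with $S(\lambda',\lambda)=q^{\lambda'\lambda}$ and $T(\lambda)=q^{(\lambda^2-(r_0-1)^2)/2}$, $$N_r^{\mathfrak{osp}(1|2)}(M,\omega)=\frac1{\Delta_+^{b_+}\Delta_-^{b_-}}\sum_{k\in I_r^V}\prod_v\mathsf d(\alpha_v+k_v)^{2-\deg v}T(\alpha_v+k_v)^{f_v}\prod_{\{v,v'\}\in E(\Gamma)}S(\alpha_v+k_v,\alpha_{v'}+k_{v'}).$$ Here $\Delta_+=\sqrt{r'}\,q^{-3/2}\kappa$ with $\kappa=1,\sqrt{-1},-\sqrt{-1},-1$ for $r\equiv1,7,2,6\bmod8$ respectively, and $\Delta_-=-\overline{\Delta_+}$. **Regularization Hypothesis.** There is a family of coefficients $F^+_l(t)$, depending on a parameter $t\to1$, with $F_l^+(t)\to F_l^+$, $F^+_l(t)=0$ unless $l_v\equiv\deg v\bmod2$ for all $v$, such that: for all $k\in I_r^V$ the series $\sum_lF_l^+(t)\prod_vq^{l_v(\alpha_v+k_v)}$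 converges absolutely and tends to $F^+(\{q^{\alpha_v+k_v}\}_v)$ as $t\to1$; and, writing $\widehat Z_{\mathfrak s}(M;\mathbf q;t)$ for the series with $F_l^+$ replaced by $F_l^+(t)$, the limit $\lim_{\mathbf q\to e^{4\pi\sqrt{-1}/r}}\sum_{\mathfrak s}c_{\omega,\mathfrak s}\widehat Z_{\mathfrak s}(M;\mathbf q)$ exists and equals $\lim_{t\to1}\sum_{\mathfrak s}c_{\omega,\mathfrak s}\widehat Z_{\mathfrak s}(M;e^{4\pi\sqrt{-1}/r};t)$. *)

(* Defs.v *)
From HB Require Import structures.
From mathcomp Require Import all_boot all_order all_algebra.
From mathcomp Require Import generic_quotient finmap.
From mathcomp Require Import all_classical all_reals all_analysis.
From mathcomp Require Import showcase.summability.
From mathcomp Require Import complex mxtens.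

Set Implicit Arguments.
Unset Strict Implicit.
Unset Printing Implicit Defensive.

Import Order.TTheory GRing.Theory Num.Theory.
Import numFieldNormedType.Exports.

Local Open Scope ring_scope.
Local Open Scope quotient_scope.
Local Open Scope classical_set_scope.

(* The last condition is acyclicity: in a symmetric relation, traversing an edge
   back and forth is a cycle of size 2. *)
Record plumbing := Plumbing {
  nv : nat;
  adj : rel 'I_nv;
  framing : 'I_nv -> int;
  _ : symmetric adj;
  _ : irreflexive adj;
  _ : (0 < nv)%N;
  _ : forall v w, connect adj v w;
  _ : forall p, ucycle adj p -> (size p <= 2)%N }.

Section Plumbing.
Variable G : plumbing.
Let n := nv G.

Definition deg (v : 'I_n) : nat := #|[set w | adj v w]%SET|.

Definition linking : 'M[int]_n :=
  \matrix_(v, w) (if v == w then framing v else (adj v w)%:Z).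

Definition linking_inv : 'M[rat]_n := invmx (map_mx intr linking).

Definition weakly_negative_definite (R : realType) : Prop :=
  forall x : 'cV[R]_n, x != 0 ->
    (forall v, (deg v <= 2)%N -> x v 0 = 0) ->
    (x^T *m map_mx ratr linking_inv *m x) 0 0 < 0.

(* [x^t B^-1 y] before reduction mod 1; only its class mod 1 depends on the
   classes of [x] and [y] alone. *)
Definition lk (x y : 'cV[int]_n) : rat :=
  ((map_mx intr x)^T *m linking_inv *m map_mx intr y) 0 0.

End Plumbing.

Section LatticeQuotient.
Variables (n : nat) (A : 'M[int]_n).

Definition lat_equiv (x y : 'cV[int]_n) : bool :=
  `[< exists z : 'cV[int]_n, x - y = A *m z >].

Lemma lat_equiv_refl : reflexive lat_equiv.
Proof. by move=> x; apply/asboolP; exists 0; rewrite subrr mulmx0. Qed.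

Lemma lat_equiv_sym : symmetric lat_equiv.
Proof.
move=> x y; apply/asboolP/asboolP => -[z e]; exists (- z);
  by rewrite mulmxN -e opprB.
Qed.

Lemma lat_equiv_trans : transitive lat_equiv.
Proof.
move=> y x z /asboolP[u eu] /asboolP[v ev]; apply/asboolP; exists (u + v).
by rewrite mulmxDr -eu -ev addrA subrK.
Qed.

Canonical lat_equiv_equiv :=
  EquivRel lat_equiv lat_equiv_refl lat_equiv_sym lat_equiv_trans.

Definition latq : Type := {eq_quot lat_equiv}.

Lemma latqP (x y : 'cV[int]_n) :
  reflect (exists z, x - y = A *m z) (\pi_latq x == \pi_latq y).
Proof. by rewrite eqmodE; apply: asboolP. Qed.

(* The sums over such quotients below are finitely supported sums over
   [[set: latq A]]. *)
Lemma latq_finite : \det A != 0 -> finite_set [set: latq].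
Proof.
move=> dA0; pose d : int := \det A; pose N := `|d|%N.
have N0 : (0 < N)%N by rewrite absz_gt0.
have lt (x : int) : (`|(x %% d)%Z| < N.-1.+1)%N.
  by rewrite prednK // -ltz_nat gez0_abs ?modz_ge0 // ltz_mod.
pose f (x : latq) : {ffun 'I_n -> 'I_N.-1.+1} :=
  [ffun i => Ordinal (lt (repr x i 0))].
have f_inj : injective f.
  move=> x y /ffunP e; rewrite -[x]reprK -[y]reprK.
  apply/eqP/latqP; exists (\adj A *m \col_i divz (repr x i 0 - repr y i 0) d).
  rewrite mulmxA mul_mx_adj mul_scalar_mx; apply/matrixP => i j.
  rewrite !mxE ord1 mulrC divzK //.
  move: (e i); rewrite !ffunE => /(congr1 val) /= /(congr1 Posz).
  rewrite !gez0_abs ?modz_ge0 // => /eqP.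
  by rewrite -eqz_mod_dvd.
rewrite -(eq_finite_set (@inj_card_eq _ _ setT f _)); last by move=> ? ? _ _ /f_inj.
exact: finite_finset.
Qed.

End LatticeQuotient.

Definition rep n (A : 'M[int]_n) (x : latq A) : 'cV[int]_n := repr x.

Section Invariants.
Variable R : realType.
Local Notation C := R[i].

Definition cexp (z : C) : C :=
  ((expR (complex.Re z) * cos (complex.Im z)) +i*
   (expR (complex.Re z) * sin (complex.Im z)))%C.

Definition e2pi (z : C) : C := cexp ((0 +i* (2 * pi))%C * z).

Section Topology.
Variable G : plumbing.
Local Notation n := (nv G).
Local Notation B := (linking G).

Definition spectrum : seq C :=
  sval (closed_field_poly_normal (char_poly (map_mx intr B : 'M[C]_n))).

Definition bplus : nat := count (fun z => 0 < z) spectrum.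
Definition bminus : nat := count (fun z => z < 0) spectrum.
Definition signature : int := bplus%:Z - bminus%:Z.

Definition H1 := latq B.
Definition card_H1 : nat := #|` fset_set [set: H1] |.

Definition spin : {set 'cV['F_2]_n} :=
  [set s | map_mx intr B *m s == \col_i (B i i)%:~R]%SET.

Definition spin_lift (s : 'cV['F_2]_n) : 'cV[int]_n := \col_i (s i 0 : nat)%:Z.

Definition spinc : set (latq (B *+ 2)) :=
  [set K | forall i, (rep K i 0%R == B i i %[mod 2])%Z].

Definition sigma (b : H1) (s : 'cV['F_2]_n) : latq (B *+ 2) :=
  \pi_(latq (B *+ 2)) (rep b *+ 2 + B *m spin_lift s).

(* The characteristic sublink attached to [s] is the set of vertices where the
   0/1 lift of [s] equals 1.  In a plumbing forest no two of them are adjacent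
   (each has an even number of neighbours in the set), so the sublink is an
   unlink, its Arf invariant vanishes, and the surgery formula
   [mu = signature - C.C + 8 Arf C] for the Rokhlin invariant mod 16 is the
   following. *)
Definition rokhlin (s : 'cV['F_2]_n) : 'Z_16 :=
  (signature - ((spin_lift s)^T *m B *m spin_lift s) 0 0)%:~R.

(* [alpha] lifts a class of [H^1(M; C/2Z)]. *)
Definition is_class (alpha : 'I_n -> C) : Prop :=
  forall v, exists m : int, \sum_w (B v w)%:~R * alpha w = (2 * m)%:~R.

Definition half_class (alpha : 'I_n -> C) (a : 'cV[int]_n) : C :=
  (\sum_v (a v 0)%:~R * alpha v) / 2.

(* The Reidemeister torsion [T(M, [k omega])] of the plumbed manifold; the sign
   [(-1)^b_+] and the absence of a unit fix its normalization. *)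
Definition torsion (alpha : 'I_n -> C) (k : nat) : C :=
  (-1) ^+ bplus *
  \prod_v (e2pi (k%:R * alpha v / 2) - e2pi (- (k%:R * alpha v / 2)))
          ^ ((deg v)%:Z - 2).

Definition gbinom (m : int) (j : nat) : C :=
  (\prod_(i < j) (m - i%:Z)%:~R) / j`!%:R.

(* Coefficient of [x^l] in the Laurent expansion at 0 of
   [(x + x^-1)^m = x^-m (1 + x^2)^m]; the expansion at infinity is its image
   under [x -> x^-1]. *)
Definition laurent0 (m l : int) : C :=
  if (0 <= l + m) && (2 %| l + m)%Z then gbinom m `|((l + m) %/ 2)%Z|%N else 0.

Definition Fplus_coef (l : 'cV[int]_n) : C :=
  \prod_v ((laurent0 (2 - (deg v)%:Z) (l v 0) +
            laurent0 (2 - (deg v)%:Z) (- l v 0)) / 2).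

Definition Fplus (x : 'I_n -> C) : C :=
  \prod_v (x v + (x v)^-1) ^ (2 - (deg v)%:Z).

Definition abs_summable (I : choiceType) (x : I -> C) : Prop :=
  exists M : C, forall J : {fset I}, partial_sum (fun i => `|x i|) J <= M.

Definition csum (I : choiceType) (x : I -> C) : C :=
  @summability.sum I C C^o x.

(* The series with coefficients [F] at [q = e^(2 i pi tau)], all fractional
   powers being [q^x = e^(2 i pi tau x)].  For [K = sigma b s] the index set
   [K - B 1 + 2 B Z^V] is [2 b + B (s - 1) + 2 B Z^V]. *)
Definition zhat (F : 'cV[int]_n -> C) (K : latq (B *+ 2)) (tau : C) : C :=
  e2pi (tau * (3 * signature - \tr B)%:~R / 4) *
  csum (fun l : 'cV[int]_n =>
    if `[< exists y, l = rep K - B *m const_mx 1 + (B *m y) *+ 2 >]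
    then F l * e2pi (- (tau * ratr (lk l l) / 4)) else 0).

Section Coefficients.
Variables (r : nat) (delta : int) (alpha : 'I_n -> C).

Definition c_odd (b : H1) (s : 'cV['F_2]_n) : C :=
  e2pi ((rokhlin s : nat)%:R / 2) * torsion alpha 4 / card_H1%:R *
  \sum_(a \in [set: H1]) \sum_(f \in [set: H1])
    e2pi (- ((r%:Z - delta)%:~R / 8 * ratr (lk (rep a) (rep a)))
          - ratr (lk (rep a) (rep b + rep f))
          + 2 * delta%:~R * ratr (lk (rep f) (rep f))
          - half_class alpha (rep a)).

Definition c_even (b : H1) (s : 'cV['F_2]_n) : C :=
  e2pi (- (delta%:~R * (rokhlin s : nat)%:R / 4)) *
  torsion alpha 2 / card_H1%:R *
  \sum_(a \in [set: H1]) \sum_(f \in [set: H1])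
    e2pi (- ((r%:Z - 2 * delta)%:~R / 8 * ratr (lk (rep a) (rep a)))
          - ratr (lk (rep a) (rep b + rep f *~ delta))
          + delta%:~R * ratr (lk (rep f) (rep f))
          - half_class alpha (rep a)).

Definition c_formula (b : H1) (s : 'cV['F_2]_n) : C :=
  if (r == delta %[mod 8])%Z then c_odd b s else c_even b s.

(* A presentation [K = sigma b s] is chosen here; independence of this choice
   is part of the theorem. *)
Definition c_omega (K : latq (B *+ 2)) : C :=
  let p := xget (\pi_H1 0, 0) [set p : H1 * 'cV['F_2]_n |
                               p.2 \in spin /\ sigma p.1 p.2 = K] in
  c_formula p.1 p.2.

Definition zhat_sum (F : 'cV[int]_n -> C) (tau : C) : C :=
  \sum_(K \in spinc) c_omega K * zhat F K tau.

End Coefficients.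
End Topology.

Section Quantum.
Variable r : nat.

Definition qpow (z : C) : C := e2pi (z / r%:R).
Local Notation q := (qpow 1).

Definition r0 : nat := if odd r then (2 * r)%N else r.
Definition r' : nat := (r %/ gcdn 2 r)%N.
Definition I_r (i : 'I_r') : C := - r0%:R + 1 + 2 * i%:R.

Definition qbrace (k : nat) : C := (q ^- k - (- q) ^+ k) / (q + q^-1).
Definition qfact (k : nat) : C := \prod_(1 <= i < k.+1) qbrace i.
Definition qint (z : C) : C := (qpow z - qpow (- z)) / (q - q^-1).

(* A weight supermodule in a homogeneous basis of weight vectors; operators act
   on column vectors, and [K = q^H]. *)
Record wmodule := WModule {
  wdim : nat;
  wt : 'I_wdim -> C;
  par : 'I_wdim -> bool;
  opE : 'M[C]_wdim;
  opF : 'M[C]_wdim }.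

Definition opH (V : wmodule) : 'M[C]_(wdim V) := diag_mx (\row_i wt i).
Definition opK (V : wmodule) (c : C) : 'M[C]_(wdim V) :=
  diag_mx (\row_i qpow (c * wt i)).
Definition opS (V : wmodule) : 'M[C]_(wdim V) :=
  diag_mx (\row_i (-1) ^+ par i).

(* The relations involving [K] alone, and those between [K] and [E], [F], follow
   from [K = q^H] and the ones between [H] and [E], [F]. *)
Definition is_module (V : wmodule) : Prop :=
  [/\ opH V *m opE V - opE V *m opH V = 2 *: opE V,
      opH V *m opF V - opF V *m opH V = - 2 *: opF V,
      opE V *m opF V + opF V *m opE V
        = (q - q^-1)^-1 *: (opK V 1 - opK V (-1)),
      opE V ^+ r0 = 0 /\ opF V ^+ r0 = 0
    & opS V *m opE V = - (opE V *m opS V) /\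
      opS V *m opF V = - (opF V *m opS V)].

Definition is_simple (V : wmodule) : Prop :=
  (0 < wdim V)%N /\
  forall U : 'M[C]_(wdim V),
    stablemx U (opE V)^T -> stablemx U (opF V)^T ->
    stablemx U (opH V)^T -> stablemx U (opS V)^T ->
    U = 0 \/ row_full U.

(* Basis [F^i v], [0 <= i < r0], with [v] of weight [lam + r0 - 1] killed by
   [E]; the entries of [E] come from [E F = [H] - F E], where
   [[H] = (K - K^-1) / (q - q^-1)]. *)
Definition verma (lam : C) (p : bool) : wmodule :=
  let wt i : C := lam + r0%:R - 1 - 2 * i%:R in
  @WModule r0 (fun i => wt i) (fun i => p (+) odd i)
    (\matrix_(i, j) if i.+1 == j :> nat then
                      \sum_(k < j) (-1) ^+ (j.-1 - k) * qint (wt k)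
                    else 0)
    (\matrix_(i, j) (i == j.+1 :> nat)%:R).

Definition congr2Z (x y : C) : Prop := exists m : int, x - y = (2 * m)%:~R.

Definition atypical (lam : C) : Prop := ~ is_simple (verma lam false).

(* [lam] lies over a point of the exceptional set [X] of [C/2Z]. *)
Definition exceptional (lam : C) : Prop :=
  exists2 mu, congr2Z lam mu & atypical (mu - r0%:R + 1).

(* The antipode is [S(E) = - E K^-1], [S(F) = - K F], [S(H) = - H], and
   [(x f)(w) = (-1)^(|x||f|) f(S(x) w)]. *)
Definition dual (V : wmodule) : wmodule :=
  @WModule (wdim V) (fun i => - wt i) (@par V)
    (\matrix_(j, i) (- (-1) ^+ par i * qpow (- wt j) * opE V i j))
    (\matrix_(j, i) (- (-1) ^+ par i * qpow (wt i) * opF V i j)).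

(* Tensor products use the basis [v_i (x) w_j], indexed by [mxtens_index].  For
   odd [x], [y] the operator [x^l (x) y^l] sends [v (x) w] to
   [(-1)^(l|v|) x^l v (x) y^l w]. *)
Definition Rtilde (V W : wmodule) : 'M[C]_(wdim V * wdim W) :=
  \sum_(l < r0)
    ((-1) ^+ l * q ^+ ((l * l.-1) %/ 2) * (q - q^-1) ^+ l / qfact l)
    *: ((opE V ^+ l *m opS V ^+ l) *t (opF W ^+ l)).

Definition Upsilon (V W : wmodule) : 'M[C]_(wdim V * wdim W) :=
  diag_mx (\row_x qpow (wt (mxtens_unindex x).1 * wt (mxtens_unindex x).2 / 2)).

Definition superflip (V W : wmodule) :
    'M[C]_(wdim W * wdim V, wdim V * wdim W) :=
  \matrix_(y, x)
    let: (i, j) := mxtens_unindex x in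
    if mxtens_unindex y == (j, i) then (-1) ^+ (par i && par j) else 0.

Definition braiding (V W : wmodule) :
    'M[C]_(wdim W * wdim V, wdim V * wdim W) :=
  superflip V W *m Upsilon V W *m Rtilde V W.

(* Right partial trace over [W], closing with the right evaluation
   [v (x) f |-> (-1)^(|f||v|) f(K^(1-r0) v)]. *)
Definition ptr (V W : wmodule) (f : 'M[C]_(wdim V * wdim W)) : 'M[C]_(wdim V) :=
  \matrix_(i, j) \sum_k
    (-1) ^+ par k * qpow ((1 - r0%:R) * wt k)
    * f (mxtens_index (i, k)) (mxtens_index (j, k)).

Definition twist (V : wmodule) : 'M[C]_(wdim V) := ptr (braiding V V).

(* The twist of [V (x) W], by the balancing axiom. *)
Definition twist_tens (V W : wmodule) : 'M[C]_(wdim V * wdim W) :=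
  braiding W V *m braiding V W *m (twist V *t twist W).

Definition mdim (lam : C) : C :=
  (qpow lam + qpow (- lam)) / (qpow (r0%:R * lam) - qpow (- (r0%:R * lam))).

(* [Delta_+] is the case [pos = true], [Delta_-] the case [pos = false]. *)
Definition is_Delta (pos : bool) (D : C) : Prop :=
  forall (lam : C) (V : wmodule),
    ~ exceptional lam -> is_module V -> (forall i : 'I_(wdim V), congr2Z (wt i) lam) ->
    \sum_(j : 'I_r') mdim (lam + I_r j) *:
      (let W := dual (verma (lam + I_r j) false) in
       ptr (if pos then twist_tens V W else invmx (twist_tens V W)))
    = D%:M.

Section PlumbingLink.
Variable G : plumbing.
Local Notation n := (nv G).

Definition twist_pow (V : wmodule) (f : int) : 'M[C]_(wdim V) :=
  match f with
  | Posz m => twist V ^+ m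
  | Negz m => invmx (twist V ^+ m.+1)
  end.

(* The endomorphism of [V] given by a strand coloured by [V] encircled by the
   closure of a strand coloured by [W] carrying the endomorphism [f]. *)
Definition encircle (V W : wmodule) (f : 'M[C]_(wdim W)) : 'M[C]_(wdim V) :=
  ptr (braiding W V *m braiding V W *m (1%:M *t f)).

(* The (1,1)-tangle obtained by cutting component [v], and discarding the branch
   of the tree through the neighbour [u] of [v] when [up = Some u].  Recursion
   is along the tree, and [fuel] bounds its depth. *)
Fixpoint tangle (col : 'I_n -> wmodule) (fuel : nat) (up : option 'I_n)
    (v : 'I_n) : 'M[C]_(wdim (col v)) :=
  if fuel is m.+1 then
    (\big[*%R/1]_(w | adj v w && (Some w != up))
       encircle (col v) (tangle col m (Some v) w))
    *m twist_pow (col v) (framing v)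
  else 1%:M.

(* The scalar by which an endomorphism of a simple module acts. *)
Definition scalar_of (V : wmodule) (f : 'M[C]_(wdim V)) : C :=
  \tr f / (wdim V)%:R.

(* [F'] of the plumbing link with component [v] coloured by the simple module
   [V_(lam v, 0)]: the modified trace of the tangle obtained by cutting [root]. *)
Definition Fprime (root : 'I_n) (lam : 'I_n -> C) : C :=
  mdim (lam root) *
  scalar_of (tangle (fun v => verma (lam v) false) n None root).

Definition N_r (root : 'I_n) (Dplus Dminus : C) (alpha : 'I_n -> C) : C :=
  Dplus ^- bplus G * Dminus ^- bminus G *
  \sum_(k : {ffun 'I_n -> 'I_r'})
    (\prod_v mdim (alpha v + I_r (k v))) *
    Fprime root (fun v => alpha v + I_r (k v)).

(* The point [tau = 2 / r], at which [q = e^(2 i pi tau)] is [e^(4 i pi / r)]. *)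
Definition tau_r : C := 2 / r%:R.

(* [tau -> 2 / r] with [|e^(2 i pi tau)| < 1]; along this filter
   [q^x = e^(2 i pi tau x)] tends to [e^(4 i pi x / r)]. *)
Definition to_root : set_system (C^o) :=
  within [set tau : C^o | 0 < complex.Im tau] (nbhs (tau_r : C^o)).

Definition regularization (delta : int) (alpha : 'I_n -> C) : Prop :=
  exists Ft : R -> 'cV[int]_n -> C,
  [/\ forall l : 'cV[int]_n, (Ft t l : C^o) @[t --> (1 : R)^'-] --> (Fplus_coef l : C^o),
      \forall t \near (1 : R)^'-, forall l : 'cV[int]_n,
        ~ (forall v, (l v 0%R == deg v %[mod 2])%Z) -> Ft t l = 0,
      forall k : {ffun 'I_n -> 'I_r'},
        let x v := qpow (alpha v + I_r (k v)) in
        let term t (l : 'cV[int]_n) :=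
          Ft t l * \prod_v qpow ((l v 0)%:~R * (alpha v + I_r (k v))) in
        (\forall t \near (1 : R)^'-, abs_summable (term t)) /\
        ((csum (term t) : C^o) @[t --> (1 : R)^'-] --> (Fplus x : C^o))
    & exists L : C^o,
        (zhat_sum r delta alpha (@Fplus_coef G) tau : C^o)
          @[tau --> to_root] --> L /\
        (zhat_sum r delta alpha (Ft t) tau_r : C^o)
          @[t --> (1 : R)^'-] --> L].

End PlumbingLink.
End Quantum.
End Invariants.

(* Main.v *)
(* Evaluating the link on Verma modules, where twists and encirclings act by
   scalars, gives N_r = Z sum_k W_k F^+(q^(alpha + k)), a sum over k in (Z/p)^V
   (p = r') in which W_k is a quadratic phase in the weights alpha + k and Z does
   not depend on k.  For the regularized coefficients F^+ may be expanded and the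
   sums exchanged; what multiplies F^+_l is then a Gauss sum over (Z/p)^V of the
   form B, with a linear term depending on l.  Writing p = 4jh + delta, reciprocity
   turns it into a double sum over H_1(M): Milgram's formula is applied to the
   tensor product of B with the binary form of matrix
   [-2j, -1; -1, 2 h delta], whose determinant is -delta p.  The outcome is the
   coefficient c_omega of the Spin^c structure determined by l, and each l of the
   right parity determines exactly one.

   Gauss sums over different finite quotients are compared as averages of
   periodic functions on Z^n, for which a change of lattice is a substitution. *)

Require Import Defs.
From mathcomp Require Import all_boot all_order all_algebra.
From mathcomp Require Import perm spectral sesquilinear generic_quotient finmap.
From mathcomp Require Import all_classical all_reals all_analysis.
From mathcomp Require Import showcase.summability complex mxtens.
From mathcomp Require Import ring lra zify.

Import Order.TTheory GRing.Theory Num.Theory.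
Import numFieldNormedType.Exports.

Local Open Scope ring_scope.
Local Open Scope classical_set_scope.

Set Implicit Arguments.
Unset Strict Implicit.
Unset Printing Implicit Defensive.

(** * Phases and averages of periodic functions *)

(** The binary form is read off the coefficient: its diagonal entries [-2j] and [2 h delta] are
    twice the factors of [lk a a] and [lk f f] in [c_omega], its off-diagonal entry is the pairing
    of [a] with [f], and the congruence on [r] is what makes the determinant [- delta p]. For
    [delta = 1] the form is indefinite, so tensoring it with [B] gives signature 0; for [delta = -1]
    it is negative definite, and the signature is [-2] times that of [B]. Hence a phase
    [(delta - 1) signature / 8], which the powers of [Delta] cancel. A class [omega] has the shape
    [alpha = 2 B^-1 m] with [m] integral, so the phases in the sum over colours have rational
    exponents and are compared modulo 1. Completing the square for a given [l] leaves the
    half-integral shift [p s / 2]; [h] times its norm over [p], that is [h p s^t B s / 4], joins the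
    signature part of [Delta] to form the Rokhlin phase. *)

Section Exponential.
Variable R : realType.
Local Notation C := R[i].

Lemma e2piE (x : R) :
  e2pi (x%:C)%C = (cos (2 * pi * x) +i* sin (2 * pi * x))%C :> C.
Proof.
rewrite /e2pi /cexp /=; simpc => /=.
by rewrite expR0 !mul1r.
Qed.

Lemma e2piD (x y : C) : e2pi (x + y) = e2pi x * e2pi y.
Proof.
rewrite /e2pi mulrDr; move: (_ * x) (_ * y) => {x y} [a b] [c d].
rewrite /cexp /= expRD cosD sinD; simpc; apply/eqP; rewrite eq_complex /=.
by apply/andP; split; apply/eqP; ring.
Qed.

Lemma e2pi0 : e2pi 0 = 1 :> C.
Proof. by rewrite (_ : 0 = (0%:C)%C) // e2piE mulr0 cos0 sin0. Qed.

Lemma e2pi_neq0 (x : C) : e2pi x != 0.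
Proof.
apply/eqP => e; have := e2piD x (- x); rewrite subrr e2pi0 e mul0r => /eqP.
by rewrite oner_eq0.
Qed.

Lemma e2piN (x : C) : e2pi (- x) = (e2pi x)^-1.
Proof.
by apply: (mulfI (e2pi_neq0 x)); rewrite -e2piD subrr e2pi0 divff ?e2pi_neq0.
Qed.

Lemma e2piMn (x : C) (k : nat) : e2pi (x *+ k) = e2pi x ^+ k.
Proof.
by elim: k => [|k IH]; rewrite ?mulr0n ?expr0 ?e2pi0 // mulrS exprS e2piD IH.
Qed.

Lemma e2piMz (x : C) (k : int) : e2pi (x *~ k) = e2pi x ^ k.
Proof.
case: k => k; first by rewrite -pmulrn e2piMn.
by rewrite NegzE mulrNz -pmulrn e2piN e2piMn.
Qed.

Lemma e2pi1 : e2pi 1 = 1 :> C.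
Proof.
by rewrite (_ : 1 = (1%:C)%C) // e2piE mulr1 mulr_natl cos2pi sin2pi.
Qed.

Lemma e2pi_int (k : int) : e2pi k%:~R = 1 :> C.
Proof. by rewrite e2piMz e2pi1 exp1rz. Qed.

Lemma e2pi_nat (k : nat) : e2pi k%:R = 1 :> C.
Proof. by rewrite e2piMn e2pi1 expr1n. Qed.

Lemma e2pi_half : e2pi (1 / 2) = -1 :> C.
Proof.
have -> : 1 / 2 = ((2^-1 : R)%:C)%C :> C.
  by rewrite fmorphV /= mul1r rmorph_nat.
rewrite e2piE (_ : 2 * pi * 2^-1 = pi); last by field.
by rewrite cospi sinpi; apply/eqP; rewrite eq_complex /= oppr0 !eqxx.
Qed.

Lemma e2pi_quarter : e2pi (1 / 4) = 'i%C :> C.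
Proof.
have -> : 1 / 4 = ((4^-1 : R)%:C)%C :> C.
  by rewrite fmorphV /= mul1r rmorph_nat.
rewrite e2piE (_ : 2 * pi * 4^-1 = pi / 2); last by field.
by rewrite cos_pihalf sin_pihalf.
Qed.

Lemma norm_e2pi (x : R) : `|e2pi (x%:C)%C| = 1 :> C.
Proof. by rewrite e2piE normc_def /= cos2Dsin2 sqrtr1. Qed.

Lemma conj_e2pi (x : R) : (e2pi (x%:C)%C : C)^* = e2pi (- (x%:C)%C).
Proof.
rewrite -rmorphN !e2piE mulrN cosN sinN; apply/eqP.
by rewrite eq_complex /= !eqxx.
Qed.

(* Halving the angle turns [cos t = 1] into [sin (t/2) = 0], whose zeros in
   [[0, pi)] are easy to locate. *)
Lemma e2pi_eq1 (x : R) : e2pi (x%:C)%C = 1 :> C -> exists k : int, x = k%:~R.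
Proof.
move=> e; exists (Num.floor x).
set y := x - (Num.floor x)%:~R.
have /andP[y0 y1] : 0 <= y < 1.
  by rewrite /y subr_ge0 ltrBlDl -{3}[1]/(1%:~R) -intrD addrC intrD Num.Theory.floor_le_tmp /=
    -[1 + _]addrC -intrD1 lt_succ_floor.
have ey : e2pi (y%:C)%C = 1 :> C.
  by rewrite /y rmorphB rmorph_int e2piD e e2piN e2pi_int invr1 mulr1.
suff: y = 0 by move/eqP; rewrite subr_eq0 => /eqP.
move/eqP: ey; rewrite e2piE eq_complex /= => /andP[/eqP c1 _].
have s0 : sin (pi * y) = 0.
  have : cos (2 * pi * y) = 1 - 2 * sin (pi * y) ^+ 2.
    rewrite (_ : 2 * pi * y = pi * y + pi * y); last by ring.
    by rewrite cosD; have := cos2Dsin2 (pi * y); lra.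
  rewrite c1 => /eqP; rewrite -subr_eq0 opprB addrCA subrr addr0 mulf_eq0.
  by rewrite pnatr_eq0 /= sqrf_eq0 => /eqP.
apply: le_anti; rewrite y0 andbT leNgt; apply/negP => yp.
have : 0 < sin (pi * y).
  by apply: sin_gt0_pi; rewrite mulr_gt0 ?pi_gt0 //= gtr_pMr ?pi_gt0.
by rewrite s0 ltxx.
Qed.

(** Phases at rational arguments, where equality is integrality of the difference of the exponents
    ([er_congr], [er_eq1]). *)
Definition er (x : rat) : C := e2pi (ratr x).

Lemma erE x : er x = e2pi (((ratr x : R)%:C)%C).
Proof. by rewrite /er; congr e2pi; rewrite fmorph_rat. Qed.

Lemma erD x y : er (x + y) = er x * er y.
Proof. by rewrite /er rmorphD e2piD. Qed.
Lemma er0 : er 0 = 1. Proof. by rewrite /er rmorph0 e2pi0. Qed.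
Lemma er_neq0 x : er x != 0. Proof. exact: e2pi_neq0. Qed.
Lemma erN x : er (- x) = (er x)^-1.
Proof. by rewrite /er rmorphN e2piN. Qed.
Lemma er_int (k : int) : er k%:~R = 1.
Proof. by rewrite /er rmorph_int e2pi_int. Qed.
Lemma er_nat (k : nat) : er k%:R = 1.
Proof. by rewrite /er rmorph_nat e2pi_nat. Qed.
Lemma erMn x (k : nat) : er (x *+ k) = er x ^+ k.
Proof. by rewrite /er rmorphMn /= e2piMn. Qed.
Lemma er_sum (I : Type) (s : seq I) (P : pred I) (F : I -> rat) :
  er (\sum_(i <- s | P i) F i) = \prod_(i <- s | P i) er (F i).
Proof. by apply: (big_morph _ erD er0). Qed.
Lemma norm_er x : `|er x| = 1. Proof. by rewrite erE norm_e2pi. Qed.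
Lemma conj_er x : (er x)^* = er (- x).
Proof. by rewrite !erE conj_e2pi !rmorphN. Qed.
Lemma er_half : er (1 / 2) = -1.
Proof. by rewrite /er fmorph_div /= rmorph1 rmorph_nat e2pi_half. Qed.

Lemma er_eq1 x : er x = 1 -> x \is a Num.int.
Proof.
rewrite erE => /e2pi_eq1 [k e]; apply/intrP; exists k.
have : ratr x = ratr k%:~R :> R by rewrite e ratr_int.
by move/fmorph_inj.
Qed.

Lemma er_int_num x : x \is a Num.int -> er x = 1.
Proof. by case/intrP => k ->; rewrite er_int. Qed.

Lemma er_congr x y : x - y \is a Num.int -> er x = er y.
Proof. by move=> /er_int_num e; rewrite -[x](subrK y) erD e mul1r. Qed.

End Exponential.

Section Periodic.
Variable R : realType.
Local Notation C := R[i].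

Section Period.
Variables (V : zmodType) (T : Type).
Definition period (M : nat) (f : V -> T) := forall x y, f (x + y *+ M) = f x.
Definition per (f : V -> T) := exists2 M, (0 < M)%N & period M f.
End Period.

Lemma period_mull (V : zmodType) (T : Type) (M K : nat) (f : V -> T) :
  period M f -> period (M * K) f.
Proof. by move=> pf x y; rewrite mulnC mulrnA pf. Qed.

Lemma period_mulr (V : zmodType) (T : Type) (M K : nat) (f : V -> T) :
  period K f -> period (M * K) f.
Proof. by rewrite mulnC; apply: period_mull. Qed.

Lemma per_cst (V : zmodType) (T : Type) (c : T) : per (fun _ : V => c).
Proof. by exists 1. Qed.

Lemma per_op (V : zmodType) (T T1 T2 : Type) (op : T1 -> T2 -> T)
    (f : V -> T1) (g : V -> T2) :
  per f -> per g -> per (fun x => op (f x) (g x)).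
Proof.
move=> [M M0 pf] [K K0 pg]; exists (M * K)%N; first by rewrite muln_gt0 M0.
by move=> x y; rewrite (period_mull K pf) (period_mulr M pg).
Qed.

Lemma per_comp (V : zmodType) (T U : Type) (h : T -> U) (f : V -> T) :
  per f -> per (fun x => h (f x)).
Proof. by move=> [M M0 pf]; exists M => // x y; rewrite pf. Qed.

(** Weaker than affine: only congruences modulo every [n] have to be preserved, which is what
    pulling back a periodic function uses. *)
Definition affine (V W : zmodType) (phi : V -> W) :=
  forall x y n, exists z, phi (x + y *+ n) = phi x + z *+ n.

Lemma per_affine (V W : zmodType) (T : Type) (phi : V -> W) (f : W -> T) :
  affine phi -> per f -> per (fun x => f (phi x)).
Proof.
move=> ap [M M0 pf]; exists M => // x y.
by have [z ->] := ap x y M; rewrite pf.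
Qed.

Lemma affine_id (V : zmodType) : affine (fun x : V => x).
Proof. by move=> x y n; exists y. Qed.
Lemma affine_fst (V W : zmodType) : affine (fun x : V * W => x.1).
Proof. by move=> x y n; exists y.1; rewrite /= raddfMn. Qed.
Lemma affine_snd (V W : zmodType) : affine (fun x : V * W => x.2).
Proof. by move=> x y n; exists y.2; rewrite /= raddfMn. Qed.
Lemma affine_cst (V W : zmodType) (c : W) : affine (fun _ : V => c).
Proof. by move=> x y n; exists 0; rewrite mul0rn addr0. Qed.
Lemma affine_add (V W : zmodType) (f g : V -> W) :
  affine f -> affine g -> affine (fun x => f x + g x).
Proof.
move=> af ag x y n; have [u ->] := af x y n; have [v ->] := ag x y n.
by exists (u + v); rewrite mulrnDl addrACA.
Qed.
Lemma affine_opp (V W : zmodType) (f : V -> W) :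
  affine f -> affine (fun x => - f x).
Proof.
by move=> af x y n; have [u ->] := af x y n; exists (- u); rewrite opprD mulNrn.
Qed.
Lemma affine_mulmx (V : zmodType) m n (A : 'M[int]_(m, n)) (f : V -> 'cV[int]_n) :
  affine f -> affine (fun x => A *m f x).
Proof.
move=> af x y k; have [u ->] := af x y k.
by exists (A *m u); rewrite mulmxDr raddfMn.
Qed.

End Periodic.

Section Average.
Variable R : realType.
Local Notation C := R[i].
Variable n : nat.
Implicit Types f g : 'cV[int]_n -> C.

Definition box M (k : {ffun 'I_n -> 'I_M}) : 'cV[int]_n := \col_i (k i : nat)%:Z.

Definition mean M f : C := (M%:R ^- n) * \sum_(k : {ffun 'I_n -> 'I_M}) f (box k).

(* Independent of the chosen period; junk when [f] has none. *)
Definition Av f : C := mean (xget 1%N [set M | (0 < M)%N /\ period M f]) f.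

Lemma period_eq M f (x y : 'cV[int]_n) :
  period M f -> (forall i, (M %| (x i ord0 - y i ord0)%R)%Z) -> f x = f y.
Proof.
move=> pf xy.
have -> : x = y + (\col_i divz (x i 0 - y i 0) M) *+ M.
  apply/matrixP => i j; rewrite ord1 !mxE mulmxnE mxE -mulr_natr -[_%:R]/(M%:R).
  by rewrite natz divzK // addrC subrK.
by rewrite pf.
Qed.

(** Residues modulo [M * K] are written [a + M b], and a function of period [M] sees only [a]. This
    makes [Av] independent of the period. *)
Lemma mean_mul M K f : (0 < M)%N -> (0 < K)%N -> period M f -> mean (M * K) f = mean M f.
Proof.
move=> M0 K0 pf; rewrite /mean.
have lt (a : 'I_M) (b : 'I_K) : (a + M * b < M * K)%N.
  rewrite (@leq_trans (M + M * b)%N) ?ltn_add2r //.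
  by rewrite -mulnS leq_mul2l ltn_ord orbT.
pose h (p : {ffun 'I_n -> 'I_M} * {ffun 'I_n -> 'I_K}) : {ffun 'I_n -> 'I_(M * K)} :=
  [ffun i => Ordinal (lt (p.1 i) (p.2 i))].
have ltm (a : 'I_(M * K)) : (a %% M < M)%N by rewrite ltn_mod.
have ltd (a : 'I_(M * K)) : (a %/ M < K)%N by rewrite ltn_divLR // [(K * M)%N]mulnC ltn_ord.
pose h' (k : {ffun 'I_n -> 'I_(M * K)}) : {ffun 'I_n -> 'I_M} * {ffun 'I_n -> 'I_K} :=
  ([ffun i => Ordinal (ltm (k i))], [ffun i => Ordinal (ltd (k i))]).
rewrite (reindex h) /=; last first.
  exists h' => k _.
    case: k => a b; rewrite /h' /h /=; congr pair; apply/ffunP => i; rewrite !ffunE;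
      apply/val_inj => /=; rewrite ?ffunE /= addnC mulnC.
      by rewrite modnMDl modn_small.
    by rewrite divnMDl // divn_small // addn0.
  apply/ffunP => i; rewrite !ffunE; apply/val_inj => /=; rewrite ?ffunE /=.
  by rewrite addnC mulnC -divn_eq.
rewrite -(pair_bigA _ (fun a b => f (box (h (a, b))))) /=.
under eq_bigr => a _.
  under eq_bigr => b _.
    rewrite (_ : f _ = f (box a)); first over.
    apply: (period_eq pf) => i; rewrite !mxE !ffunE /=.
    by rewrite PoszD addrC addKr PoszM dvdz_mulr.
  rewrite sumr_const cardT -cardE card_ffun !card_ord; over.
rewrite /= sumrMnl -[X in _ * X = _]mulr_natr natrX natrM exprMn invfM mulrCA -!mulrA.
rewrite mulVf; first by rewrite mulr1 mulrC.
by rewrite expf_eq0 pnatr_eq0 (gtn_eqF K0) andbF.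
Qed.

Lemma AvE M f : (0 < M)%N -> period M f -> Av f = mean M f.
Proof.
move=> M0 pf; rewrite /Av; case: xgetP => [K _ [K0 pK]|/(_ M)[]//].
by rewrite -(mean_mul _ M0 pK) // mulnC mean_mul.
Qed.

Lemma eq_Av f g : f =1 g -> Av f = Av g.
Proof. by move=> /funext ->. Qed.

Lemma Av_cst c : Av (fun=> c) = c.
Proof.
rewrite (@AvE 1) // /mean expr1n invr1 mul1r sumr_const card_ffun !card_ord.
by rewrite exp1n mulr1n.
Qed.

Lemma AvD f g : per f -> per g -> Av (fun x => f x + g x) = Av f + Av g.
Proof.
move=> [M M0 pf] [K K0 pg]; have MK : (0 < M * K)%N by rewrite muln_gt0 M0.
have pf' := period_mull K pf; have pg' := period_mulr M pg.
rewrite (AvE MK pf') (AvE MK pg') (AvE MK); last first.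
  by move=> x y; rewrite pf' pg'.
by rewrite /mean big_split mulrDr.
Qed.

Lemma AvZ c f : per f -> Av (fun x => c * f x) = c * Av f.
Proof.
move=> [M M0 pf]; rewrite (AvE M0 pf) (AvE M0) => [|x y]; last by rewrite pf.
by rewrite /mean mulrCA [in RHS]mulr_sumr.
Qed.

Lemma AvZr c f : per f -> Av (fun x => f x * c) = Av f * c.
Proof. by move=> pf; rewrite mulrC -AvZ //; apply: eq_Av => x; rewrite mulrC. Qed.

Lemma Av_conj f : per f -> (Av f)^* = Av (fun x => (f x)^*).
Proof.
move=> [M M0 pf]; rewrite (AvE M0 pf) (AvE M0) => [|x y]; last by rewrite pf.
by rewrite /mean rmorphM rmorph_sum fmorphV rmorphXn rmorph_nat.
Qed.

(* A substitution that preserves congruences and is invertible permutes the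
   residues. *)
Lemma Av_bij f (phi psi : 'cV[int]_n -> 'cV[int]_n) :
  affine phi -> affine psi -> cancel phi psi -> cancel psi phi -> per f ->
  Av (fun x => f (phi x)) = Av f.
Proof.
move=> aphi apsi phiK psiK [M M0 pf].
have pfphi : period M (fun x => f (phi x)).
  by move=> x y; have [z ->] := aphi x y M; rewrite pf.
rewrite (AvE M0 pf) (AvE M0 pfphi) /mean; congr (_ * _).
case: M M0 pf pfphi => // M M0 pf pfphi.
pose red (x : 'cV[int]_n) : {ffun 'I_n -> 'I_M.+1} :=
  [ffun i => inord (absz (modz (x i 0) M.+1))].
have redE x : exists z, x = box (red x) + z *+ M.+1.
  exists (\col_i divz (x i 0) M.+1); apply/matrixP => i j.
  rewrite ord1 !mxE mulmxnE !mxE ffunE inordK; last first.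
    by rewrite -ltz_nat gez0_abs ?modz_ge0 // ltz_mod.
  rewrite gez0_abs ?modz_ge0 // -mulr_natr natz addrC -divz_eq //.
have boxK k x : red (box k + x *+ M.+1) = k.
  apply/ffunP => i; rewrite ffunE !mxE mulmxnE; apply: val_inj.
  rewrite -[X in _ + X]mulr_natr natz addrC modzMDl modz_small ?absz_nat ?inord_val //.
  by rewrite lez_nat ltz_nat ltn_ord.
rewrite [RHS](reindex (fun k : {ffun 'I_n -> 'I_M.+1} => red (phi (box k)))) /=; last first.
  exists (fun k : {ffun 'I_n -> 'I_M.+1} => red (psi (box k))) => k _.
    have [z ez] := redE (phi (box k)).
    have [w ew] := apsi (box (red (phi (box k)))) z M.+1.
    rewrite -[RHS](boxK _ (- w)); congr red; apply/eqP.
    by rewrite mulNrn eq_sym subr_eq -ew -ez phiK.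
  have [z ez] := redE (psi (box k)).
  have [w ew] := aphi (box (red (psi (box k)))) z M.+1.
  rewrite -[RHS](boxK _ (- w)); congr red; apply/eqP.
  by rewrite mulNrn eq_sym subr_eq -ew -ez psiK.
by apply: eq_bigr => k _; have [z ->] := redE (phi (box k)); rewrite pf boxK.
Qed.

Lemma Av_transl f z : per f -> Av (fun x => f (x + z)) = Av f.
Proof.
move=> pf; apply: (@Av_bij f (fun x => x + z) (fun x => x - z)) => //.
- by apply: affine_add; [apply: affine_id|apply: affine_cst].
- by apply: affine_add; [apply: affine_id|apply: affine_cst].
- by move=> x; rewrite addrK.
- by move=> x; rewrite subrK.
Qed.

Lemma Av_opp f : per f -> Av (fun x => f (- x)) = Av f.
Proof.
move=> pf; apply: (@Av_bij f (fun x => - x) (fun x => - x)) => //;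
  try exact/affine_opp/affine_id; exact: opprK.
Qed.

Lemma Av_indicator_gt0 (b : 'cV[int]_n -> bool) :
  per b -> b 0 -> 0 < Av (fun x => (b x)%:R).
Proof.
move=> [M M0 pb] b0; have p : period M (fun x => (b x)%:R : C).
  by move=> x y; rewrite pb.
rewrite (AvE M0 p) /mean mulr_gt0 ?invr_gt0 ?exprn_gt0 ?ltr0n //.
case: M M0 pb p => // M _ _ _.
rewrite (bigD1 [ffun=> ord0]) //=.
have -> : box [ffun=> ord0 : 'I_M.+1] = 0.
  by apply/matrixP => i j; rewrite !mxE ffunE.
by rewrite b0 ltr_wpDr // sumr_ge0 // => k _; rewrite ler0n.
Qed.

End Average.

(** Joint periodicity supplies one modulus for both variables, so both sides are finite sums over
    the same boxes. *)
Lemma Av_Fubini (R : realType) m n (f : 'cV[int]_m -> 'cV[int]_n -> R[i]) :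
  per (fun p : 'cV[int]_m * 'cV[int]_n => f p.1 p.2) ->
  Av (fun x => Av (f x)) = Av (fun y => Av (f^~ y)).
Proof.
move=> [M M0 pf].
have p1 y : period M (f^~ y).
  by move=> x z; have := pf (x, y) (z, 0); rewrite /= !raddfMn /= mul0rn addr0.
have p2 x : period M (f x).
  by move=> y z; have := pf (x, y) (0, z); rewrite /= !raddfMn /= mul0rn addr0.
have e1 : (fun x => Av (f x)) = (fun x => mean M (f x)).
  by apply/funext => x; rewrite (AvE M0).
have e2 : (fun y => Av (f^~ y)) = (fun y => mean M (f^~ y)).
  by apply/funext => y; rewrite (AvE M0).
rewrite e1 e2 (AvE M0); last first.
  by move=> x z; rewrite /mean; under eq_bigr => k _ do rewrite p1.
rewrite (AvE M0); last first.
  by move=> x z; rewrite /mean; under eq_bigr => k _ do rewrite p2.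
rewrite /mean -!mulr_sumr exchange_big /=.
by rewrite !mulrA [_^-1 * _^-1]mulrC.
Qed.

Lemma mean1 (R : realType) M (f : 'cV[int]_1 -> R[i]) :
  mean M f = M%:R^-1 * \sum_(a < M) f (a : nat)%:Z%:M.
Proof.
rewrite /mean expr1; congr (_ * _).
rewrite (reindex (fun a : 'I_M => [ffun=> a] : {ffun 'I_1 -> 'I_M})) /=; last first.
  exists (fun k : {ffun 'I_1 -> 'I_M} => k ord0) => k _; first by rewrite ffunE.
  by apply/ffunP => i; rewrite ffunE (ord1 i).
apply: eq_bigr => a _; congr f; apply/matrixP => i j.
by rewrite !ord1 !mxE ffunE.
Qed.

Lemma Av_split (R : realType) m n (f : 'cV[int]_(m + n) -> R[i]) :
  per f -> Av f = Av (fun x => Av (fun y => f (col_mx x y))).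
Proof.
move=> [M M0 pf].
have p1 x : period M (fun y => f (col_mx x y)).
  move=> y z; rewrite -(pf (col_mx x y) (col_mx 0 z)); congr f.
  by rewrite -[col_mx 0 z *+ M]scaler_nat scale_col_mx !scaler_nat mul0rn add_col_mx addr0.
have e1 : (fun x => Av (fun y => f (col_mx x y))) = fun x => mean M (fun y => f (col_mx x y)).
  by apply/funext => x; rewrite (AvE M0).
rewrite e1 (AvE M0 pf) (AvE M0); last first.
  move=> x z; rewrite /mean; congr (_ * _); apply: eq_bigr => k _.
  rewrite -(pf (col_mx x _) (col_mx z 0)); congr f.
  by rewrite -[col_mx z 0 *+ M]scaler_nat scale_col_mx !scaler_nat mul0rn add_col_mx addr0.
rewrite /mean -!mulr_sumr mulrA -invfM -exprD; congr (_^-1 * _).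
pose h (p : {ffun 'I_m -> 'I_M} * {ffun 'I_n -> 'I_M}) : {ffun 'I_(m + n) -> 'I_M} :=
  [ffun i : 'I_(m + n) => match fintype.split i with inl a => p.1 a | inr b => p.2 b end].
pose h' (k : {ffun 'I_(m + n) -> 'I_M}) : {ffun 'I_m -> 'I_M} * {ffun 'I_n -> 'I_M} :=
  ([ffun i => k (lshift n i)], [ffun i => k (rshift m i)]).
rewrite (reindex h) /=; last first.
  exists h' => k _.
    case: k => a b; congr pair; apply/ffunP => i; rewrite !ffunE.
      by rewrite (unsplitK (inl i)).
    by rewrite (unsplitK (inr i)).
  apply/ffunP => i; rewrite ffunE /=; case: splitP => j e; rewrite ffunE;
    congr (k _); exact: val_inj.
rewrite -(pair_bigA _ (fun a b => f (box (h (a, b))))) /=.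
apply: eq_bigr => a _; apply: eq_bigr => b _; congr f.
apply/colP => i; rewrite !mxE ffunE /=.
by case: splitP => j _; rewrite mxE.
Qed.

Lemma Av_prod (R : realType) n (g : 'I_n -> 'cV[int]_1 -> R[i]) :
  (forall i, per (g i)) ->
  Av (fun x : 'cV[int]_n => \prod_i g i (x i 0)%:M) = \prod_i Av (g i).
Proof.
move=> pg.
have [M M0 pM] : exists2 M, (0 < M)%N & forall i, period M (g i).
  have [K KP] : exists K : 'I_n -> nat, forall i, (0 < K i)%N /\ period (K i) (g i).
    have h i : exists K, (0 < K)%N /\ period K (g i).
      by have [K] := pg i; exists K.
    by have [K KP] := boolp.choice h; exists K.
  exists (\prod_i K i)%N; first by rewrite prodn_gt0 // => i; case: (KP i).
  by move=> i; rewrite (bigD1 i) //=; apply: period_mull; case: (KP i).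
rewrite (AvE M0); last first.
  move=> x y; apply: eq_bigr => i _; rewrite -[RHS](pM i _ (y i 0)%:M); congr (g i _).
  by apply/matrixP => a b; rewrite !ord1 !mxE mulmxnE mulmxnE mxE !mulr1n.
under [RHS]eq_bigr => i _ do rewrite (AvE M0 (pM i)) mean1.
rewrite /mean big_split /= prodr_const card_ord exprVn bigA_distr_bigA /=.
by congr (_ * _); apply: eq_bigr => k _; apply: eq_bigr => i _; rewrite mxE.
Qed.

(** * Rational bilinear forms on integral vectors *)

Definition bf m n (S : 'M[rat]_(m, n)) (x : 'cV[int]_m) (y : 'cV[int]_n) : rat :=
  ((map_mx intr x)^T *m S *m map_mx intr y) 0 0.

Section BilinearForm.
Variables (m n : nat).
Implicit Types (S : 'M[rat]_(m, n)) (x : 'cV[int]_m) (y : 'cV[int]_n).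

Lemma bfDl S x x' y : bf S (x + x') y = bf S x y + bf S x' y.
Proof. by rewrite /bf map_mxD linearD /= !mulmxDl mxE. Qed.
Lemma bfDr S x y y' : bf S x (y + y') = bf S x y + bf S x y'.
Proof. by rewrite /bf map_mxD mulmxDr mxE. Qed.
Lemma bfNl S x y : bf S (- x) y = - bf S x y.
Proof. by rewrite /bf map_mxN linearN /= !mulNmx mxE. Qed.
Lemma bfNr S x y : bf S x (- y) = - bf S x y.
Proof. by rewrite /bf map_mxN mulmxN mxE. Qed.
Lemma bf0l S y : bf S 0 y = 0.
Proof. by rewrite /bf map_mx0 trmx0 !mul0mx mxE. Qed.
Lemma bf0r S x : bf S x 0 = 0.
Proof. by rewrite /bf map_mx0 mulmx0 mxE. Qed.
Lemma bfMnl S x y k : bf S (x *+ k) y = bf S x y *+ k.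
Proof. by elim: k => [|k IH]; rewrite ?bf0l // !mulrS bfDl IH. Qed.
Lemma bfMnr S x y k : bf S x (y *+ k) = bf S x y *+ k.
Proof. by elim: k => [|k IH]; rewrite ?bf0r // !mulrS bfDr IH. Qed.
Lemma bfMzl S x y (k : int) : bf S (x *~ k) y = k%:~R * bf S x y.
Proof.
case: k => k; first by rewrite -pmulrn bfMnl mulr_natl.
by rewrite NegzE mulrNz bfNl -pmulrn bfMnl -mulr_natl intrN mulNr.
Qed.
Lemma bfMzr S x y (k : int) : bf S x (y *~ k) = k%:~R * bf S x y.
Proof.
case: k => k; first by rewrite -pmulrn bfMnr mulr_natl.
by rewrite NegzE mulrNz bfNr -pmulrn bfMnr -mulr_natl intrN mulNr.
Qed.
Lemma bfZ (c : rat) S x y : bf (c *: S) x y = c * bf S x y.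
Proof. by rewrite /bf -scalemxAr -scalemxAl mxE. Qed.
Lemma bf_int (A : 'M[int]_(m, n)) x y : bf (map_mx intr A) x y \is a Num.int.
Proof.
rewrite /bf map_trmx -!map_mxM mxE; exact: intr_int.
Qed.
Lemma bf_tr S x y : bf S^T y x = bf S x y.
Proof.
rewrite /bf -[in RHS](trmxK (_ *m _)) [RHS]mxE !trmx_mul trmxK.
by rewrite mulmxA.
Qed.
End BilinearForm.

Lemma bfC n (S : 'M[rat]_n) x y : S^T = S -> bf S x y = bf S y x.
Proof. by move=> e; rewrite -{1}e bf_tr. Qed.

Lemma bf_mull m n k (S : 'M[rat]_(m, n)) (A : 'M[int]_(m, k)) x y :
  bf S (A *m x) y = bf ((map_mx intr A)^T *m S) x y.
Proof. by rewrite /bf map_mxM trmx_mul !mulmxA. Qed.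
Lemma bf_mulr m n k (S : 'M[rat]_(m, n)) (A : 'M[int]_(n, k)) x y :
  bf S x (A *m y) = bf (S *m map_mx intr A) x y.
Proof. by rewrite /bf map_mxM !mulmxA. Qed.

Lemma common_denominator m n (S : 'M[rat]_(m, n)) :
  exists2 D, (0 < D)%N & exists A, S *+ D = map_mx intr A.
Proof.
pose N := \prod_i \prod_j denq (S i j).
have N0 : 0 < N by apply: prodr_gt0 => i _; apply: prodr_gt0 => j _.
have NE : (absz N)%:R = N%:~R :> rat.
  by rewrite -[in RHS](gez0_abs (ltW N0)) -pmulrn.
exists (absz N); first by rewrite absz_gt0 gt_eqF.
exists (\matrix_(i, j) (numq (S i j) * (\prod_(j' | j' != j) denq (S i j')) *
                  \prod_(i' | i' != i) \prod_j' denq (S i' j'))).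
apply/matrixP => i j; rewrite mulmxnE !mxE -mulr_natr NE.
rewrite /N (bigD1 i) //= (bigD1 (F := fun j => denq (S i j)) j) //=.
rewrite !rmorphM /= !mulrA; congr (_ * _ * _).
by rewrite -[X in X * _](divq_num_den (S i j)) mulfVK ?intr_eq0 ?denq_neq0.
Qed.

(** If [D S] is integral, moving both arguments by multiples of [D] changes the form by an
    integer. *)
Lemma per_er_bf (R : realType) (V : zmodType) m n (S : 'M[rat]_(m, n))
    (phi : V -> 'cV[int]_m) (psi : V -> 'cV[int]_n) :
  affine phi -> affine psi -> per (fun v => er R (bf S (phi v) (psi v))).
Proof.
move=> aphi apsi; have [D D0 [A eA]] := common_denominator S.
exists D => // x y; have [u ->] := aphi x y D; have [v ->] := apsi x y D.
apply: er_congr; rewrite !(bfDl, bfDr, bfMnl, bfMnr).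
have E a b : bf S a b *+ D = bf (map_mx intr A) a b.
  by rewrite -eA -scaler_nat bfZ mulr_natl.
have aux (a b c : rat) : a + b + c - a = b + c by ring.
by rewrite !E aux !rpredD ?rpredMn ?bf_int.
Qed.

Section PeriodicPhases.
Variables (R : realType) (V : zmodType).
Local Notation C := R[i].
Lemma per_mul (f g : V -> C) : per f -> per g -> per (fun x => f x * g x).
Proof. exact: per_op. Qed.
Lemma per_er_add (f g : V -> rat) : per (fun x => er R (f x)) ->
  per (fun x => er R (g x)) -> per (fun x => er R (f x + g x)).
Proof.
move=> pf pg; apply: eq_ind (per_mul pf pg) _ _; apply/funext => x.
by rewrite erD.
Qed.
Lemma per_er_opp (f : V -> rat) : per (fun x => er R (f x)) ->
  per (fun x => er R (- f x)).
Proof.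
move=> pf; apply: eq_ind (per_comp (fun z : C => z^-1) pf) _ _; apply/funext => x.
by rewrite erN.
Qed.
Lemma per_er_scale (c : rat) m n (S : 'M[rat]_(m, n))
    (phi : V -> 'cV[int]_m) (psi : V -> 'cV[int]_n) :
  affine phi -> affine psi -> per (fun v => er R (c * bf S (phi v) (psi v))).
Proof.
move=> aphi apsi; apply: eq_ind (per_er_bf R (c *: S) aphi apsi) _ _.
by apply/funext => v; rewrite bfZ.
Qed.
End PeriodicPhases.

Ltac affine_tac :=
  cbv beta;
  lazymatch goal with
  | |- affine (fun x => x) => exact: affine_id
  | |- affine (fun x => x.1) => exact: affine_fst
  | |- affine (fun x => x.2) => exact: affine_snd
  | |- affine (fun x => @?f x + @?g x) =>
      apply: (@affine_add _ _ f g); affine_tac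
  | |- affine (fun x => - @?f x) => apply: (@affine_opp _ _ f); affine_tac
  | |- affine (fun x => ?A *m @?f x) =>
      apply: (@affine_mulmx _ _ _ A f); affine_tac
  | |- affine (mulmx ?A) => apply: (@affine_mulmx _ _ _ A id); exact: affine_id
  | |- affine _ => exact: affine_cst
  | _ => idtac
  end.

(** Periodicity is recognized from the shape of the exponent; for this reason exponents are at times
    expanded into sums of scaled values of [bf]. *)
Ltac per_tac :=
  cbv beta;
  lazymatch goal with
  | |- per (fun x => er ?R (@?f x + @?g x)) =>
      apply: (@per_er_add R _ f g); per_tac
  | |- per (fun x => er ?R (- @?f x)) => apply: (@per_er_opp R _ f); per_tac
  | |- per (fun x => er ?R (?c * bf ?S (@?f x) (@?g x))) =>
      apply: (@per_er_scale R _ c _ _ S f g); affine_tac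
  | |- per (fun x => er ?R (bf ?S (@?f x) (@?g x))) =>
      apply: (@per_er_bf R _ _ _ S f g); affine_tac
  | |- per (fun x => @?f x * @?g x) => apply: (@per_mul _ _ f g); per_tac
  | |- per _ => first [exact: per_cst | idtac]
  | _ => idtac
  end.

(* Translating by a basis vector multiplies the average by the value of the
   character there. *)
Lemma Av_char (R : realType) m n (S : 'M[rat]_(m, n)) (x : 'cV[int]_m) :
  Av (fun z => er R (bf S x z)) =
  [forall i, ((map_mx intr x)^T *m S) 0 i \is a Num.int]%:R.
Proof.
have pe : per (fun z => er R (bf S x z)) by per_tac.
have vi (z : 'cV[int]_n) : bf S x z = \sum_i ((map_mx intr x)^T *m S) 0 i * (z i 0)%:~R.
  by rewrite /bf mxE; apply: eq_bigr => i _; rewrite [X in _ * X]mxE.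
case: forallP => [vint|/forallP]; last rewrite negb_forall => /existsP[i ni].
  rewrite -[RHS](@Av_cst R n); apply: eq_Av => z; apply: er_int_num.
  by rewrite vi rpred_sum // => i _; rewrite rpredM ?intr_int.
have := Av_transl (\col_j (j == i)%:Z) pe.
under eq_Av => z do rewrite bfDr erD.
rewrite AvZr // => /eqP; rewrite -{2}[Av _]mulr1 -subr_eq0 -mulrBr mulf_eq0.
case/orP => [/eqP //|]; rewrite subr_eq0 => /eqP /er_eq1.
rewrite vi (bigD1 i) //= mxE eqxx mulr1 big1 ?addr0 => [e|j /negPf ji].
  by rewrite e in ni.
by rewrite mxE ji mulr0.
Qed.

(** * Densities of sublattices *)

Section LatticeDensity.
Variable R : realType.
Local Notation C := R[i].

Definition inlat n (U : 'M[int]_n) (a : 'cV[int]_n) : bool :=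
  `[< exists z, a = U *m z >].

(** The density of the sublattice [U Z^n]; for nonzero determinant it is the inverse of the index,
    by [kap_card]. *)
Definition kap n (U : 'M[int]_n) : C := Av (fun a => (inlat U a)%:R).

Lemma inlatD n (U : 'M[int]_n) a z : inlat U (a + U *m z) = inlat U a.
Proof.
apply/asboolP/asboolP => -[w e].
  by exists (w - z); rewrite mulmxBr -e addrK.
by exists (w + z); rewrite mulmxDr -e.
Qed.

Section Nondegenerate.
Variables (n : nat) (U : 'M[int]_n).
Hypothesis U0 : \det U != 0.

Lemma mulmx_int_inj (x y : 'cV[int]_n) : U *m x = U *m y -> x = y.
Proof.
move=> e; apply/eqP; rewrite -subr_eq0.
have : \adj U *m (U *m (x - y)) = 0 by rewrite mulmxBr e subrr mulmx0.
rewrite mulmxA mul_adj_mx mul_scalar_mx => /eqP; rewrite scalemx_eq0 (negPf U0) //.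
Qed.

(* [det U * y = U (adj U y)] is a period. *)
Lemma per_lat (T : Type) (f : 'cV[int]_n -> T) :
  (forall x z, f (x + U *m z) = f x) -> per f.
Proof.
move=> fU; exists (absz (\det U)); first by rewrite absz_gt0.
move=> x y; rewrite -[RHS](fU x (\adj U *m (sgz (\det U) *: y))).
rewrite mulmxA mul_mx_adj mul_scalar_mx scalerA mulrC -abszEsg.
by rewrite -scaler_nat natz.
Qed.

Lemma per_inlat : per (inlat U).
Proof. by apply: per_lat => x z; rewrite inlatD. Qed.

Lemma per_inlatC : per (fun a => (inlat U a)%:R : C).
Proof. exact: (per_comp (fun b : bool => b%:R) per_inlat). Qed.

Lemma inlat_mul x : inlat U (U *m x).
Proof. by apply/asboolP; exists x. Qed.

(** Translations by [U z] fix the indicator. Averaging over [z] first replaces [G] by its average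
    along a coset, which on [U Z^n] itself no longer depends on the point. *)
Lemma Av_inlat (G : 'cV[int]_n -> C) : per G ->
  Av (fun a => (inlat U a)%:R * G a) = kap U * Av (fun x => G (U *m x)).
Proof.
move=> pG; have pIG := per_mul per_inlatC pG.
have pGU : per (fun x => G (U *m x)) by apply: (@per_affine _ _ _ (mulmx U)) pG; affine_tac.
transitivity (Av (fun z => Av (fun a => (inlat U (a + U *m z))%:R * G (a + U *m z)))).
  rewrite -[LHS](@Av_cst R n); apply: eq_Av => z.
  by rewrite (@Av_transl _ _ (fun a => (inlat U a)%:R * G a)).
rewrite -(@Av_Fubini _ _ _ (fun a z => (inlat U (a + U *m z))%:R * G (a + U *m z))); last first.
  by apply: (@per_affine _ _ _ (fun p : 'cV[int]_n * 'cV[int]_n => p.1 + U *m p.2)) pIG; affine_tac.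
rewrite /kap -AvZr //; last exact: per_inlatC.
apply: eq_Av => a; under eq_Av => z do rewrite inlatD.
have [/asboolP[b ->]|_] := boolP (inlat U a); last first.
  by rewrite mul0r -[RHS](@Av_cst R n); apply: eq_Av => z; rewrite mul0r.
rewrite mul1r -[RHS](Av_transl b pGU); apply: eq_Av => z.
by rewrite mul1r mulmxDr addrC.
Qed.

Lemma kap_gt0 : 0 < kap U.
Proof.
apply: Av_indicator_gt0; first exact: per_inlat.
by apply/asboolP; exists 0; rewrite mulmx0.
Qed.

(** The bridge from sums over [H_1] to averages: [f] is the sum over the cosets of its value times
    the indicator, and each coset has density [kap U] by translation. *)
Lemma sum_latq (f : 'cV[int]_n -> C) : (forall x z, f (x + U *m z) = f x) ->
  kap U * \sum_(a \in [set: latq U]) f (rep a) = Av f.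
Proof.
move=> fU; have fin := latq_finite U0.
have pf := per_lat fU.
have pa (a : latq U) : per (fun x => (inlat U (x - rep a))%:R : C).
  by apply: per_lat => x z; rewrite addrAC inlatD.
have e x : f x = \sum_(a <- finmap.enum_fset (fset_set [set: latq U])) (inlat U (x - rep a))%:R
  * f (rep a).
  rewrite (bigD1_seq (\pi_(latq U) x)%qT) ?finmap.fset_uniq //=; last first.
    by rewrite in_fset_set // inE.
  have /latqP[z ez] : (\pi_(latq U) x == \pi_(latq U) (rep (\pi_(latq U) x)))%qT.
    by rewrite /rep reprK.
  have -> : inlat U (x - rep (\pi_(latq U) x)%qT) by apply/asboolP; exists z.
  rewrite mul1r big1 ?addr0 => [|a ax].
    by rewrite -[RHS](fU _ z) -ez addrC subrK.
  rewrite /inlat; case: asboolP => [[w ew]|_]; last by rewrite mul0r.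
  case/eqP: ax; rewrite -[a]reprK; apply/esym/eqP/latqP; by exists w.
rewrite fsbig_finite // mulr_sumr.
rewrite [RHS](eq_Av (g := fun x =>
  \sum_(a <- finmap.enum_fset (fset_set [set: latq U])) (inlat U (x - rep a))%:R * f (rep a))) //.
elim: (finmap.enum_fset _) => [|a s IH].
  by rewrite big_nil -[LHS](@Av_cst R n); apply: eq_Av => x; rewrite big_nil.
rewrite big_cons IH; under [RHS]eq_Av => x do rewrite big_cons.
rewrite AvD; last 2 first.
- by apply: (@per_op _ _ _ _ (fun u v => u * v)) => //; exact: per_cst.
- elim: s {IH} => [|b s IHs].
    by under eq_fun => x do rewrite big_nil; exact: per_cst.
  under eq_fun => x do rewrite big_cons.
  by apply: per_op => //; apply: (@per_op _ _ _ _ (fun u v => u * v)) => //; exact: per_cst.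
congr (_ + _); rewrite AvZr //; congr (_ * _).
by rewrite (Av_transl (- rep a) per_inlatC).
Qed.

Lemma kap_card : kap U * (size (finmap.enum_fset (fset_set [set: latq U])))%:R = 1.
Proof.
rewrite -[RHS](@Av_cst R n) -(sum_latq (f := fun=> 1)) //; congr (_ * _).
rewrite fsbig_finite; last exact: latq_finite.
by rewrite big_const_seq count_predT iter_addr_0.
Qed.

End Nondegenerate.

(** [Av_inlat] for [U], applied to the indicator of [U V Z^n]; injectivity of [U] identifies the
    pulled-back indicator with that of [V Z^n]. *)
Lemma kapM n (U V : 'M[int]_n) : \det U != 0 -> \det V != 0 ->
  kap (U *m V) = kap U * kap V.
Proof.
move=> U0 V0; have UV0 : \det (U *m V) != 0 by rewrite det_mulmx mulf_neq0.
rewrite /kap [X in _ * X](eq_Av (g := fun x => (inlat (U *m V) (U *m x))%:R)); last first.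
  move=> x; congr (nat_of_bool _)%:R; apply/asboolP/asboolP => -[z e].
    by exists z; rewrite e mulmxA.
  by exists z; apply: (mulmx_int_inj U0); rewrite e mulmxA.
rewrite -[X in X * _]/(kap U) -(Av_inlat U0 (G := fun a => (inlat (U *m V) a)%:R));
  last exact: per_inlatC.
apply: eq_Av => a; have [/asboolP[z ->]|_] := boolP (inlat (U *m V) a); last by rewrite mulr0.
by rewrite -mulmxA inlat_mul mul1r.
Qed.

End LatticeDensity.

(** * Gauss sums and Milgram's formula *)

Section RogersSzego.
Variables (F : fieldType) (q : F).
Local Notation x := (q ^+ 2).

(** Gaussian binomial coefficients with base [q ^+ 2], defined by one of their two Pascal rules so
    that they make sense at roots of unity; [qb_pascal] is the other rule. *)
Fixpoint qb (m j : nat) : F :=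
  match m, j with
  | _, 0%N => 1
  | 0%N, _.+1 => 0
  | m'.+1, j'.+1 => qb m' j' + x ^+ j'.+1 * qb m' j'.+1
  end.

Lemma qb0 m : qb m 0 = 1. Proof. by case: m. Qed.

Lemma qb_small m j : (m < j)%N -> qb m j = 0.
Proof.
elim: m j => [|m IH] [|j] //= lt.
by rewrite !IH ?mulr0 ?addr0 // ltnW.
Qed.

(** The ratio of consecutive coefficients, kept free of division because the denominators may
    vanish. *)
Lemma qb_step m j : (j <= m)%N ->
  (1 - x ^+ j.+1) * qb m j.+1 = (1 - x ^+ (m - j)) * qb m j.
Proof.
elim: m j => [|m IH] j; first by case: j => // _ /=; rewrite subrr mulr0 mul0r.
move=> jm; have [e|ne] := eqVneq j m.+1.
  by rewrite e qb_small // subnn expr0 subrr mulr0 mul0r.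
have {ne jm}jm : (j <= m)%N by rewrite -ltnS ltn_neqAle ne.
have -> : (1 - x ^+ j.+1) * qb m.+1 j.+1 = (1 - x ^+ m.+1) * qb m j.
  rewrite /= mulrDr mulrCA IH // mulrCA mulrA -mulrDl; congr (_ * _).
  have -> : m.+1 = (j.+1 + (m - j))%N by lia.
  by rewrite exprD; move: (x ^+ j.+1) (x ^+ (m - j)) => a b; ring.
case: j jm => [|j] jm; first by rewrite !qb0 subn0.
rewrite /= subSS mulrDr; have := IH j (ltnW jm).
move=> e; rewrite -e mulrCA mulrA -mulrDl; congr (_ * _).
have -> : m.+1 = (j.+1 + (m - j))%N by lia.
by rewrite exprD; move: (x ^+ j.+1) (x ^+ (m - j)) => a b; ring.
Qed.

Lemma qb_pascal m j : (j <= m)%N ->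
  qb m.+1 j.+1 = x ^+ (m - j) * qb m j + qb m j.+1.
Proof.
move=> /qb_step; rewrite [qb _.+1 _]/=.
move: (x ^+ j.+1) (x ^+ (m - j)) (qb m j) (qb m j.+1) => a b u v e.
apply: (addIr (- (a * v) - b * u)); transitivity ((1 - b) * u); first by ring.
by rewrite -e; ring.
Qed.

(** The Rogers-Szego polynomial of base [q ^+ 2] factors at the argument [q]. The two sums agree by
    symmetry of the coefficients, but the induction step of each one uses both, through the two
    Pascal rules. *)
Lemma rogers_szego m :
  \sum_(j < m.+1) q ^+ j * qb m j = \prod_(1 <= k < m.+1) (1 + q ^+ k) /\
  \sum_(j < m.+1) q ^+ (m - j) * qb m j = \prod_(1 <= k < m.+1) (1 + q ^+ k).
Proof.
elim: m => [|m [IHa IHb]].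
  by rewrite !big_ord1 big_nil /= !expr0 mulr1.
have shift : \sum_(j < m.+1) q ^+ j.+1 * qb m j.+1 = \prod_(1 <= k < m.+1) (1 + q ^+ k) - 1.
  rewrite -IHa big_ord_recr /= qb_small // mulr0 addr0 [in RHS]big_ord_recl /=.
  by rewrite qb0 expr0 mulr1 addrC addKr.
rewrite big_nat_recr //; set P := \prod_(_ <= _ < _) _ in IHa IHb shift *.
split; rewrite big_ord_recl qb0 ?subn0 mulr1 ?expr0.
  under eq_bigr => j _ do rewrite lift0 (qb_pascal (leq_ord j)) mulrDr.
  rewrite big_split /= shift.
  have -> : \sum_(i < m.+1) q ^+ i.+1 * (x ^+ (m - i) * qb m i) = q ^+ m.+1 * P.
    rewrite -IHb mulr_sumr; apply: eq_bigr => i _; rewrite !mulrA; congr (_ * _).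
    have im : (i <= m)%N by rewrite -ltnS.
    rewrite -exprM -!exprD; congr (_ ^+ _); lia.
  by ring.
under eq_bigr => j _ do rewrite lift0 [qb _.+1 _]/= mulrDr.
rewrite big_split /=.
have -> : \sum_(i < m.+1) q ^+ (m.+1 - i.+1) * qb m i = P.
  by rewrite -IHb; apply: eq_bigr => i _; rewrite subSS.
have -> : \sum_(i < m.+1) q ^+ (m.+1 - i.+1) * (x ^+ i.+1 * qb m i.+1) = q ^+ m.+1 * (P - 1).
  rewrite -shift mulr_sumr; apply: eq_bigr => i _; rewrite !mulrA; congr (_ * _).
  have im : (i <= m)%N by rewrite -ltnS.
  rewrite -exprM -!exprD; congr (_ ^+ _); lia.
by ring.
Qed.

(** At a primitive root of order [n.+1] the power [x ^+ (n - j)] is inverse to [x ^+ j.+1], so the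
    ratio in [qb_step] becomes minus a power of [x]. The coefficients turn into signed powers of [q]
    with quadratic exponent. *)
Lemma qb_root n j : q != 0 -> x ^+ n.+1 = 1 ->
  (forall i, (0 < i < n.+1)%N -> x ^+ i != 1) -> (j <= n)%N ->
  qb n j * q ^+ (j * j.+1) = (-1) ^+ j.
Proof.
move=> q0 xn xi; elim: j => [|j IH] jn; first by rewrite qb0 mul1r.
have ne : 1 - x ^+ j.+1 != 0 by rewrite subr_eq0 eq_sym xi.
apply: (mulfI ne); rewrite mulrA qb_step ?(ltnW jn) //.
have -> : (j.+1 * j.+2 = j * j.+1 + 2 * j.+1)%N by lia.
rewrite exprD [q ^+ (2 * _)]exprM -[LHS]mulrA [qb _ _ * _]mulrA IH 1?ltnW //.
have e : (1 - x ^+ (n - j)) * x ^+ j.+1 = - (1 - x ^+ j.+1).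
  rewrite mulrBl -exprD mul1r; have -> : (n - j + j.+1 = n.+1)%N by lia.
  by rewrite xn opprB.
by rewrite [(-1) ^+ j * _]mulrC mulrA e [(-1) ^+ j.+1]exprS mulN1r mulrN mulNr.
Qed.

(* Gauss: for even moduli the theta-like sum at a root of unity is a product
   whose factors have visible arguments. *)
Lemma gauss_product n : q != 0 -> x ^+ n.+1 = 1 ->
  (forall i, (0 < i < n.+1)%N -> x ^+ i != 1) ->
  \sum_(j < n.+1) (-1) ^+ j / q ^+ (j * j) = \prod_(1 <= k < n.+1) (1 + q ^+ k).
Proof.
move=> q0 xn xi; have [<- _] := rogers_szego n; apply: eq_bigr => j _.
rewrite -(qb_root q0 xn xi (leq_ord j)) mulnS exprD mulrA mulfK ?expf_neq0 //.
by rewrite mulrC.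
Qed.
End RogersSzego.

Section GaussSum.
Variable R : realType.
Local Notation C := R[i].
Local Notation er := (er R).

(** A nonzero number of argument [2 pi t]: moduli are absorbed and arguments add as rationals. *)
Definition posarg (z : C) (t : rat) := exists2 c : C, 0 < c & z = c * er t.

Lemma posarg1 : posarg 1 0.
Proof. by exists 1; rewrite ?er0 ?mulr1. Qed.

Lemma posargM z w s t : posarg z s -> posarg w t -> posarg (z * w) (s + t).
Proof.
move=> [c c0 ->] [d d0 ->]; exists (c * d); first exact: mulr_gt0.
by rewrite erD; ring.
Qed.

Lemma posarg_conj z t : posarg z t -> posarg z^* (- t).
Proof.
move=> [c c0 ->]; exists c => //; rewrite rmorphM /= conj_er.
by congr (_ * _); apply/CrealP; rewrite realE ltW.
Qed.

Lemma posarg_prod (I : Type) (s : seq I) (P : pred I) (F : I -> C) (t : I -> rat) :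
  (forall i, P i -> posarg (F i) (t i)) ->
  posarg (\prod_(i <- s | P i) F i) (\sum_(i <- s | P i) t i).
Proof.
by move=> h; apply: big_rec2 => [|i x y Pi]; [apply: posarg1|apply/posargM/h].
Qed.

Lemma er_cos_sin t :
  er t = (cos (2 * pi * ratr t) +i* sin (2 * pi * ratr t))%C.
Proof. by rewrite erE e2piE. Qed.

Lemma erN_cos_sin t :
  er (- t) = (cos (2 * pi * ratr t) -i* sin (2 * pi * ratr t))%C.
Proof. by rewrite er_cos_sin rmorphN /= mulrN cosN sinN. Qed.

(** Halving the angle: [1 + er (- 2 t)] is [er (- t)] times twice a cosine, positive in the given
    range. The lemma for [1 - er (- 2 t)] has a sine instead. *)
Lemma posarg_one_plus (t : rat) : 0 <= t < 1 / 4 -> posarg (1 + er (- (2 * t))) (- t).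
Proof.
move=> /andP[t0 t4]; exists (er t + er (- t)); last first.
  by rewrite [RHS]mulrDl -!erD subrr er0; congr (_ + er _); ring.
rewrite erN_cos_sin er_cos_sin.
have -> : forall a b : R, (a +i* b)%C + (a -i* b)%C = ((a + a)%:C)%C :> C.
  by move=> a b; apply/eqP; rewrite eq_complex /= subrr !eqxx.
rewrite ltcR -mulr2n pmulrn_lgt0 //; apply: cos_gt0_pihalf.
have p0 := pi_gt0 R; have t0' : 0 <= ratr t :> R by rewrite ler0q.
have t4' : ratr t < 1 / 4 :> R.
  by have := t4; rewrite -(ltr_rat R) fmorph_div /= rmorph1 rmorph_nat.
apply/andP; split; nra.
Qed.

Lemma posarg_one_minus (t : rat) : 0 < t < 1 / 2 ->
  posarg (1 - er (- (2 * t))) (1 / 4 - t).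
Proof.
move=> /andP[t0 t4]; exists ((er t - er (- t)) / er (1 / 4)); last first.
  rewrite erD [er (1 / 4) * _]mulrC mulrA [RHS]mulrAC mulfVK ?er_neq0 //.
  by rewrite [RHS]mulrBl -!erD subrr er0; congr (_ - er _); ring.
have -> : er (1 / 4) = ('i)%C.
  by rewrite /er fmorph_div /= rmorph1 rmorph_nat e2pi_quarter.
rewrite erN_cos_sin er_cos_sin.
have -> : forall a b : R, ((a +i* b)%C - (a -i* b)%C) / ('i)%C = ((b + b)%:C)%C :> C.
  move=> a b; apply: (mulIf (neq0Ci _)); rewrite mulfVK ?neq0Ci //.
  by apply/eqP; rewrite eq_complex /=; apply/andP; split; apply/eqP; ring.
rewrite ltcR -mulr2n pmulrn_lgt0 //; apply: sin_gt0_pi.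
have p0 := pi_gt0 R; have t0' : 0 < ratr t :> R by rewrite ltr0q.
have t4' : ratr t < 1 / 2 :> R.
  by have := t4; rewrite -(ltr_rat R) fmorph_div /= rmorph1 rmorph_nat.
apply/andP; split; nra.
Qed.

Lemma gauss_sum (d : nat) : (0 < d)%N ->
  posarg (\sum_(j < 2 * d) er (j%:R ^+ 2 / (4 * d%:R))) (1 / 8).
Proof.
move=> d0; have dr : d%:R != 0 :> rat by rewrite pnatr_eq0 -lt0n.
(* [q ^+ 2] is a primitive root of order [2 d], and the sign in [q] turns [(-1) ^+ j / q ^+ (j * j)]
   into the summand [er (j ^+ 2 / (4 d))]. *)
pose q := - er (- (1 / (4 * d%:R))).
have q0 : q != 0 by rewrite oppr_eq0 er_neq0.
have qk k : q ^+ k = (-1) ^+ k * er (- (k%:R / (4 * d%:R))).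
  rewrite (_ : - (k%:R / _) = (- (1 / (4 * d%:R))) *+ k); last by rewrite -mulr_natl; ring.
  by rewrite (erMn R _ k) /q (exprNn (er _)).
have x1 : (q ^+ 2) ^+ (2 * d).-1.+1 = 1.
  rewrite prednK ?muln_gt0 // -exprM qk -signr_odd oddM /= expr0 mul1r.
  have -> : - ((2 * (2 * d))%N%:R / (4 * d%:R)) = (-1)%:~R :> rat.
    by rewrite !natrM; field.
  by rewrite er_int.
have xi i : (0 < i < (2 * d).-1.+1)%N -> (q ^+ 2) ^+ i != 1.
  rewrite prednK ?muln_gt0 // => /andP[i0 id].
  rewrite -exprM qk -signr_odd oddM /= expr0 mul1r; apply/eqP => /er_eq1.
  rewrite rpredN => /intrP[k]; rewrite natrM => e.
  have e2 : (i%:Z = k * (2 * d%:Z)).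
    apply: (@intr_inj rat); rewrite rmorphM /= -e rmorphM /= -!pmulrn.
    by rewrite natrD; field.
  have k0 : 0 < k by move: e2; nia.
  move: e2; nia.
have := gauss_product q0 x1 xi; rewrite prednK ?muln_gt0 //.
rewrite (eq_bigr (fun j : 'I__ => er (j%:R ^+ 2 / (4 * d%:R)))); last first.
  move=> j _; rewrite qk -[(-1) ^+ (j * j)]signr_odd oddM andbb signr_odd.
  rewrite erN invfM invrK mulrA divff ?expf_neq0 ?oppr_eq0 ?oner_eq0 // mul1r.
  by rewrite natrM expr2.
(* [t k] is the argument of the factor [1 + q ^+ k]. The [d] odd indices contribute [d / 4], the
   linear terms [- (2 d - 1) / 8], in total [1 / 8]. *)
move=> ->; pose t k : rat := (odd k)%:R / 4 - k%:R / (8 * d%:R).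
have -> : 1 / 8 = \sum_(1 <= k < 2 * d) t k.
  have [m dm] : exists m, d = m.+1 by case: d d0 {dr q q0 qk x1 xi t} => // m _; exists m.
  have aux m' c : c != 0 -> \sum_(1 <= k < 2 * m'.+1) ((odd k)%:R / 4 - k%:R / c) =
    (m'.+1)%:R / 4 - (m'.+1)%:R * (2 * m'.+1)%:R / c + (m'.+1)%:R / c :> rat.
    move=> c0; elim: m' => [|m' IH]; first by rewrite big_nat1 /= muln1; field.
    have -> : (2 * m'.+2 = (2 * m'.+1).+2)%N by lia.
    move: IH; have Ko : odd (2 * m'.+1) = false by rewrite oddM.
    have KE : (2 * m'.+1)%:R = 2 * (m'%:R + 1) :> rat by rewrite natrM -[m'.+1]addn1 natrD.
    move: (2 * m'.+1)%N Ko KE (isT : (0 < 2 * m'.+1)%N) => K Ko KE K0 IH.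
    rewrite big_nat_recr; last exact: ltnW.
    rewrite big_nat_recr //= IH Ko /= -[K.+2]addn2 -[K.+1]addn1 !natrD KE.
    by rewrite -[m'.+2]addn2 -[m'.+1]addn1 !natrD; field.
  rewrite {1}dm (aux m (8 * d%:R)); last by rewrite mulf_neq0.
  by rewrite -dm natrM; field; exact: dr.
rewrite !big_nat; apply: posarg_prod => k /andP[k1 kd].
have dp : 0 < d%:R :> rat by rewrite ltr0n.
have kp : 0 < k%:R :> rat by rewrite ltr0n.
have kd' : k%:R < 2 * d%:R :> rat by rewrite -natrM ltr_nat.
have e : - (k%:R / (4 * d%:R)) = - (2 * (k%:R / (8 * d%:R))) :> rat by field.
have tp : 0 < (k%:R / (8 * d%:R) : rat) < 1 / 4.
  rewrite divr_gt0 ?mulr_gt0 //= ltr_pdivrMr ?mulr_gt0 //; lra.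
rewrite qk -signr_odd e /t; case: (odd k) => /=.
  by rewrite expr1 mulN1r; apply: posarg_one_minus; move: tp; lra.
by rewrite expr0 mul1r mul0r add0r; apply: posarg_one_plus; move: tp; lra.
Qed.

Lemma Av_gauss_pos (d : nat) : (0 < d)%N ->
  posarg (Av (fun u : 'cV[int]_1 => er ((u 0 0)%:~R ^+ 2 / (4 * d%:R)))) (1 / 8).
Proof.
move=> d0; have dr : d%:R != 0 :> rat by rewrite pnatr_eq0 -lt0n.
rewrite (@AvE _ _ (2 * d)) ?muln_gt0 //; last first.
  move=> u w; apply: er_congr; rewrite !mxE mulmxnE.
  set a : int := u 0 0; set b : int := w 0 0.
  rewrite (_ : _ - _ = (a * b + d%:Z * b ^+ 2)%:~R) ?intr_int //.
  have -> : b *+ (2 * d) = b * (2%:Z * d%:Z) by rewrite -mulr_natr natz PoszM.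
  rewrite !expr2 !(intrD, intrM) -[d%:~R]/(d%:R) -[2%:~R]/(2%:R); field.
  exact: dr.
rewrite mean1; have [c c0 e] := gauss_sum d0.
exists ((2 * d)%:R^-1 * c); first by rewrite mulr_gt0 // invr_gt0 ltr0n muln_gt0.
rewrite -mulrA -e; congr (_ * _); apply: eq_bigr => j _.
by rewrite !mxE mulr1n.
Qed.

Lemma per_er_sq (c : rat) : per (fun u : 'cV[int]_1 => er ((u 0 0)%:~R ^+ 2 / c)).
Proof.
apply: eq_ind (@per_er_scale R _ c^-1 _ _ 1%:M id id (@affine_id _) (@affine_id _)) _ _.
apply/funext => u; congr er; rewrite mulrC /bf mulmx1 !mxE big_ord1 !mxE.
by rewrite expr2.
Qed.

Lemma Av_gauss (m : int) : m != 0 ->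
  posarg (Av (fun u : 'cV[int]_1 => er ((u 0 0)%:~R ^+ 2 / (4 * m%:~R)))) ((sgz m)%:~R / 8).
Proof.
case: (ltrgt0P m) => // [m0|m0] _.
  have -> : m = (absz m)%:Z by rewrite gtz0_abs.
  have d0 : (0 < absz m)%N by rewrite absz_gt0 gt_eqF.
  by rewrite gtr0_sgz //; apply: Av_gauss_pos.
have -> : m = - (absz m)%:Z by rewrite ltz0_abs // opprK.
set d := absz m; have d0 : (0 < d)%N by rewrite absz_gt0 lt_eqF.
rewrite ltr0_sgz ?oppr_lt0 // rmorphN /= mulNr; have := posarg_conj (Av_gauss_pos d0).
congr (posarg _ _); rewrite Av_conj; last exact: per_er_sq.
by apply: eq_Av => u; rewrite conj_er; congr er; rewrite mulrN invrN mulrN.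
Qed.

End GaussSum.

Section Inverse.
Variables (n : nat) (B : 'M[int]_n) (Bi : 'M[rat]_n).
Hypothesis BBi : map_mx intr B *m Bi = 1%:M.

Lemma mulVmx_int : Bi *m map_mx intr B = 1%:M.
Proof. exact: mulmx1C. Qed.

Lemma det_inv_neq0 : \det B != 0.
Proof.
have := congr1 determinant BBi; rewrite det_mulmx det1 det_map_mx /= => e.
apply/eqP => d0; move: e; rewrite d0 rmorph0 mul0r => /eqP.
by rewrite eq_sym oner_eq0.
Qed.

Lemma sym_inv : B^T = B -> Bi^T = Bi.
Proof.
move=> Bs; have e : Bi^T *m map_mx intr B = 1%:M.
  by rewrite -Bs -map_trmx -trmx_mul BBi trmx1.
by rewrite -[LHS]mulmx1 -BBi mulmxA e mul1mx.
Qed.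

Lemma inlatP a :
  reflect (forall i, (Bi *m map_mx intr a) i 0 \is a Num.int) (inlat B a).
Proof.
apply: (iffP (asboolP _)) => [[z ->] i|h].
  by rewrite map_mxM mulmxA mulVmx_int mul1mx mxE intr_int.
exists (\col_i Num.floor ((Bi *m map_mx intr a) i 0)).
suff : map_mx intr a = map_mx intr (B *m \col_i Num.floor ((Bi *m map_mx intr a) i 0)) :>
  'cV[rat]_n.
  by move=> e; apply/matrixP => i j; have := congr1 (fun X : 'cV[rat]_n => X i j) e;
    rewrite !mxE => /intr_inj.
have e : map_mx intr (\col_i Num.floor ((Bi *m map_mx intr a) i 0)) = Bi *m map_mx intr a.
  by apply/matrixP => i j; rewrite mxE [X in X%:~R]mxE ord1 floorK.
by rewrite map_mxM e mulmxA BBi mul1mx.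
Qed.

Lemma Av_char_inlat (R : realType) z :
  Av (fun x => er R (bf Bi x z)) = (inlat B z)%:R.
Proof.
transitivity (Av (fun x => er R (bf Bi^T z x))).
  by apply: eq_Av => x; rewrite bf_tr.
rewrite Av_char; congr (nat_of_bool _)%:R.
have e : (map_mx intr z)^T *m Bi^T = (Bi *m map_mx intr z)^T by rewrite trmx_mul.
apply/forallP/inlatP => h i; first by have := h i; rewrite e mxE.
by rewrite e mxE.
Qed.
End Inverse.

(** * Gauss sums of even forms *)

Section Milgram.
Variable R : realType.
Local Notation C := R[i].
Local Notation er := (er R).

(** With [Qi] the inverse of an even form [Q], the Gauss sum of its discriminant form divided by the
    order of the discriminant group. *)
Definition gam N (Qi : 'M[rat]_N) : C := Av (fun u => er (1 / 2 * bf Qi u u)).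

Section EvenForm.
Variables (N : nat) (Q : 'M[int]_N) (Qi : 'M[rat]_N).
Hypothesis QQi : map_mx intr Q *m Qi = 1%:M.
Hypothesis Qsym : Q^T = Q.
Hypothesis Qeven : forall z, 1 / 2 * bf (map_mx intr Q) z z \is a Num.int.

Let Q0 : \det Q != 0. Proof. exact: det_inv_neq0 QQi. Qed.
Let Qis : Qi^T = Qi. Proof. exact: sym_inv QQi Qsym. Qed.

(** In the double average for the squared modulus put [u = a + z]. Averaging over [a] restricts [z]
    to [Q Z^N], where evenness makes the remaining phase trivial. *)
Lemma gam_norm : gam Qi * (gam Qi)^* = kap R Q.
Proof.
have pe : per (fun u : 'cV[int]_N => er (1 / 2 * bf Qi u u)) by per_tac.
rewrite mulrC /gam Av_conj // -AvZr; last exact: (per_comp (fun z : C => z^*) pe).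
transitivity (Av (fun a => Av (fun z => er (1 / 2 * bf Qi z z) * er (bf Qi a z)))).
  apply: eq_Av => a; rewrite -(Av_transl a pe) -AvZ; last first.
    by apply: (@per_affine _ _ _ (fun z => z + a)) pe; affine_tac.
  apply: eq_Av => z; rewrite conj_er -!(erD R); congr er.
  by rewrite !(bfDl, bfDr) (bfC a z Qis); field.
rewrite (@Av_Fubini _ _ _ (fun a z => er (1 / 2 * bf Qi z z) * er (bf Qi a z))); last by per_tac.
transitivity (Av (fun z => (inlat Q z)%:R * er (1 / 2 * bf Qi z z))).
  apply: eq_Av => z; rewrite AvZ; last by per_tac.
  by rewrite (Av_char_inlat QQi) mulrC.
rewrite (Av_inlat Q0 pe) -[RHS]mulr1; congr (_ * _); rewrite -[RHS](@Av_cst R N).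
apply: eq_Av => z; apply: er_int_num; have := Qeven z.
by rewrite bf_mull bf_mulr -mulmxA (mulVmx_int QQi) mulmx1 map_trmx Qsym.
Qed.

Section Sublattice.
Variables (U : 'M[int]_N) (Ui : 'M[rat]_N).
Hypothesis UUi : map_mx intr U *m Ui = 1%:M.

(** [Ui *m Qi *m Ui^T] is the inverse of the restricted form [U^T Q U]. A translation by [U^T Q z]
    leaves the average unchanged but multiplies the summand by a character in [z]; averaging over
    [z] confines [a] to [U^T Z^N], where the form becomes [Qi]. *)
Lemma gam_sublattice : gam (Ui *m Qi *m Ui^T) = kap R U^T * gam Qi.
Proof.
have UiU := mulVmx_int UUi.
have UTi : map_mx intr U^T *m Ui^T = 1%:M by rewrite -map_trmx -trmx_mul UiU trmx1.
have iUT : Ui^T *m map_mx intr U^T = 1%:M by exact: mulmx1C.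
set Q' := Ui *m Qi *m Ui^T.
have pe : per (fun u : 'cV[int]_N => er (1 / 2 * bf Q' u u)) by per_tac.
transitivity (Av (fun z => Av (fun a => er (1 / 2 * bf Q' a a) * er (bf Ui a z)))).
  rewrite -[LHS](@Av_cst R N); apply: eq_Av => z.
  rewrite /gam -(Av_transl (U^T *m (Q *m z)) pe); apply: eq_Av => a.
  rewrite -(erD R); apply: er_congr; rewrite !(bfDl, bfDr).
  have e1 : bf Q' a (U^T *m (Q *m z)) = bf Ui a z.
    rewrite bf_mulr bf_mulr; congr (bf _ a z).
    by rewrite /Q' -!mulmxA [Ui^T *m _]mulmxA iUT mul1mx (mulVmx_int QQi) mulmx1.
  have e2 : bf Q' (U^T *m (Q *m z)) a = bf Ui a z.
    rewrite -e1 bfC // /Q' !trmx_mul trmxK Qis mulmxA //.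
  have e3 : bf Q' (U^T *m (Q *m z)) (U^T *m (Q *m z)) = bf (map_mx intr Q) z z.
    rewrite bf_mulr bf_mulr bf_mull bf_mull; congr (bf _ z z).
    rewrite /Q' -!mulmxA [Ui^T *m _]mulmxA iUT mul1mx (mulVmx_int QQi) mulmx1.
    by rewrite !map_trmx Qsym trmxK UUi mulmx1.
  rewrite e1 e2 e3.
  rewrite (_ : _ - _ = 1 / 2 * bf (map_mx intr Q) z z); [exact: Qeven|by field].
rewrite -(@Av_Fubini _ _ _ (fun a z => er (1 / 2 * bf Q' a a) * er (bf Ui a z))); last by per_tac.
transitivity (Av (fun a => (inlat U^T a)%:R * er (1 / 2 * bf Q' a a))).
  apply: eq_Av => a; rewrite AvZ; last by per_tac.
  have e : Av (fun z => er (bf Ui a z)) = (inlat U^T a)%:R.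
    rewrite -(@Av_char_inlat _ _ _ UTi R a); apply: eq_Av => z.
    by rewrite bf_tr.
  by rewrite e mulrC.
rewrite (Av_inlat (det_inv_neq0 UTi) pe).
have e x : bf Q' (U^T *m x) (U^T *m x) = bf Qi x x.
  rewrite bf_mull bf_mulr map_trmx trmxK /Q' -!mulmxA iUT mulmx1.
  by rewrite mulmxA UUi mul1mx.
rewrite (@eq_Av _ _ _ (fun x => er (1 / 2 * bf Qi x x))) // => x.
by rewrite e.
Qed.

Variable d : 'rV[int]_N.
Hypothesis UQU : U^T *m Q *m U = diag_mx d.

(* Milgram's formula, with the signature read off a diagonalization over the
   rationals: a sublattice of finite index changes the Gauss sum by a positive
   factor, and for a diagonal form it is a product of classical sums. *)
Lemma milgram : exists2 c : C, 0 < c /\ c ^+ 2 = kap R Q &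
  gam Qi = c * er (\sum_i (sgz (d 0 i))%:~R / 8).
Proof.
have UTi : map_mx intr U^T *m Ui^T = 1%:M.
  by rewrite -map_trmx -trmx_mul (mulVmx_int UUi) trmx1.
have k0 : 0 < kap R U^T by apply: kap_gt0; exact: det_inv_neq0 UTi.
have dE i : (d 0 i)%:~R = bf (map_mx intr Q) (U *m delta_mx i 0) (U *m delta_mx i 0) :> rat.
  rewrite bf_mull bf_mulr map_trmx -!map_mxM UQU /bf map_diag_mx map_delta_mx.
  by rewrite trmx_delta -rowE -colE !mxE eqxx mulr1n.
(* The diagonal entries are values of an even form, so the one-dimensional sums have the
   denominators [4 m] required by [Av_gauss]. *)
have deven i : exists m, d 0 i = 2 * m.
  have /intrP[m e] := Qeven (U *m delta_mx i 0); exists m.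
  apply: (@intr_inj rat); rewrite intrM -e dE -[2%:~R]/(2%:R); by field.
have d0 i : d 0 i != 0.
  have : \det (diag_mx d) != 0.
    rewrite -UQU !det_mulmx det_tr !mulf_neq0 //; exact: det_inv_neq0 UUi.
  by rewrite det_diag => /prodf_neq0/(_ i isT).
pose di : 'rV[rat]_N := \row_i ((d 0 i)%:~R)^-1.
have diE : Ui *m Qi *m Ui^T = diag_mx di.
  have e1 : diag_mx (map_mx intr d) *m diag_mx di = 1%:M.
    apply/matrixP => i j; rewrite mulmx_diag !mxE divff ?intr_eq0 //.
  have e2 : Ui *m Qi *m Ui^T *m diag_mx (map_mx intr d) = 1%:M.
    rewrite -map_diag_mx -UQU !map_mxM -!mulmxA [Ui^T *m _]mulmxA.
    rewrite (mulmx1C UTi) mul1mx [Qi *m _]mulmxA (mulVmx_int QQi) mul1mx.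
    exact: mulVmx_int UUi.
  by rewrite -[LHS]mulmx1 -e1 mulmxA e2 mul1mx.
have : posarg (gam (diag_mx di)) (\sum_i (sgz (d 0 i))%:~R / 8).
  pose g i (u : 'cV[int]_1) := er ((u 0 0)%:~R ^+ 2 / (2 * (d 0 i)%:~R)).
  have -> : gam (diag_mx di) = \prod_i Av (g i).
    rewrite -Av_prod => [|i]; last exact: per_er_sq.
    apply: eq_Av => u; rewrite -(er_sum R); congr er.
    rewrite /bf mxE mulr_sumr; apply: eq_bigr => i _.
    rewrite mul_mx_diag !mxE mulr1n; field.
    by rewrite ?intr_eq0 d0.
  apply: posarg_prod => i _; have [m em] := deven i.
  have m0 : m != 0 by have := d0 i; rewrite em mulf_eq0 negb_or => /andP[].
  have -> : sgz (d 0 i) = sgz m by rewrite em sgzM gtr0_sgz ?mul1r.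
  rewrite (_ : Av (g i) = Av (fun u : 'cV[int]_1 => er ((u 0 0)%:~R ^+ 2 / (4 * m%:~R)))).
    exact: Av_gauss.
  by apply: eq_Av => u; rewrite /g em intrM mulrA -[2%:~R]/(2%:R) -natrM.
rewrite -diE gam_sublattice => -[c c0 e].
have ge : gam Qi = (kap R U^T)^-1 * c * er (\sum_i (sgz (d 0 i))%:~R / 8).
  by rewrite -mulrA -e mulrA mulVf ?gt_eqF // mul1r.
exists ((kap R U^T)^-1 * c) => //; have c0' : 0 < (kap R U^T)^-1 * c by rewrite mulr_gt0 ?invr_gt0.
split=> //; rewrite -gam_norm ge rmorphM /= conj_er mulrACA -(erD R) subrr er0 mulr1.
by rewrite expr2; congr (_ * _); apply/esym/CrealP; rewrite realE ltW.
Qed.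
End Sublattice.
End EvenForm.
End Milgram.

(** * Reciprocity *)

Lemma bf_block m1 m2 n1 n2 (A11 : 'M[rat]_(m1, n1)) A12 A21
    (A22 : 'M[rat]_(m2, n2)) x y u v :
  bf (block_mx A11 A12 A21 A22) (col_mx x y) (col_mx u v) =
  bf A11 x u + bf A12 x v + bf A21 y u + bf A22 y v.
Proof.
rewrite /bf !map_col_mx tr_col_mx mul_row_block mul_row_col !mulmxDl.
by rewrite mxE [X in X + _]mxE [X in _ + X]mxE; ring.
Qed.

Lemma bfZl m n (S : 'M[rat]_(m, n)) (k : int) x y :
  bf S (k *: x) y = k%:~R * bf S x y.
Proof. by rewrite /bf map_mxZ linearZ /= -!scalemxAl mxE. Qed.

Lemma bfZr m n (S : 'M[rat]_(m, n)) (k : int) x y :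
  bf S x (k *: y) = k%:~R * bf S x y.
Proof. by rewrite /bf map_mxZ -scalemxAr mxE. Qed.

(** The tensor product of the 2 x 2 matrix [[a, b; c, e]] with [M]; products act on the two factors
    separately. *)
Definition blk (T : comNzRingType) m n (a b c e : T) (M : 'M[T]_(m, n)) :
    'M[T]_(m + m, n + n) :=
  block_mx (a *: M) (b *: M) (c *: M) (e *: M).

Lemma blkM (T : comNzRingType) m n q (a b c e a' b' c' e' : T)
    (M : 'M[T]_(m, n)) (N : 'M[T]_(n, q)) :
  blk a b c e M *m blk a' b' c' e' N =
  blk (a * a' + b * c') (a * b' + b * e') (c * a' + e * c') (c * b' + e * e')
      (M *m N).
Proof.
rewrite /blk mulmx_block; congr block_mx;
  by rewrite -!scalemxAl -!scalemxAr !scalerA -scalerDl.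
Qed.

Lemma blk_tr (T : comNzRingType) m n (a b c e : T) (M : 'M[T]_(m, n)) :
  (blk a b c e M)^T = blk a c b e M^T.
Proof. by rewrite /blk tr_block_mx !linearZ. Qed.

Lemma blk_map m n (a b c e : int) (M : 'M[int]_(m, n)) :
  map_mx intr (blk a b c e M) =
  blk a%:~R b%:~R c%:~R e%:~R (map_mx intr M : 'M[rat]_(m, n)).
Proof. by rewrite /blk map_block_mx !map_mxZ. Qed.

Lemma blk1 (T : comNzRingType) n : blk 1 0 0 1 (1%:M : 'M[T]_n) = 1%:M.
Proof. by rewrite /blk !scale1r !scale0r -scalar_mx_block. Qed.

Lemma blk_diag (T : comNzRingType) n (a e : T) (d : 'rV[T]_n) :
  blk a 0 0 e (diag_mx d) = diag_mx (row_mx (a *: d) (e *: d)).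
Proof. by rewrite /blk !scale0r diag_mx_row !linearZ. Qed.

Lemma bf_blk m n (a b c e : rat) (S : 'M[rat]_(m, n)) x y u v :
  bf (blk a b c e S) (col_mx x y) (col_mx u v) =
  a * bf S x u + b * bf S x v + c * bf S y u + e * bf S y v.
Proof. by rewrite bf_block !bfZ. Qed.

Lemma blk_mul_col m n (a b c e : int) (M : 'M[int]_(m, n))
    (x y : 'cV[int]_n) :
  blk a b c e M *m col_mx x y =
  col_mx (a *: (M *m x) + b *: (M *m y)) (c *: (M *m x) + e *: (M *m y)).
Proof. by rewrite /blk mul_block_col -!scalemxAl. Qed.

Section Reciprocity.
Variable R : realType.
Local Notation C := R[i].
Local Notation er := (er R).

Lemma kap_scalar n (p : nat) : (0 < p)%N -> kap R (p%:Z%:M : 'M[int]_n) = (p%:R ^- n : C).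
Proof.
move=> p0; have E (x : 'cV[int]_n) : inlat p%:Z%:M x = [forall i, (p %| (x i 0)%R)%Z].
  apply/asboolP/forallP => [[z ->] i|h]; first by rewrite mul_scalar_mx mxE dvdz_mulr.
  exists (\col_i divz (x i 0) p); rewrite mul_scalar_mx; apply/matrixP => i j.
  by rewrite !mxE ord1 mulrC divzK // h.
rewrite /kap (@AvE _ _ p) //; last first.
  move=> x y; congr (nat_of_bool _)%:R.
  by rewrite -scaler_nat natz -mul_scalar_mx inlatD.
rewrite /mean; case: p p0 E => // p p0 E; rewrite (bigD1 [ffun=> ord0]) //= big1 => [|k k0].
  rewrite addr0 E; case: forallP => [_|[]]; first by rewrite mulr1.
  by move=> i; rewrite !mxE ffunE dvdz0.
rewrite E; case: forallP => // h; case/eqP: k0; apply/ffunP => i; rewrite ffunE.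
apply: val_inj => /=; have := h i; rewrite mxE dvdzE /= => /dvdn_leq kp.
by case: (posnP (k i)) => // /kp; rewrite leqNgt ltn_ord.
Qed.

Lemma kap_unimodular n (U W : 'M[int]_n) : U *m W = 1%:M -> kap R U = 1.
Proof.
move=> UW; rewrite -[RHS](@Av_cst R n); apply: eq_Av => x.
suff -> : inlat U x by [].
by apply/asboolP; exists (W *m x); rewrite mulmxA UW mul1mx.
Qed.

Variables (n : nat) (B : 'M[int]_n) (Bi : 'M[rat]_n).
Hypothesis BBi : map_mx intr B *m Bi = 1%:M.
Hypothesis Bsym : B^T = B.
Variables (U : 'M[int]_n) (Ui : 'M[rat]_n) (d : 'rV[int]_n).
Hypothesis UUi : map_mx intr U *m Ui = 1%:M.
Hypothesis UBU : U^T *m B *m U = diag_mx d.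
Variables (delta j : int) (h p : nat).
Hypothesis delta2 : delta * delta = 1.
Hypothesis h0 : (0 < h)%N.
Hypothesis p0 : (0 < p)%N.
Hypothesis pE : p%:Z = 4 * j * h%:Z + delta.

Let B0 : \det B != 0. Proof. exact: det_inv_neq0 BBi. Qed.

Lemma kap_double : kap R (blk 1 0 0 1 B) = kap R B ^+ 2.
Proof.
have E x y : inlat (blk 1 0 0 1 B) (col_mx x y) = inlat B x && inlat B y.
  apply/asboolP/andP => [[z]|[/asboolP[z ->] /asboolP[w ->]]].
    rewrite -(vsubmxK z) blk_mul_col !scale1r !scale0r addr0 add0r.
    by case/eq_col_mx => -> ->; rewrite !inlat_mul.
  by exists (col_mx z w); rewrite blk_mul_col !scale1r !scale0r addr0 add0r.
have D0 : \det (blk 1 0 0 1 B) != 0.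
  apply: (@det_inv_neq0 _ _ (blk 1 0 0 1 Bi)); rewrite blk_map blkM BBi -blk1;
    congr (blk _ _ _ _ _); rewrite !(intrD, intrM, rmorph1, rmorph0); ring.
rewrite /kap Av_split; last exact: per_inlatC.
have pB := @per_inlatC R _ _ B0.
transitivity (Av (fun x => Av (fun y => (inlat B x)%:R * (inlat B y)%:R : C))).
  by apply: eq_Av => x; apply: eq_Av => y; rewrite E -natrM mulnb.
transitivity (Av (fun x => (inlat B x)%:R * kap R B)).
  by apply: eq_Av => x; rewrite AvZ.
by rewrite AvZr // expr2.
Qed.

Let Q : 'M[int]_(n + n) := blk (- (2 * j)) (-1) (-1) (2 * h%:Z * delta) B.
(** The inverse of the determinant [- delta p] of the 2 x 2 matrix, since [delta * delta = 1]; [Qi]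
    is then the adjugate formula. *)
Let k : rat := - delta%:~R / p%:R.
Let Qi : 'M[rat]_(n + n) :=
  blk (k * 2 * h%:R * delta%:~R) k k (- (2 * j%:~R * k)) Bi.

Let pr0 : p%:R != 0 :> rat. Proof. by rewrite pnatr_eq0 -lt0n. Qed.
Let hr0 : h%:R != 0 :> rat. Proof. by rewrite pnatr_eq0 -lt0n. Qed.
Let d2 : delta%:~R * delta%:~R = 1 :> rat.
Proof. by rewrite -intrM delta2. Qed.
Let pEr : p%:R = 4 * j%:~R * h%:R + delta%:~R :> rat.
Proof. by have := congr1 (intr : int -> rat) pE; rewrite intrD !intrM. Qed.
Let kp : k * (- (4 * j%:~R * h%:R * delta%:~R + 1)) = 1 :> rat.
Proof.
rewrite -[X in _ + X]d2 -mulrDl -pEr /k -[RHS]d2; field; exact: pr0.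
Qed.
Let posz_r (m : nat) : (m%:Z)%:~R = m%:R :> rat. Proof. by []. Qed.
Let intE := (posz_r, intrD, intrM, rmorphN, rmorph1, rmorph0).

Lemma recip_QQi : map_mx intr Q *m Qi = 1%:M.
Proof.
rewrite /Q /Qi blk_map blkM BBi -blk1 !intE /=.
by congr (blk _ _ _ _ _); rewrite -?[RHS]kp; ring.
Qed.

Let Bis : Bi^T = Bi. Proof. exact: sym_inv BBi Bsym. Qed.
Let iBB : Bi *m map_mx intr B = 1%:M. Proof. exact: mulVmx_int BBi. Qed.

Lemma recip_Qsym : Q^T = Q.
Proof. by rewrite /Q blk_tr Bsym. Qed.

Lemma recip_Qeven z : 1 / 2 * bf (map_mx intr Q) z z \is a Num.int.
Proof.
rewrite -(vsubmxK z) /Q blk_map bf_blk.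
set x := usubmx z; set y := dsubmx z.
have -> : bf (map_mx intr B) y x = bf (map_mx intr B) x y.
  by rewrite bfC // map_trmx Bsym.
have := bf_int B x x; have := bf_int B x y; have := bf_int B y y.
move=> /intrP[a ->] /intrP[b ->] /intrP[e ->]; apply/intrP.
exists (- j * e - b + h%:Z * delta * a).
by rewrite !intE /=; field.
Qed.

(** The columns [(2h, delta)] and [(0, 1)] are orthogonal for the 2 x 2 matrix because
    [delta * delta = 1], with norms [- 2 h p] and [2 h delta]; [U] diagonalizes the factor [B]. *)
Let V : 'M[int]_(n + n) := blk (2 * h%:Z) 0 delta 1 U.
Let Vi : 'M[rat]_(n + n) := blk (2 * h%:R)^-1 0 (- (delta%:~R / (2 * h%:R))) 1 Ui.
Let dd : 'rV[int]_(n + n) :=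
  row_mx ((- (2 * h%:Z * p%:Z)) *: d) ((2 * h%:Z * delta) *: d).

Lemma recip_VVi : map_mx intr V *m Vi = 1%:M.
Proof.
rewrite /V /Vi blk_map blkM UUi -blk1 !intE /=.
by congr (blk _ _ _ _ _); field.
Qed.

Lemma recip_VQV : V^T *m Q *m V = diag_mx dd.
Proof.
rewrite /V /Q blk_tr !blkM UBU -blk_diag pE.
congr (blk _ _ _ _ _).
- transitivity (- (8 * h%:Z * h%:Z * j) - 4 * h%:Z * delta + 2 * h%:Z * delta * (delta * delta)).
    by ring.
  by rewrite delta2; ring.
- by transitivity (2 * h%:Z * (delta * delta - 1)); [ring|rewrite delta2; ring].
- by transitivity (2 * h%:Z * (delta * delta - 1)); [ring|rewrite delta2; ring].
- by ring.
Qed.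

Let P : 'M[int]_(n + n) := blk (- (2 * j)) (-1) (-1) (2 * h%:Z * delta) 1%:M.

(* Unimodular row and column operations bring the 2 x 2 matrix to
   [diag(1, p)]. *)
Lemma kap_recip : kap R Q = kap R B ^+ 2 * p%:R ^- n.
Proof.
have -> : Q = blk 1 0 0 1 B *m P.
  by rewrite /P blkM mulmx1 /Q; congr (blk _ _ _ _ _); ring.
have D0 : \det (blk 1 0 0 1 B) != 0.
  apply: (@det_inv_neq0 _ _ (blk 1 0 0 1 Bi)); rewrite blk_map blkM BBi -blk1;
    congr (blk _ _ _ _ _); rewrite !(intrD, intrM, rmorph1, rmorph0); ring.
have P0 : \det P != 0.
  apply: (@det_inv_neq0 _ _ (blk (k * 2 * h%:R * delta%:~R) k k (- (2 * j%:~R * k)) 1%:M)).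
  rewrite /P blk_map blkM map_scalar_mx /= mulmx1 -blk1 !intE /=.
  by congr (blk _ _ _ _ _); rewrite -?[RHS]kp; ring.
rewrite kapM // kap_double; congr (_ * _).
have E (x y : 'cV[int]_n) : inlat P (col_mx x y) = inlat p%:Z%:M (y + (2 * h%:Z * delta) *: x).
  apply/asboolP/asboolP => [[z]|[w e]].
    rewrite -(vsubmxK z) blk_mul_col !mul1mx => /eq_col_mx[-> ->].
    exists (- delta *: usubmx z).
    rewrite mul_scalar_mx pE; apply/matrixP => a b; rewrite !mxE.
    move: (z (lshift n a) b) (z (rshift n a) b) => s t.
    transitivity (- (4 * h%:Z * delta * j) * s - (delta * delta) * s); last by ring.
    by rewrite delta2; ring.
  exists (col_mx (- delta *: w) (- x + (2 * j * delta) *: w)).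
  rewrite blk_mul_col !mul1mx; congr col_mx; apply/matrixP => a b; rewrite !mxE; first by ring.
  have := congr1 (fun M : 'cV[int]_n => M a b) e; rewrite mul_scalar_mx !mxE pE.
  set s : int := x a b; set t : int := y a b; set r : int := w a b => e'.
  transitivity ((4 * j * h%:Z + delta) * r - 2 * h%:Z * delta * s); first by rewrite -e'; ring.
  transitivity (4 * j * h%:Z * (delta * delta) * r + delta * r - 2 * h%:Z * delta * s);
    last by ring.
  by rewrite delta2; ring.
rewrite -kap_scalar // /kap Av_split; last exact: per_inlatC.
have pp : \det (p%:Z%:M : 'M[int]_n) != 0.
  apply: (@det_inv_neq0 _ _ (p%:R^-1)%:M).
  by rewrite map_scalar_mx -scalar_mxM /= -[p%:~R]/(p%:R) divff.
transitivity (Av (fun _ : 'cV[int]_n => kap R (p%:Z%:M : 'M[int]_n))); last by rewrite Av_cst.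
apply: eq_Av => x; rewrite /kap -(Av_transl ((2 * h%:Z * delta) *: x) (@per_inlatC R _ _ pp)).
by apply: eq_Av => y; rewrite E.
Qed.

(** The two diagonal blocks have the signs of [- d_i] and [delta d_i], which gives the exponent; the
    modulus is the positive square root of [kap R Q]. *)
Lemma gam_recip : gam R Qi = kap R B * (sqrtC p%:R) ^- n *
  er (\sum_i (delta%:~R - 1) * (sgz (d 0 i))%:~R / 8).
Proof.
have [c [c0 c2] ->] := milgram R recip_QQi recip_Qsym recip_Qeven recip_VVi recip_VQV.
have s0 : 0 < sqrtC p%:R :> C by rewrite sqrtC_gt0 ltr0n.
congr (_ * er _).
  have k0 := kap_gt0 R B0.
  apply: (@pexpIrn _ 2) => //; rewrite ?nnegrE ?(ltW c0) //.
    by rewrite ltW // mulr_gt0 // invr_gt0 exprn_gt0.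
  have sq : (sqrtC p%:R ^+ n) ^+ 2 = p%:R ^+ n :> C.
    by rewrite -exprM mulnC exprM sqrtCK.
  rewrite c2 kap_recip [RHS]exprMn -sq; congr (_ * _).
  by rewrite exprVn.
rewrite big_split_ord /= -big_split /=; apply: eq_bigr => i _.
rewrite row_mxEl row_mxEr !mxE !sgzM sgzN !sgzM.
have dE : sgz delta = delta.
  have /orP[/eqP->|/eqP->] // : (delta == 1) || (delta == -1).
  by rewrite -sqrf_eq1 expr2 delta2.
have sh : sgz h%:Z = 1 by rewrite gtr0_sgz.
have sp : sgz p%:Z = 1 by rewrite gtr0_sgz.
have s2 : sgz (2 : int) = 1 by [].
rewrite dE sh sp s2 !mul1r mulN1r !intE /=.
by ring.
Qed.

Variable c : 'cV[int]_n.
Let Bq : 'M[rat]_n := map_mx intr B.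
Let one : 'M[rat]_n := map_mx intr (1%:M : 'M[int]_n).
Let cc : 'cV[int]_(n + n) := col_mx c 0.
Let Bi2 : 'M[rat]_(n + n) := blk 1 0 0 1 Bi.
Let B2 : 'M[int]_(n + n) := blk 1 0 0 1 B.
Let QA : 'M[rat]_(n + n) :=
  blk (- (2 * j%:~R)) (-1) (-1) (2 * h%:R * delta%:~R) Bi.

Let BB2 : map_mx intr B2 *m Bi2 = 1%:M.
Proof.
rewrite blk_map blkM BBi -blk1.
by congr (blk _ _ _ _ _); rewrite !(intrD, intrM, rmorph1, rmorph0); ring.
Qed.
Let B20 : \det B2 != 0. Proof. exact: det_inv_neq0 BB2. Qed.
Let Bi2s : Bi2^T = Bi2. Proof. by rewrite /Bi2 blk_tr Bis. Qed.
Let QiP : Qi *m map_mx intr P = Bi2.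
Proof.
rewrite /Qi /P blk_map blkM map_scalar_mx /= mulmx1 !intE /=.
by congr (blk _ _ _ _ _); rewrite -?[RHS]kp; ring.
Qed.
Let PQA : (map_mx intr P)^T *m Bi2 = QA.
Proof.
rewrite /P blk_map blk_tr /Bi2 blkM map_scalar_mx /= trmx1 mul1mx !intE /=.
by congr (blk _ _ _ _ _); ring.
Qed.
Let Qis : Qi^T = Qi. Proof. by rewrite /Qi blk_tr Bis. Qed.

(** The exponent is [h / p] times the norm of [i + B^-1 c] under [B]. *)
Definition gauss_lhs : C := Av (fun i =>
  er (h%:R / p%:R * (bf Bq i i + 2 * bf one i c + bf Bi c c))).

(* Up to the factor [#|H_1|^2], the double sum over [H_1] in the coefficients
   [c_omega], the averages replacing sums over [Z^n / B Z^n]. *)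
Definition gauss_rhs : C := Av (fun a => Av (fun f =>
  er (- (j%:~R * bf Bi a a) - bf Bi a (c + f) + h%:R * delta%:~R * bf Bi f f))).

Let A (z : 'cV[int]_(n + n)) : C := er (1 / 2 * bf QA z z + - bf Bi2 cc z).
Let E (u : 'cV[int]_(n + n)) : C := er (1 / 2 * bf Qi u u).

Let pA : per A. Proof. by rewrite /A; per_tac. Qed.
Let pE' : per E. Proof. by rewrite /E; per_tac. Qed.

Lemma gauss_rhsE : gauss_rhs = Av A.
Proof.
rewrite Av_split //; apply: eq_Av => a; apply: eq_Av => f; congr er.
by rewrite /QA /Bi2 /cc !bf_blk !bf0l bfDr (bfC f a Bis) (bfC c a Bis); field.
Qed.

(* Both sides are the average of [conj (A z) E (u + P z)], which is linear
   in [z]; averaging over [z] first restricts [u] to a coset of [B]. *)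
Lemma recip_dual : gauss_rhs^* * gam R Qi = kap R B ^+ 2 * gauss_lhs^*.
Proof.
rewrite gauss_rhsE Av_conj // -AvZr; last exact: (per_comp (fun z : C => z^*) pA).
transitivity (Av (fun z => Av (fun u => E u * er (bf Bi2 z (u + cc))))).
  apply: eq_Av => z; rewrite /gam -(Av_transl (P *m z) pE') -AvZ; last first.
    by apply: (@per_affine _ _ _ (fun u => u + P *m z)) pE'; affine_tac.
  apply: eq_Av => u; rewrite /A /E conj_er -!(erD R); congr er.
  have e1 v : bf Qi v (P *m z) = bf Bi2 v z by rewrite bf_mulr QiP.
  have e2 : bf Qi (P *m z) u = bf Bi2 z u by rewrite (bfC _ _ Qis) e1 (bfC _ _ Bi2s).
  have e3 : bf Qi (P *m z) (P *m z) = bf QA z z by rewrite e1 bf_mull PQA.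
  by rewrite !bfDl !bfDr e1 e2 e3 (bfC u z Bi2s) (bfC cc z Bi2s); field.
rewrite (@Av_Fubini _ _ _ (fun z u => E u * er (bf Bi2 z (u + cc)))); last first.
  by rewrite /E; per_tac.
transitivity (Av (fun u => (inlat B2 u)%:R * E (u - cc))).
  pose H u : C := (inlat B2 (u + cc))%:R * E u.
  have pH : per H.
    apply: per_mul => //.
    by apply: (@per_affine _ _ _ (fun u => u + cc)) (@per_inlatC R _ _ B20); affine_tac.
  rewrite -[LHS](_ : Av H = _); last first.
    apply: eq_Av => u; rewrite AvZ; last by per_tac.
    by rewrite (Av_char_inlat BB2) mulrC.
  by rewrite -(Av_transl (- cc) pH); apply: eq_Av => u; rewrite /H subrK.
have pEc : per (fun u => E (u - cc)).
  by apply: (@per_affine _ _ _ (fun u => u - cc)) pE'; affine_tac.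
rewrite (Av_inlat B20 pEc) kap_double; congr (_ * _).
rewrite Av_split; last by apply: (@per_affine _ _ _ (mulmx B2)) pEc; affine_tac.
pose W (v1 v2 : 'cV[int]_n) : rat := k * (h%:R * delta%:~R *
  (bf Bq v1 v1 - 2 * bf one v1 c + bf Bi c c) + (bf Bq v1 v2 - bf one v2 c)
  - j%:~R * bf Bq v2 v2).
have b1 x y : bf Bi (B *m x) (B *m y) = bf Bq x y.
  by rewrite bf_mull bf_mulr -mulmxA iBB mulmx1 map_trmx Bsym.
have b2 x : bf Bi (B *m x) c = bf one x c.
  by rewrite bf_mull map_trmx Bsym BBi /one map_scalar_mx.
have b3 x : bf Bi c (B *m x) = bf one x c by rewrite (bfC _ _ Bis) b2.
have WE v1 v2 : E (B2 *m col_mx v1 v2 - cc) = er (W v1 v2).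
  rewrite /E blk_mul_col !scale1r !scale0r addr0 add0r /cc opp_col_mx add_col_mx oppr0 addr0.
  rewrite /Qi bf_blk !(bfDl, bfDr, bfNl, bfNr) !b1 !b2 !b3 (_ : bf Bq v2 v1 = bf Bq v1 v2).
    by congr er; rewrite /W; field.
  by apply: bfC; rewrite map_trmx Bsym.
pose L (x : 'cV[int]_n) : rat := - (h%:R / p%:R * (bf Bq x x - 2 * bf one x c + bf Bi c c)).
(* The shift of [v1] by [2 j v2] decouples the variables: the terms containing [v2] acquire the
   factor [k (4 j h delta + 1) = -1] and become integers. *)
have WL x v2 : er (W (x + (2 * j) *: v2) v2) = er (L x).
  have eZ S (u v : 'cV[int]_n) : bf S ((2 * j) *: u) v = 2 * j%:~R * bf S u v.
    by rewrite bfZl intrM.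
  have eZ' S (u v : 'cV[int]_n) : bf S v ((2 * j) *: u) = 2 * j%:~R * bf S v u.
    by rewrite bfZr intrM.
  apply: er_congr; rewrite /W /L !(bfDl, bfDr) !(eZ, eZ').
  have -> : bf Bq v2 x = bf Bq x v2 by apply: bfC; rewrite map_trmx Bsym.
  rewrite (_ : _ - _ = k * (4 * j%:~R * h%:R * delta%:~R + 1) * (bf Bq x v2
    + j%:~R * bf Bq v2 v2 - bf one v2 c)
     + (h%:R / p%:R) * (1 - delta%:~R * delta%:~R) * (bf Bq x x - 2 * bf one x c + bf Bi c c));
       last first.
    by rewrite /k; field.
  have -> : k * (4 * j%:~R * h%:R * delta%:~R + 1) = -1.
    by apply: oppr_inj; rewrite opprK -mulrN kp.
  rewrite d2 subrr mulr0 mul0r addr0 mulN1r rpredN.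
  by rewrite rpredB ?rpredD ?rpredM ?bf_int ?intr_int.
have pW : per (fun q : 'cV[int]_n * 'cV[int]_n => er (W q.1 q.2)).
  pose F (q : 'cV[int]_n * 'cV[int]_n) := er (
    k * h%:R * delta%:~R * bf Bq q.1 q.1 + - (k * h%:R * delta%:~R * 2) * bf one q.1 c
    + k * h%:R * delta%:~R * bf Bi c c + k * bf Bq q.1 q.2 + - k * bf one q.2 c
    + - (k * j%:~R) * bf Bq q.2 q.2).
  rewrite (_ : (fun q => _) = F); first by rewrite /F; per_tac.
  by apply/funext => q; congr er; rewrite /W; ring.
transitivity (Av (fun v2 : 'cV[int]_n => Av (fun x => er (L x)))).
  transitivity (Av (fun v1 => Av (fun v2 => er (W v1 v2)))).
    by apply: eq_Av => v1; apply: eq_Av => v2; rewrite WE.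
  rewrite (Av_Fubini pW); apply: eq_Av => v2.
  have pW1 : per (fun v1 => er (W v1 v2)).
    apply: (@per_affine _ _ _ (fun v1 => (v1, v2))) pW.
    by move=> x y m; exists (y, 0); congr pair; rewrite /= ?raddfMn ?mul0rn ?addr0.
  by rewrite -(Av_transl ((2 * j) *: v2) pW1); apply: eq_Av => x; rewrite WL.
rewrite Av_cst /gauss_lhs.
have pG : per (fun i => er (h%:R / p%:R * (bf Bq i i + 2 * bf one i c + bf Bi c c))).
  pose F (i : 'cV[int]_n) := er (h%:R / p%:R * bf Bq i i +
    h%:R / p%:R * 2 * bf one i c + h%:R / p%:R * bf Bi c c).
  rewrite (_ : (fun i => _) = F); first by rewrite /F; per_tac.
  by apply/funext => i; congr er; ring.
rewrite Av_conj // -[RHS]Av_opp; last exact: (per_comp (fun z : C => z^*) pG).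
apply: eq_Av => x; rewrite conj_er; congr er.
by rewrite /L !(bfNl, bfNr); ring.
Qed.

(** The conjugate of [recip_dual] with [gam_recip] inserted, after cancelling a factor [kap R B];
    conjugation accounts for the sign of the exponent. *)
Theorem reciprocity :
  kap R B * gauss_lhs = gauss_rhs * (sqrtC p%:R) ^- n *
    er (- (\sum_i (delta%:~R - 1) * (sgz (d 0 i))%:~R / 8)).
Proof.
have k0 := kap_gt0 R B0.
have rC (x : C) : 0 <= x -> x^* = x by move=> x0; apply/CrealP; rewrite realE x0.
have := congr1 (fun z : C => z^*) recip_dual.
rewrite rmorphM /= conjCK gam_recip rmorphM /= conj_er rC; last first.
  by rewrite mulr_ge0 ?(ltW k0) // invr_ge0 exprn_ge0 // sqrtC_ge0 ler0n.
rewrite rmorphM /= conjCK (rC (kap R B ^+ 2)); last by rewrite exprn_ge0 // ltW.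
move=> e; apply: (mulfI (lt0r_neq0 k0)); rewrite mulrA -expr2 -e; ring.
Qed.
End Reciprocity.

(** * The signature *)

Section Diagonalization.
Variable F : numFieldType.

(** A nonzero diagonal entry is moved to the front. If the diagonal vanishes and [A i j] does not,
    the vector [e_i + e_j] has norm [2 A i j], nonzero in characteristic zero. *)
Lemma sym_pivot n (A : 'M[F]_n.+1) : A^T = A -> A != 0 ->
  exists2 P, P \in unitmx & (P^T *m A *m P) 0 0 != 0.
Proof.
move=> As A0.
have tp (M : 'M[F]_n.+1) k : ((tperm_mx 0 k)^T *m M *m tperm_mx 0 k) 0 0 = M k k.
  by rewrite tr_tperm_mx -xrowE -xcolE !mxE !tpermL.
have [i Aii|Aii] := pickP (fun i => A i i != 0).
  exists (tperm_mx 0 i); first exact: unitmx_perm.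
  by rewrite tp.
have [i [j Aij]] : exists i j, A i j != 0.
  case: (pickP (fun q : 'I_n.+1 * 'I_n.+1 => A q.1 q.2 != 0)) => [[i j] h|h]; first by exists i, j.
  by case/eqP: A0; apply/matrixP => i j; rewrite mxE; have /negbFE/eqP := h (i, j).
have ij : i != j by apply: contraNneq Aij => ->; have := Aii j => /negbFE.
pose L : 'M[F]_n.+1 := 1%:M + delta_mx j i.
have LU : L \in unitmx.
  suff /mulmx1_unit[] : L *m (1%:M - delta_mx j i) = 1%:M by [].
  rewrite /L mulmxBr mulmx1 mulmxDl mul1mx mul_delta_mx_cond (negPf ij) mulr0n addr0.
  by rewrite addrK.
exists (L *m tperm_mx 0 i); first by rewrite unitmx_mul LU unitmx_perm.
have -> : (L *m tperm_mx 0 i)^T *m A *m (L *m tperm_mx 0 i) =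
    (tperm_mx 0 i)^T *m (L^T *m A *m L) *m tperm_mx 0 i.
  by rewrite trmx_mul !mulmxA.
rewrite tp.
have Aji : A j i = A i j by rewrite -{1}As mxE.
have A00 k : A k k = 0 by have /negbFE/eqP := Aii k.
suff -> : (L^T *m A *m L) i i = A i j *+ 2 by rewrite mulrn_eq0.
have LT : L^T = 1%:M + delta_mx i j.
  by apply/matrixP => x y; rewrite !mxE andbC eq_sym.
rewrite LT /L mulmxDl mul1mx mulmxDr mulmx1 mulmxDl.
have e1 (M : 'M[F]_n.+1) : (M *m delta_mx j i) i i = M i j.
  rewrite mxE (bigD1 j) //= big1 ?addr0 => [|k kj]; first by rewrite mxE !eqxx mulr1.
  by rewrite mxE (negPf kj) mulr0.
have e2 (M : 'M[F]_n.+1) l : (delta_mx i j *m M) i l = M j l.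
  rewrite mxE (bigD1 j) //= big1 ?addr0 => [|k kj]; first by rewrite mxE !eqxx mul1r.
  by rewrite mxE (negPf kj) andbF mul0r.
rewrite [LHS]mxE [X in X + _]mxE e2 [X in _ + X]mxE !e1 e2 !A00 Aji.
by rewrite add0r addr0 mulr2n.
Qed.

(** Lagrange reduction: a nonzero pivot is split off and the induction continues with its Schur
    complement. *)
Lemma sym_diagonalize n (A : 'M[F]_n) : A^T = A ->
  exists2 P, P \in unitmx & exists e, P^T *m A *m P = diag_mx e.
Proof.
elim: n A => [|n IH] A As.
  by exists 1%:M; rewrite ?unitmx1 //; exists 0; apply/matrixP => -[].
(* The dimension is displayed as [1 + n] so that block decompositions apply. *)
move: A As; change (forall A : 'M[F]_(1 + n), A^T = A ->
  exists2 P : 'M[F]_(1 + n), P \in unitmx &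
    exists e : 'rV[F]_(1 + n), P^T *m A *m P = diag_mx e) => A As.
have [->|A0] := eqVneq A 0.
  by exists 1%:M; rewrite ?unitmx1 //; exists 0; rewrite mulmx0 mul0mx linear0.
have [P Pu P00] : exists2 P : 'M[F]_(1 + n), P \in unitmx & (P^T *m A *m P) 0 0 != 0.
  exact: sym_pivot As A0.
have [A' A'E] : exists A', A' = P^T *m A *m P by eexists.
have A's : A'^T = A' by rewrite A'E !trmx_mul trmxK As mulmxA.
rewrite -A'E in P00.
pose a := A' 0 0; pose b : 'cV[F]_n := dlsubmx (A' : 'M[F]_(1 + n)).
pose D : 'M[F]_n := drsubmx (A' : 'M[F]_(1 + n)).
have A'b : A' = block_mx (a%:M : 'M[F]_1) b^T b D :> 'M[F]_(1 + n).
  rewrite -[LHS](@submxK _ 1 n 1 n); congr block_mx.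
    by apply/matrixP => i j; rewrite !ord1 !mxE; congr (A' _ _); apply: val_inj.
  by rewrite /b trmx_dlsub A's.
pose L : 'M[F]_(1 + n) := block_mx 1%:M (- (a^-1 *: b^T)) 0 1%:M.
have Lu : L \in unitmx by rewrite unitmxE det_ublock !det1 mulr1 unitr1.
have Ds : (D - a^-1 *: (b *m b^T))^T = D - a^-1 *: (b *m b^T).
  by rewrite linearB /= linearZ /= trmx_mul trmxK trmx_drsub A's.
have [Q Qu [e eE]] := IH _ Ds.
pose Q' : 'M[F]_(1 + n) := block_mx 1%:M 0 0 Q.
have Q'u : Q' \in unitmx by rewrite unitmxE /Q' det_ublock det1 mul1r -unitmxE.
exists (P *m (L *m Q')).
  by rewrite !unitmx_mul Pu Lu Q'u.
exists (row_mx (a%:M : 'M[F]_1) e).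
have -> : (P *m (L *m Q'))^T *m A *m (P *m (L *m Q')) = Q'^T *m (L^T *m A' *m L) *m Q'.
  by rewrite A'E !trmx_mul !mulmxA.
have -> : L^T *m A' *m L = block_mx (a%:M : 'M[F]_1) 0 0 (D - a^-1 *: (b *m b^T)).
  rewrite A'b /L tr_block_mx !trmx1 trmx0 linearN /= linearZ /= trmxK.
  rewrite !mulmx_block !mul1mx !mulmx1 !mul0mx !addr0 !mulmx0 ?addr0.
  have ba : (a^-1 *: b) *m (a%:M : 'M[F]_1) = b.
    by rewrite mul_mx_scalar scalerA divff ?scale1r.
  have ab : (a%:M : 'M[F]_1) *m (a^-1 *: b^T) = b^T.
    by rewrite mul_scalar_mx scalerA divff ?scale1r.
  congr block_mx.
  - by rewrite mulmxN ab addrC subrr.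
  - by rewrite mulNmx ba addrC subrr.
  - by rewrite [_ *m a%:M]mulNmx ba addNr mul0mx add0r mulNmx -scalemxAl addrC.
rewrite /Q' tr_block_mx !trmx1 !trmx0 !mulmx_block !mul1mx !mulmx1 !mul0mx !mulmx0 !addr0 !add0r.
by rewrite mul0mx eE diag_mx_row; congr block_mx; apply/matrixP => i j; rewrite !ord1 !mxE.
Qed.
End Diagonalization.

Lemma int_diagonalize n (B : 'M[int]_n) : B^T = B ->
  exists U, exists2 Ui : 'M[rat]_n, map_mx intr U *m Ui = 1%:M &
    exists d, U^T *m B *m U = diag_mx d.
Proof.
move=> Bs; have Bqs : (map_mx intr B : 'M[rat]_n)^T = map_mx intr B by rewrite map_trmx Bs.
have [P Pu [e eE]] := sym_diagonalize Bqs.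
have [D D0 [U UE]] := common_denominator P.
have Dr : D%:R != 0 :> rat by rewrite pnatr_eq0 -lt0n.
have UE' : map_mx intr U = D%:R *: P by rewrite -UE scaler_nat.
exists U, (D%:R^-1 *: invmx P).
  by rewrite UE' -scalemxAl -scalemxAr scalerA mulmxV // divff // scale1r.
have e2 : map_mx intr (U^T *m B *m U) = (D%:R ^+ 2) *: diag_mx e.
  have UT : map_mx intr U^T = D%:R *: P^T by rewrite -map_trmx UE' linearZ.
  by rewrite !map_mxM UT UE' -!scalemxAl -scalemxAr -eE scalerA expr2.
exists (\row_i (U^T *m B *m U) i i); apply/matrixP => i j.
have := congr1 (fun M : 'M[rat]_n => M i j) e2; rewrite [LHS]mxE => h.
apply: (@intr_inj rat); rewrite h !mxE.
have [->|ij] := eqVneq i j; last by rewrite !mulr0n mulr0.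
have := congr1 (fun M : 'M[rat]_n => M j j) e2; rewrite [LHS]mxE !mxE eqxx !mulr1n => <-.
by [].
Qed.

(** * Sylvester's law of inertia *)

Section Inertia.
Variable C : numClosedFieldType.

Lemma rowsub_free n (I : {set 'I_n}) :
  row_free (rowsub (fun i : 'I_#|I| => enum_val i) (1%:M : 'M[C]_n)).
Proof.
apply/row_freeP; exists (colsub (fun i : 'I_#|I| => enum_val i) 1%:M).
apply/matrixP => i j; rewrite mxE (bigD1 (enum_val i)) //= big1 => [|k ki].
  by rewrite !mxE eqxx mul1r addr0 (inj_eq enum_val_inj).
by rewrite !mxE eq_sym (negPf ki) mul0r.
Qed.

Lemma rowsub_support n (I : {set 'I_n}) (x : 'rV[C]_#|I|) i :
  i \notin I -> (x *m rowsub (fun i : 'I_#|I| => enum_val i) (1%:M : 'M[C]_n)) 0 i = 0.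
Proof.
move=> iI; rewrite mxE big1 // => j _; rewrite !mxE.
case: eqP => [e|]; last by rewrite mulr0.
by move: iI; rewrite -e enum_valP.
Qed.

(* Sylvester's law: a vector in both spaces makes the form positive and
   nonpositive. *)
Lemma inertia n (X Y : 'M[C]_n) (a b : 'rV[C]_n) :
  X \in unitmx -> Y \in unitmx ->
  (forall i, a 0 i \is Num.real) -> (forall i, b 0 i \is Num.real) ->
  X *m diag_mx a *m (map_mx Num.conj X)^T = Y *m diag_mx b *m (map_mx Num.conj Y)^T ->
  (#|[set i | (0 < a 0 i)%R]%SET| <= #|[set i | (0 < b 0 i)%R]%SET|)%N.
Proof.
move=> Xu Yu ar br e; rewrite leqNgt; apply/negP => lt.
set I := [set i | 0 < a 0 i]%SET in lt *; pose J := [set i | b 0 i <= 0]%SET.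
have JE : J = (~: [set i | 0 < b 0 i])%SET.
  by apply/setP => i; rewrite !inE; rewrite real_leNgt ?real0 //.
pose Z1 := rowsub (fun i : 'I_#|I| => enum_val i) (1%:M : 'M[C]_n) *m invmx X.
pose Z2 := rowsub (fun i : 'I_#|J| => enum_val i) (1%:M : 'M[C]_n) *m invmx Y.
have r1 : \rank Z1 = #|I|.
  by rewrite mxrankMfree ?row_free_unit ?unitmx_inv //; exact/eqP/rowsub_free.
have r2 : \rank Z2 = #|J|.
  by rewrite mxrankMfree ?row_free_unit ?unitmx_inv //; exact/eqP/rowsub_free.
(* Under the assumption [lt] the dimensions [#|I|] and [#|J|] add up to more than [n], since [J] is
   the complement of the positive set of [b]. *)
have cap0 : (Z1 :&: Z2)%MS != 0.
  rewrite -mxrank_eq0 -lt0n; have := mxrank_sum_cap Z1 Z2; rewrite r1 r2.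
  have := rank_leq_col (Z1 + Z2)%MS; have := cardsC [set i | 0 < b 0 i]%SET.
  rewrite -JE card_ord; lia.
have /rowV0Pn[v] := cap0; rewrite sub_capmx => /andP[/submxP[x xE] /submxP[y yE]] v0.
have form (M : 'M[C]_n) (g : 'rV[C]_n) : (v *m M *m diag_mx g *m (map_mx Num.conj (v *m M))^T) 0 0
    = \sum_i g 0 i * (`|(v *m M) 0 i| ^+ 2).
  rewrite mxE; apply: eq_bigr => i _; rewrite mul_mx_diag !mxE normCK.
  by rewrite mulrAC mulrC.
have pos : 0 < \sum_i a 0 i * (`|(v *m X) 0 i| ^+ 2).
  have vX : v *m X = x *m rowsub (fun i : 'I_#|I| => enum_val i) (1%:M : 'M[C]_n).
    by rewrite xE /Z1 -!mulmxA mulVmx // mulmx1.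
  have [i vi] : exists i, (v *m X) 0 i != 0.
    apply/existsP; rewrite -negb_forall; apply: contra v0 => /forallP h.
    apply/eqP; rewrite -[v]mulmx1 -(mulmxV Xu) mulmxA (_ : v *m X = 0) ?mul0mx //.
    by apply/rowP => i; rewrite [RHS]mxE; exact/eqP/h.
  have ge j : 0 <= a 0 j * `|(v *m X) 0 j| ^+ 2.
    have [jI|jI] := boolP (j \in I).
      by rewrite mulr_ge0 ?exprn_ge0 ?normr_ge0 // ltW //; rewrite inE in jI.
    by rewrite vX rowsub_support // normr0 expr0n mulr0.
  rewrite (bigD1 i) //= ltr_wpDr ?sumr_ge0 //.
  have iI : i \in I by apply: contraNT vi => iI; rewrite vX rowsub_support.
  by rewrite mulr_gt0 ?exprn_gt0 ?normr_gt0 //; rewrite inE in iI.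
have neg : \sum_i b 0 i * (`|(v *m Y) 0 i| ^+ 2) <= 0.
  have vY : v *m Y = y *m rowsub (fun i : 'I_#|J| => enum_val i) (1%:M : 'M[C]_n).
    by rewrite yE /Z2 -!mulmxA mulVmx // mulmx1.
  apply: sumr_le0 => j _; have [jJ|jJ] := boolP (j \in J).
    by rewrite mulr_le0_ge0 ?exprn_ge0 ?normr_ge0 //; rewrite inE in jJ.
  by rewrite vY rowsub_support // normr0 expr0n mulr0.
move: pos neg; rewrite -!form !map_mxM !trmx_mul.
have -> : v *m X *m diag_mx a *m ((map_mx Num.conj X)^T *m (map_mx Num.conj v)^T) =
  v *m (X *m diag_mx a *m (map_mx Num.conj X)^T) *m (map_mx Num.conj v)^T by rewrite !mulmxA.
rewrite e !mulmxA => h1 h2; have := lt_le_trans h1 h2; by rewrite ltxx.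
Qed.

Lemma inertia_neg n (X Y : 'M[C]_n) (a b : 'rV[C]_n) :
  X \in unitmx -> Y \in unitmx ->
  (forall i, a 0 i \is Num.real) -> (forall i, b 0 i \is Num.real) ->
  X *m diag_mx a *m (map_mx Num.conj X)^T = Y *m diag_mx b *m (map_mx Num.conj Y)^T ->
  (#|[set i | (a 0 i < 0)%R]%SET| <= #|[set i | (b 0 i < 0)%R]%SET|)%N.
Proof.
move=> Xu Yu ar br e.
have neg (g : 'rV[C]_n) : (forall i, g 0 i \is Num.real) ->
    forall i, (- g) 0 i \is Num.real by move=> h i; rewrite mxE realN.
have dN (g : 'rV[C]_n) : diag_mx (- g) = - diag_mx g.
  by apply/matrixP => i j; rewrite !mxE mulNrn.
have := inertia Xu Yu (neg _ ar) (neg _ br).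
rewrite !dN !mulmxN !mulNmx => /(_ (congr1 -%R e)).
congr (_ <= _)%N; apply: eq_card => i; by rewrite !inE mxE oppr_gt0.
Qed.
End Inertia.

Section Signature.
Variable R : realType.
Local Notation C := R[i].

(** The spectral theorem presents the roots of the characteristic polynomial, with multiplicity, as
    the diagonal of a form congruent to [B], so that inertia applies to them. *)
Lemma spectrum_perm (G : plumbing) : (linking G)^T = linking G ->
  let B := map_mx intr (linking G) : 'M[C]_(nv G) in
  exists2 P : 'M[C]_(nv G), P \in unitmx & exists2 s : 'rV[C]_(nv G),
    (forall i, s 0 i \is Num.real) /\
    B = P *m diag_mx s *m (map_mx Num.conj P)^T &
    perm_eq (spectrum R G) [seq s 0 i | i <- enum 'I_(nv G)].
Proof.
move=> Gs B.
have Bh : B \is hermsymmx.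
  apply: realsym_hermsym.
    apply/is_hermitianmxP; rewrite expr0 scale1r map_mx_id //.
    by rewrite /B map_trmx Gs.
  by apply/mxOverP => i j; rewrite mxE realz.
have /orthomx_spectralP e := hermitian_normalmx Bh.
have Su := spectral_unitarymx B.
have SiE : invmx (spectralmx B) = (map_mx Num.conj (spectralmx B))^T.
  by rewrite (invmx_unitary Su) map_trmx.
have SE : (map_mx Num.conj (invmx (spectralmx B)))^T = spectralmx B.
  by rewrite SiE map_trmx trmxK; apply/matrixP => i j; rewrite !mxE conjCK.
exists (invmx (spectralmx B)); first by rewrite unitmx_inv spectral_unit.
exists (spectral_diag B).
  split; last by rewrite SE.
  by move=> i; have /mxOverP := hermitian_spectral_diag_real Bh; apply.
have cp : char_poly B = \prod_i ('X - (spectral_diag B 0 i)%:P).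
  have -> : char_poly B = char_poly (diag_mx (spectral_diag B)).
    rewrite {1}e /char_poly.
    set S := spectralmx B; set D := diag_mx _.
    have Sunit : S \in unitmx by exact: spectral_unit.
    have -> : char_poly_mx (invmx S *m D *m S) =
      map_mx polyC (invmx S) *m char_poly_mx D *m map_mx polyC S.
      rewrite /char_poly_mx mulmxBr mulmxBl !map_mxM; congr (_ - _).
      by rewrite mul_mx_scalar -scalemxAl -map_mxM mulVmx // map_mx1 scalemx1.
    rewrite !det_mulmx mulrAC -det_mulmx -map_mxM mulVmx // map_mx1 det1 mul1r //.
  rewrite char_poly_trig ?diag_mx_is_trig //.
  by apply: eq_bigr => i _; rewrite mxE eqxx mulr1n.
apply: prod_XsubC_eq; rewrite big_map big_enum -cp /spectrum.
case: closed_field_poly_normal => r /= re.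
by rewrite [RHS]re (monicP (char_poly_monic _)) scale1r.
Qed.

(** The spectral and the integral diagonalization are two congruences of the same Hermitian form;
    inertia in both directions equates the counts of signs. *)
Lemma signature_diag (G : plumbing) (U : 'M[int]_(nv G)) (Ui : 'M[rat]_(nv G)) d :
  (linking G)^T = linking G ->
  map_mx intr U *m Ui = 1%:M -> U^T *m linking G *m U = diag_mx d ->
  bplus R G = #|[set i | (0 < d 0 i)%R]%SET| /\
  bminus R G = #|[set i | (d 0 i < 0)%R]%SET|.
Proof.
move=> Gs UUi UGU; have [P Pu [s [sr BE] sp]] := spectrum_perm Gs.
set n := nv G in U Ui d UUi UGU P Pu s sr BE sp *.
set B : 'M[C]_n := map_mx intr (linking G) in BE.
have Uu : (map_mx intr U : 'M[C]_n) \in unitmx.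
  by rewrite unitmxE det_map_mx unitfE intr_eq0 (det_inv_neq0 UUi).
pose V := invmx (map_mx intr U : 'M[C]_n)^T.
have Vu : V \in unitmx by rewrite unitmx_inv unitmx_tr.
have VE : (map_mx Num.conj V)^T = invmx (map_mx intr U : 'M[C]_n).
  have -> : map_mx Num.conj V = V.
    rewrite /V map_invmx map_trmx; congr invmx.
    by apply/matrixP => i j; rewrite !mxE rmorph_int.
  by rewrite /V trmx_inv trmxK.
pose e : 'rV[C]_n := map_mx intr d.
have BE2 : B = V *m diag_mx e *m (map_mx Num.conj V)^T.
  rewrite VE /e -map_diag_mx -UGU !map_mxM -map_trmx /V -!mulmxA.
  by rewrite mulmxV // mulmx1 mulKmx // unitmx_tr.
have er i : e 0 i \is Num.real by rewrite mxE realz.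
have cnt (T : pred C) : count T (spectrum R G) = #|[set i | T (s 0 i)]%SET|.
  by rewrite (seq.permP sp) count_map cardsE cardE /enum_mem !size_filter count_filter;
    apply: eq_count => i /=; rewrite andbT.
have p1 := inertia Pu Vu sr er (etrans (esym BE) BE2).
have p2 := inertia Vu Pu er sr (etrans (esym BE2) BE).
have n1 := inertia_neg Pu Vu sr er (etrans (esym BE) BE2).
have n2 := inertia_neg Vu Pu er sr (etrans (esym BE2) BE).
rewrite /bplus /bminus !cnt; split.
  transitivity #|[set i | (0 < e 0 i)%R]%SET|.
    by apply/eqP; rewrite eqn_leq p1 p2.
  by apply: eq_card => i; rewrite !inE mxE ltr0z.
transitivity #|[set i | (e 0 i < 0)%R]%SET|.
  by apply/eqP; rewrite eqn_leq n1 n2.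
by apply: eq_card => i; rewrite !inE mxE ltrz0.
Qed.

End Signature.

(** * The braiding *)

Section QPow.
Variables (R : realType) (r : nat).
Local Notation C := R[i].
Local Notation q := (qpow r 1 : C).

Lemma qpowD (x y : C) : qpow r (x + y) = qpow r x * qpow r y.
Proof. by rewrite /qpow mulrDl e2piD. Qed.
Lemma qpow0 : qpow r 0 = 1 :> C.
Proof. by rewrite /qpow mul0r e2pi0. Qed.
Lemma qpow_neq0 (x : C) : qpow r x != 0.
Proof. exact: e2pi_neq0. Qed.
Lemma qpowN (x : C) : qpow r (- x) = (qpow r x)^-1.
Proof. by rewrite /qpow mulNr e2piN. Qed.
Lemma qpowMn (x : C) k : qpow r (x *+ k) = qpow r x ^+ k.
Proof. by rewrite /qpow mulrnAl e2piMn. Qed.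
Lemma qpow_nat k : qpow r (k%:R : C) = q ^+ k.
Proof. by rewrite -qpowMn. Qed.
Lemma qpow_sum (I : Type) (s : seq I) (P : pred I) (F : I -> C) :
  qpow r (\sum_(i <- s | P i) F i) = \prod_(i <- s | P i) qpow r (F i).
Proof. by apply: (big_morph _ qpowD qpow0). Qed.
Lemma qpow_r : (0 < r)%N -> qpow r (r%:R : C) = 1.
Proof. by move=> r1; rewrite /qpow divff ?e2pi1 // pnatr_eq0 -lt0n. Qed.

Hypothesis r3 : (3 <= r)%N.
Hypothesis r_odd : odd r \/ exists2 p, odd p & r = (2 * p)%N.

Lemma r0_gt2 : (2 < r0 r)%N.
Proof. by rewrite /r0; case: ifP => // _; lia. Qed.

Lemma r0_even : odd (r0 r) = false.
Proof. by rewrite /r0; case: ifP => // ro; rewrite oddM. Qed.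

Lemma r0_dvd : (r %| r0 r)%N.
Proof. by rewrite /r0; case: ifP => _; rewrite ?dvdn_mull. Qed.

Lemma qpow_r0 k : qpow r ((k * r0 r)%:R : C) = 1.
Proof.
have /dvdnP[m ->] := r0_dvd; rewrite mulnA natrM mulr_natl qpowMn qpow_r ?expr1n //.
exact: leq_trans r3.
Qed.

(** The bracket [[[k]]] is a unit times [1 - (- q ^+ 2) ^+ k] (see [qbraceE]), so the order of
    [- q ^+ 2] is the index of its first zero. This is the origin of [r0]. *)
Lemma primitive_root_q : (r0 r).-primitive_root (- q ^+ 2).
Proof.
have rq : r%:R != 0 :> rat by rewrite pnatr_eq0; lia.
have qE l : (- q ^+ 2) ^+ l = er R (l%:R / 2 + 2 * l%:R / r%:R).
  have -> : - q ^+ 2 = er R (1 / 2 + 2 / r%:R).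
    rewrite erD er_half mulN1r -qpow_nat; congr (- _).
    by rewrite /qpow /er fmorph_div /= !rmorph_nat.
  rewrite -erMn; congr er; rewrite -mulr_natr; field; exact: rq.
have r0p : (0 < r0 r)%N by apply: leq_trans r0_gt2.
(* [- q ^+ 2] has exponent [(r + 4) / (2 r)]; its order is found by removing the common factors, for
   odd and for even [r] separately. *)
have gauss_identity m : (2 * r %| m * (r + 4))%N -> (r0 r %| m)%N.
  rewrite /r0; case: r_odd => [ro|[p po ->]].
    rewrite ro Gauss_dvdl // coprimeMl coprime2n oddD ro /=.
    by rewrite /coprime gcdnDl -/(coprime r 4) (_ : 4 = 2 ^ 2)%N // coprimeXr // coprimen2.
  rewrite oddM /= (_ : (m * (2 * p + 4) = 2 * (m * (p + 2)))%N); last by lia.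
  rewrite dvdn_pmul2l // Gauss_dvdl // coprimeMl coprime2n oddD po /=.
  by rewrite /coprime gcdnDl -/(coprime p 2) coprimen2.
have one : (- q ^+ 2) ^+ r0 r = 1.
  rewrite qE; have /dvdnP[m mE] := r0_dvd.
  have -> : (r0 r)%:R / 2 + 2 * (r0 r)%:R / r%:R = ((r0 r)./2 + 2 * m)%:R :> rat.
    rewrite natrD natrM {2}mE natrM.
    have -> : (r0 r)%:R = 2 * ((r0 r)./2)%:R :> rat.
      by rewrite -natrM mul2n -[in LHS](odd_double_half (r0 r)) r0_even.
    by field.
  by rewrite er_nat.
apply/andP; split=> //; apply/forallP => i; apply/eqP.
rewrite unity_rootE; have := ltn_ord i; rewrite leq_eqVlt => /orP[/eqP->|lt].
  by rewrite one !eqxx.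
rewrite (ltn_eqF lt); apply/eqP; rewrite qE => /er_eq1/intrP[k e].
have e2 : (i.+1%:Z * (r + 4)%:Z = k * (2 * r)%:Z)%R.
  apply: (@intr_inj rat); rewrite !intrM -e -!pmulrn natrM natrD; by field.
have d : (2 * r %| i.+1 * (r + 4))%N.
  apply/dvdnP; exists (absz k); apply/eqP; rewrite -eqz_nat PoszM e2.
  have k0 : 0 <= k by move: e2 r3; nia.
  by rewrite -{1}(gez0_abs k0) PoszM.
have : (r0 r %| i.+1)%N := gauss_identity _ d.
by move=> /dvdn_leq -/(_ isT); rewrite leqNgt lt.
Qed.

Lemma q_neq0 : q != 0. Proof. exact: qpow_neq0. Qed.

Lemma q_sub_neq0 : q - q^-1 != 0.
Proof.
apply/negP => /eqP e; have : (- q ^+ 2) ^+ 2 == 1.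
  rewrite sqrrN -exprM; apply/eqP.
  have : q * (q - q^-1) = 0 by rewrite e mulr0.
  rewrite mulrBr divff ?q_neq0 // -expr2 => /eqP; rewrite subr_eq0 => /eqP e2.
  by rewrite (exprM q 2 2) e2 expr1n.
rewrite -(prim_order_dvd primitive_root_q) => /dvdn_leq -/(_ isT).
by rewrite leqNgt r0_gt2.
Qed.

Lemma q_add_neq0 : q + q^-1 != 0.
Proof.
apply/negP => /eqP e; have : (- q ^+ 2) ^+ 1 == 1.
  have : q * (q + q^-1) = 0 by rewrite e mulr0.
  rewrite mulrDr divff ?q_neq0 // -expr2 => /eqP; rewrite addr_eq0 => /eqP ->.
  by rewrite opprK expr1.
rewrite -(prim_order_dvd primitive_root_q) => /dvdn_leq -/(_ isT).
by have := r0_gt2; lia.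
Qed.

Lemma qbraceE k : qbrace R r k = q ^- k * (1 - (- q ^+ 2) ^+ k) / (q + q^-1).
Proof.
rewrite /qbrace; congr (_ / _); rewrite mulrBr mulr1; congr (_ - _).
have -> : - q ^+ 2 = (- q) * q by rewrite mulNr expr2.
by rewrite exprMn mulrCA mulVf ?mulr1 // expf_neq0 ?q_neq0.
Qed.

Lemma qbrace_neq0 k : (0 < k < r0 r)%N -> qbrace R r k != 0.
Proof.
move=> /andP[k0 kr]; rewrite qbraceE !mulf_neq0 ?invr_eq0 ?expf_neq0 ?q_neq0 ?q_add_neq0 //.
rewrite subr_eq0 eq_sym -(prim_order_dvd primitive_root_q).
by apply/negP => /(dvdn_leq k0); rewrite leqNgt kr.
Qed.

Lemma qbrace_r0 : qbrace R r (r0 r) = 0.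
Proof. by rewrite qbraceE (prim_expr_order primitive_root_q) subrr mulr0 mul0r. Qed.

Definition Rcoef (l : nat) : C :=
  (-1) ^+ l * q ^+ ((l * l.-1) %/ 2) * (q - q^-1) ^+ l / qfact R r l.

Lemma Rcoef0 : Rcoef 0 = 1.
Proof. by rewrite /Rcoef /qfact big_nil !expr0 !mulr1 divr1. Qed.

Lemma RcoefS l : (l.+1 < r0 r)%N ->
  Rcoef l.+1 * qbrace R r l.+1 = - (q ^+ l * (q - q^-1)) * Rcoef l.
Proof.
move=> lr; have b0 := @qbrace_neq0 l.+1 lr.
have f0 : qfact R r l != 0.
  rewrite /qfact prodf_seq_neq0; apply/allP => i; rewrite mem_index_iota => /andP[i0 il].
  by rewrite /= qbrace_neq0 // i0 (leq_ltn_trans _ lr) // ltnW.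
rewrite /Rcoef; have -> : qfact R r l.+1 =
  qfact R r l * qbrace R r l.+1 by rewrite /qfact big_nat_recr.
have -> : ((l.+1 * l) %/ 2 = (l * l.-1) %/ 2 + l)%N.
  have -> : (l.+1 * l = l * l.-1 + l * 2)%N by case: l {lr b0 f0} => // l /=; lia.
  by rewrite addnC divnMDl // addnC.
rewrite exprD !exprS; field.
by rewrite f0 q_neq0 b0.
Qed.

Lemma qbrace0 : qbrace R r 0 = 0.
Proof. by rewrite /qbrace !expr0 invr1 subrr mul0r. Qed.

(** This recursion and [qbraceS'] isolate the powers of [q^-1] and of [- q]; they serve the terms
    with [K] and with [K^-1] in [F_E_exp]. *)
Lemma qbraceS l : qbrace R r l.+1 = q ^- l - q * qbrace R r l.
Proof.
rewrite /qbrace !exprS; set x := q ^+ l; set y := (- q) ^+ l.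
have x0 : x != 0 by rewrite expf_neq0 ?q_neq0.
have q0 := q_neq0; have qa := q_add_neq0.
have qa' : q * q + 1 != 0.
  apply: contraNneq qa => e; apply/eqP/(mulfI q0).
  by rewrite mulr0 mulrDr divff.
by field; rewrite ?x0 ?q0 ?qa'.
Qed.

Lemma qbraceS' l : qbrace R r l.+1 = (- q) ^+ l + q^-1 * qbrace R r l.
Proof.
rewrite /qbrace !exprS; set x := q ^+ l; set y := (- q) ^+ l.
have x0 : x != 0 by rewrite expf_neq0 ?q_neq0.
have q0 := q_neq0; have qa := q_add_neq0.
have qa' : q * q + 1 != 0.
  apply: contraNneq qa => e; apply/eqP/(mulfI q0).
  by rewrite mulr0 mulrDr divff.
by field; rewrite ?x0 ?q0 ?qa'.
Qed.
End QPow.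

Section MatrixPowers.
Variables (R : pzSemiRingType) (n : nat).
Implicit Type A : 'M[R]_n.

(* Locked, since unification would otherwise unfold the products. *)
Fact mxpow_key : unit. Proof. exact: tt. Qed.
Definition mxpow A (l : nat) : 'M[R]_n :=
  locked_with mxpow_key (iter l (mulmx^~ A) 1%:M).

Lemma mxpow0 A : mxpow A 0 = 1%:M. Proof. by rewrite /mxpow unlock. Qed.
Lemma mxpowS A l : mxpow A l.+1 = mxpow A l *m A.
Proof. by rewrite /mxpow !unlock iterS. Qed.
Lemma mxpow1 A : mxpow A 1 = A. Proof. by rewrite mxpowS mxpow0 mul1mx. Qed.
Lemma mxpowSl A l : mxpow A l.+1 = A *m mxpow A l.
Proof.
by elim: l => [|l IH]; [rewrite mxpow1 mxpow0 mulmx1 | rewrite mxpowS {1}IH -mulmxA -mxpowS].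
Qed.
Lemma mxpowE A l : A ^+ l = mxpow A l.
Proof. by elim: l => [|l IH]; rewrite ?mxpow0 // exprSr IH mxpowS. Qed.
Lemma mxpow_scalar (a : R) l : mxpow a%:M l = (a ^+ l)%:M.
Proof. by elim: l => [|l IH]; rewrite ?mxpow0 // mxpowS IH -scalar_mxM -exprSr. Qed.
End MatrixPowers.

Section Modules.
Variables (R : realType) (r : nat).
Local Notation C := R[i].
Local Notation q := (qpow r 1 : C).
Local Notation wmodule := (wmodule R).
Implicit Types V W : wmodule.

Lemma opH_l (V : wmodule) (M : 'M[C]_(wdim V)) i j : (opH V *m M) i j = wt i * M i j.
Proof. by rewrite mul_diag_mx !mxE. Qed.
Lemma opH_r (V : wmodule) (M : 'M[C]_(wdim V)) i j : (M *m opH V) i j = M i j * wt j.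
Proof. by rewrite mul_mx_diag !mxE. Qed.

Lemma opK_E (V : wmodule) (c : C) : is_module r V ->
  opK r V c *m opE V = qpow r (2 * c) *: (opE V *m opK r V c).
Proof.
case=> hE _ _ _ _; apply/matrixP => i j; rewrite mul_diag_mx mxE mul_mx_diag !mxE.
move/matrixP: hE => /(_ i j); rewrite mxE [X in _ + X]mxE [RHS]mxE opH_l opH_r => e.
have [->|n0] := eqVneq (opE V i j) 0; first by rewrite !mulr0 mul0r mulr0.
have {}e : wt i = wt j + 2.
  by apply: (mulfI n0); rewrite mulrDr [_ * 2]mulrC -e; ring.
by rewrite e mulrDr qpowD [c * 2]mulrC; ring.
Qed.

Lemma wt_E (V : wmodule) i j : is_module r V -> opE V i j != 0 -> wt i = wt j + 2.
Proof.
case=> hE _ _ _ _ n0.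
move/matrixP: hE => /(_ i j); rewrite mxE [X in _ + X]mxE [RHS]mxE opH_l opH_r => e.
by apply: (mulfI n0); rewrite mulrDr [_ * 2]mulrC -e; ring.
Qed.

Lemma wt_F (V : wmodule) i j : is_module r V -> opF V i j != 0 -> wt i = wt j - 2.
Proof.
case=> _ hF _ _ _ n0.
move/matrixP: hF => /(_ i j); rewrite mxE [X in _ + X]mxE [RHS]mxE opH_l opH_r => e.
by apply: (mulfI n0); rewrite mulrBr [_ * 2]mulrC -[_ - 2 * _]/(_ + - (2 * _)) -mulNr -e; ring.
Qed.

Lemma par_odd (V : wmodule) (A : 'M[C]_(wdim V)) i j :
  opS V *m A = - (A *m opS V) -> A i j != 0 -> par i = ~~ par j.
Proof.
move=> /matrixP/(_ i j) h n0; move: h; rewrite mul_diag_mx mxE [RHS]mxE mul_mx_diag !mxE => e.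
case: (par i) (par j) e => -[] //=;
  rewrite ?expr1 ?expr0 ?mulN1r ?mul1r ?mulrN1 ?mulr1 ?opprK => /eqP.
  by rewrite eqNr (negPf n0).
by rewrite eq_sym eqNr (negPf n0).
Qed.

Lemma E_opK (V : wmodule) (c : C) : is_module r V ->
  opE V *m opK r V c = qpow r (- (2 * c)) *: (opK r V c *m opE V).
Proof. by move=> mV; rewrite (opK_E _ mV) scalerA -qpowD addNr qpow0 scale1r. Qed.

Lemma opSS (V : wmodule) : opS V *m opS V = 1%:M.
Proof.
apply/matrixP => i j; rewrite mul_mx_diag !mxE; case: eqP => [->|_]; last by rewrite mul0r.
by rewrite !mulr1n -expr2 sqrr_sign.
Qed.

Lemma opKS (V : wmodule) c : opK r V c *m opS V = opS V *m opK r V c.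
Proof. by apply/matrixP => i j; rewrite mul_mx_diag mul_diag_mx !mxE; case: eqP => [->|_];
  rewrite ?mulr0 ?mul0r // mulrC. Qed.

Hypothesis r3 : (3 <= r)%N.
Hypothesis r_odd : odd r \/ exists2 p, odd p & r = (2 * p)%N.
Let q0 : q != 0 := q_neq0 R r.
Let qa := q_add_neq0 R r3 r_odd.
Let qs := q_sub_neq0 R r3 r_odd.

Lemma E_exp_opK (V : wmodule) (c : C) l : is_module r V ->
  mxpow (opE V) l *m opK r V c = qpow r (- (2 * c) *+ l) *: (opK r V c *m mxpow (opE V) l).
Proof.
move=> mV; elim: l => [|l IH]; first by rewrite !mxpow0 mulr0n qpow0 scale1r mul1mx mulmx1.
rewrite mxpowS -mulmxA (E_opK _ mV) -scalemxAr !mulmxA IH -scalemxAl scalerA.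
by rewrite -qpowD -mulrS.
Qed.

(** The relation behind the coefficients of the [R]-matrix. In the induction the terms with [K] and
    with [K^-1] satisfy separate recursions, checked in [e1] and [e2]. *)
Lemma F_E_exp (V : wmodule) l : is_module r V ->
  opF V *m mxpow (opE V) l.+1 = (-1) ^+ l.+1 *: (mxpow (opE V) l.+1 *m opF V) +
    (qbrace R r l.+1 / (q - q^-1)) *:
      (((-1) ^+ l * q ^- l) *: (opK r V 1 *m mxpow (opE V) l)
       - q ^+ l *: (opK r V (-1) *m mxpow (opE V) l)).
Proof.
move=> mV; have [_ _ EF _ _] := mV.
have FE : opF V *m opE V = - (opE V *m opF V) + (q - q^-1)^-1 *: (opK r V 1 - opK r V (-1)).
  by rewrite -EF addrA addNr add0r.
elim: l => [|l IH].
  rewrite mxpow1 mxpow0 !mulmx1 !expr0 !expr1 invr1 mulr1 !scale1r scaleN1r FE.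
  have -> : qbrace R r 1 = 1 by rewrite (qbraceS R r3 r_odd) qbrace0 mulr0 subr0 expr0 invr1.
  by rewrite mul1r.
rewrite [mxpow _ l.+2 in LHS]mxpowS mulmxA IH mulmxDl -scalemxAl -mulmxA FE mulmxDr mulmxN.
have -> : mxpow (opE V) l.+1 *m (opE V *m opF V) = mxpow (opE V) l.+2 *m opF V.
  by rewrite mulmxA -mxpowS.
have -> : mxpow (opE V) l.+1 *m ((q - q^-1)^-1 *: (opK r V 1 - opK r V (-1))) = (q - q^-1)^-1 *:
   (q ^- l.+1 ^+ 2 *: (opK r V 1 *m mxpow (opE V) l.+1)
    - q ^+ l.+1 ^+ 2 *: (opK r V (-1) *m mxpow (opE V) l.+1)).
  rewrite -scalemxAr mulmxBr (E_exp_opK 1 _ mV) (E_exp_opK (-1) _ mV).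
  rewrite mulr1 mulrN1 opprK mulNrn qpowN qpowMn -[2]/(1 *+ 2) qpowMn.
  by rewrite -!exprVn -!exprM mulnC.
rewrite -scalemxAl mulmxBl -!scalemxAl -!mulmxA -!mxpowS.
move: (mxpow _ l.+2 *m opF V) (opK r V 1 *m mxpow _ l.+1) (opK r V (-1) *m mxpow _ l.+1) => X Y Z.
have y0 : q ^+ l != 0 by rewrite expf_neq0.
have qs' : q * q - 1 != 0.
  by apply: contraNneq qs => e; apply/eqP/(mulfI q0); rewrite mulr0 mulrBr divff.
have e1 : qbrace R r l.+2 / (q - q^-1) * ((-1) ^+ l.+1 / q ^+ l.+1) =
    (-1) ^+ l.+1 * ((q - q^-1)^-1 * q ^- l.+1 ^+ 2) +
    qbrace R r l.+1 / (q - q^-1) * ((-1) ^+ l / q ^+ l).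
  rewrite (qbraceS R r3 r_odd l.+1) [q ^+ l.+1]exprS [(-1) ^+ l.+1]exprS.
  move: (qbrace R r l.+1) (q ^+ l) y0 ((-1) ^+ l) => B y y0 t.
  by field; rewrite ?y0 ?q0 ?qs'.
have e2 : qbrace R r l.+2 / (q - q^-1) * q ^+ l.+1 =
    (-1) ^+ l.+1 * ((q - q^-1)^-1 * q ^+ l.+1 ^+ 2) + qbrace R r l.+1 / (q - q^-1) * q ^+ l.
  rewrite (qbraceS' R r3 r_odd l.+1) [(- q) ^+ _]exprNn [q ^+ l.+1]exprS [(-1) ^+ l.+1]exprS.
  move: (qbrace R r l.+1) (q ^+ l) y0 ((-1) ^+ l) => B y y0 t.
  by field; rewrite ?y0 ?q0 ?qs'.
rewrite !(scalerDr, scalerN, scalerA) e1 e2 [(-1) ^+ l.+2]exprS mulN1r scaleNr.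
rewrite !scalerDl opprD -!addrA; congr (_ + _).
by rewrite !mulrA; congr (_ + _); rewrite addrCA.
Qed.
End Modules.

Lemma tens_ind m n (P : 'I_(m * n) -> Prop) :
  (forall i j, P (mxtens_index (i, j))) -> forall x, P x.
Proof. by move=> h x; rewrite -[x]mxtens_unindexK; case: (mxtens_unindex x). Qed.

Lemma sum_tens (V : nmodType) m n (h : 'I_(m * n) -> V) :
  \sum_x h x = \sum_a \sum_b h (mxtens_index (a, b)).
Proof.
rewrite pair_big (reindex_onto (@mxtens_index m n) (@mxtens_unindex m n)) => [|x _];
  last exact: mxtens_unindexK.
by apply: eq_big => [x|[a b] _ //]; rewrite mxtens_indexK eqxx.
Qed.

Lemma addrB_swap (U : zmodType) (a b c d : U) : a + b - (c + d) = b - d - (c - a).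
Proof. by rewrite opprB [a + b]addrC [c + d]addrC opprD addrACA. Qed.

(** * Homogeneous matrices *)

Section Homogeneous.
Variables (F : fieldType) (U : zmodType).

(** The grading group is [C * 'F_2] for weight and parity together, and the integers when only the
    position in the basis matters. *)
Definition homg m n (g : 'I_m -> U) (h : 'I_n -> U) (c : U) (A : 'M[F]_(m, n)) :=
  forall i j, A i j != 0 -> g i = h j + c.

Definition gtens m n (g : 'I_m -> U) (h : 'I_n -> U) (x : 'I_(m * n)) : U :=
  g (mxtens_unindex x).1 + h (mxtens_unindex x).2.

Lemma hom_mul m n p (g : 'I_m -> U) (h : 'I_n -> U) (k : 'I_p -> U) c d
  (A : 'M[F]_(m, n)) (B : 'M[F]_(n, p)) :
  homg g h c A -> homg h k d B -> homg g k (c + d) (A *m B).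
Proof.
move=> hA hB i j; have [/existsP[x /andP[a b]] _|nx] := boolP [exists x,
  (A i x != 0) && (B x j != 0)].
  by rewrite (hA _ _ a) (hB _ _ b) -addrA [d + c]addrC.
rewrite mxE big1 ?eqxx // => x _; apply/eqP; rewrite mulf_eq0 -[_ || _]negbK negb_or.
by apply: contra nx => ab; apply/existsP; exists x.
Qed.

Lemma hom_tens m n p s (g : 'I_m -> U) (h : 'I_n -> U) (g' : 'I_p -> U) (h' : 'I_s -> U) c d
  (A : 'M[F]_(m, n)) (B : 'M[F]_(p, s)) :
  homg g h c A -> homg g' h' d B -> homg (gtens g g') (gtens h h') (c + d) (A *t B).
Proof.
move=> hA hB x y; elim/tens_ind: x => i i'; elim/tens_ind: y => j j'.
rewrite tensmxE mulf_eq0 negb_or => /andP[a b].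
by rewrite /gtens !mxtens_indexK /= (hA _ _ a) (hB _ _ b) addrACA.
Qed.

Lemma hom_sum m n (g : 'I_m -> U) (h : 'I_n -> U) c (I : finType) (A : I -> 'M[F]_(m, n)) :
  (forall l, homg g h c (A l)) -> homg g h c (\sum_l A l).
Proof.
move=> hA i j; have [/existsP[l nl] _|nx] := boolP [exists l, A l i j != 0].
  exact: hA nl.
rewrite summxE big1 ?eqxx // => l _; apply/eqP; rewrite -[_ == _]negbK.
by apply: contra nx => ab; apply/existsP; exists l.
Qed.

Lemma hom_scale m n (g : 'I_m -> U) (h : 'I_n -> U) c a (A : 'M[F]_(m, n)) :
  homg g h c A -> homg g h c (a *: A).
Proof. by move=> hA i j; rewrite mxE mulf_eq0 negb_or => /andP[_ /hA]. Qed.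

Lemma hom_diag n (g : 'I_n -> U) d : homg g g 0 (diag_mx d : 'M[F]_n).
Proof. by move=> i j; rewrite mxE addr0; case: (i =P j) => [->|]; rewrite ?mulr0n ?eqxx. Qed.

Lemma hom_1 n (g : 'I_n -> U) : homg g g 0 (1%:M : 'M[F]_n).
Proof. by rewrite -diag_const_mx; apply: hom_diag. Qed.

Lemma hom_pow n (g : 'I_n -> U) c (A : 'M[F]_n) l : homg g g c A -> homg g g (c *+ l) (mxpow A l).
Proof.
move=> hA; elim: l => [|l IH]; first by rewrite mxpow0; apply: hom_1.
by rewrite mxpowS mulrSr; apply: hom_mul IH hA.
Qed.

Lemma hom_diag_entry n (g : 'I_n -> U) (A : 'M[F]_n) i j :
  homg g g 0 A -> injective g -> i != j -> A i j = 0.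
Proof.
by move=> hA gi ij; apply: contraNeq ij => /hA; rewrite addr0 => /gi ->.
Qed.
End Homogeneous.

(** * Intertwining by the braiding and the partial trace *)

Section Rmatrix.
Variables (R : realType) (r : nat).
Local Notation C := R[i].
Local Notation q := (qpow r 1 : C).
Local Notation wmodule := (wmodule R).
Implicit Types V W : wmodule.

Definition gr (V : wmodule) (i : 'I_(wdim V)) : C * 'F_2 := (wt i, (par i)%:R).
Arguments gr : clear implicits.

Lemma hom_E V : is_module r V -> homg (gr V) (gr V) (2, 1) (opE V).
Proof.
move=> mV i j n0; have [_ _ _ _ [hS _]] := mV.
rewrite /gr (wt_E mV n0) (par_odd hS n0); congr pair.
by case: (par j) => /=; apply: val_inj.
Qed.

Lemma hom_F V : is_module r V -> homg (gr V) (gr V) (-2, 1) (opF V).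
Proof.
move=> mV i j n0; have [_ _ _ _ [_ hS]] := mV.
rewrite /gr (wt_F mV n0) (par_odd hS n0); congr pair.
by case: (par j) => /=; apply: val_inj.
Qed.

Definition Rterm V W l := (mxpow (opE V) l *m mxpow (opS V) l) *t mxpow (opF W) l.

Lemma RtildeE V W : Rtilde r V W = \sum_(l < r0 r) Rcoef R r l *: Rterm V W l.
Proof. by apply: eq_bigr => l _; rewrite /Rterm !mxpowE. Qed.

Lemma hom_Rterm V W l : is_module r V -> is_module r W ->
  homg (gtens (gr V) (gr W)) (gtens (gr V) (gr W)) 0 (Rterm V W l).
Proof.
move=> mV mW; have -> : (0 : C * 'F_2) = ((2, 1) *+ l + 0) + (-2, 1) *+ l.
  rewrite addr0 -mulrnDl.
  have -> : (2, 1) + (-2, 1) = 0 :> C * 'F_2.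
    by congr pair; [rewrite /= subrr | apply: val_inj].
  by rewrite mul0rn.
apply: hom_tens; last by apply: hom_pow; apply: hom_F.
apply: hom_mul; first by apply: hom_pow; apply: hom_E.
by rewrite -(mul0rn _ l); apply: hom_pow; apply: hom_diag.
Qed.

Lemma hom_Rtilde V W : is_module r V -> is_module r W ->
  homg (gtens (gr V) (gr W)) (gtens (gr V) (gr W)) 0 (Rtilde r V W).
Proof. by move=> mV mW; rewrite RtildeE; apply: hom_sum => l; apply: hom_scale;
  apply: hom_Rterm. Qed.

Lemma superflipE V W i j k l :
  superflip V W (mxtens_index (j, i)) (mxtens_index (k, l)) =
  if (j, i) == (l, k) then (-1) ^+ (par k && par l) else 0.
Proof. by rewrite mxE !mxtens_indexK. Qed.

Lemma hom_superflip V W :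
  homg (gtens (gr W) (gr V)) (gtens (gr V) (gr W)) 0 (superflip V W).
Proof.
move=> x y; elim/tens_ind: x => i i'; elim/tens_ind: y => j j'.
rewrite superflipE; case: ifP => [/eqP[-> ->] _|]; last by rewrite eqxx.
by rewrite /gtens !mxtens_indexK addr0 addrC.
Qed.

Lemma hom_braiding V W : is_module r V -> is_module r W ->
  homg (gtens (gr W) (gr V)) (gtens (gr V) (gr W)) 0 (braiding r V W).
Proof.
move=> mV mW; rewrite /braiding -[0]addr0; apply: hom_mul; last exact: hom_Rtilde.
by rewrite -[0]addr0; apply: hom_mul; [exact: hom_superflip | exact: hom_diag].
Qed.

Lemma superflip_l V W p (M : 'M[C]_(wdim V * wdim W, p)) j i c :
  (superflip V W *m M) (mxtens_index (j, i)) c =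
  (-1) ^+ (par i && par j) * M (mxtens_index (i, j)) c.
Proof.
rewrite mxE (bigD1 (mxtens_index (i, j))) //= big1 => [|x].
  by rewrite superflipE eqxx addr0.
elim/tens_ind: x => k l; rewrite (can_eq (@mxtens_indexK _ _)) superflipE => n.
by case: eqP => [[e1 e2]|_]; rewrite ?mul0r //; move: n; rewrite e1 e2 eqxx.
Qed.

Lemma superflip_r V W p (M : 'M[C]_(p, wdim W * wdim V)) j i c :
  (M *m superflip V W) c (mxtens_index (i, j)) =
  M c (mxtens_index (j, i)) * (-1) ^+ (par i && par j).
Proof.
rewrite mxE (bigD1 (mxtens_index (j, i))) //= big1 => [|x].
  by rewrite superflipE eqxx addr0.
elim/tens_ind: x => k l; rewrite (can_eq (@mxtens_indexK _ _)) superflipE => n.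
by rewrite (negPf n) mulr0.
Qed.

Lemma Upsilon_l V W p (M : 'M[C]_(wdim V * wdim W, p)) i j c :
  (Upsilon r V W *m M) (mxtens_index (i, j)) c =
  qpow r (wt i * wt j / 2) * M (mxtens_index (i, j)) c.
Proof. by rewrite mul_diag_mx !mxE mxtens_indexK. Qed.

Lemma Upsilon_r V W p (M : 'M[C]_(p, wdim V * wdim W)) i j c :
  (M *m Upsilon r V W) c (mxtens_index (i, j)) =
  M c (mxtens_index (i, j)) * qpow r (wt i * wt j / 2).
Proof. by rewrite mul_mx_diag !mxE mxtens_indexK. Qed.

Lemma braidingE V W i j x :
  braiding r V W (mxtens_index (j, i)) x =
  (-1) ^+ (par i && par j) * qpow r (wt i * wt j / 2) * Rtilde r V W (mxtens_index (i, j)) x.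
Proof. by rewrite /braiding -mulmxA superflip_l Upsilon_l mulrA. Qed.

(** The action of the coproduct [K^-1 (x) F + F (x) 1], where [opS] is the sign of moving [F] past
    the first factor. Commutation with [F] and degree zero will suffice, because [F] links all basis
    vectors of a Verma module. *)
Definition coF V W : 'M[C]_(wdim V * wdim W) :=
  (opK r V (-1) *m opS V) *t opF W + opF V *t 1%:M.

Hypothesis r3 : (3 <= r)%N.
Hypothesis r_odd : odd r \/ exists2 p, odd p & r = (2 * p)%N.

Lemma S_exp_odd V (A : 'M[C]_(wdim V)) l : opS V *m A = - (A *m opS V) ->
  mxpow (opS V) l *m A = (-1) ^+ l *: (A *m mxpow (opS V) l).
Proof.
move=> hA; elim: l => [|l IH]; first by rewrite mxpow0 mul1mx mulmx1 expr0 scale1r.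
by rewrite [in LHS]mxpowS -mulmxA hA mulmxN mulmxA IH -scalemxAl -mulmxA -mxpowS exprS mulN1r
  scaleNr.
Qed.

Lemma odd_exp_S V (A : 'M[C]_(wdim V)) l : opS V *m A = - (A *m opS V) ->
  opS V *m mxpow A l = (-1) ^+ l *: (mxpow A l *m opS V).
Proof.
move=> hA; elim: l => [|l IH]; first by rewrite mxpow0 mul1mx mulmx1 expr0 scale1r.
by rewrite !mxpowS mulmxA IH -scalemxAl -mulmxA hA mulmxN mulmxA scalerN exprS mulN1r scaleNr.
Qed.

Lemma S_exp_K V c l : mxpow (opS V) l *m opK r V c = opK r V c *m mxpow (opS V) l.
Proof.
elim: l => [|l IH]; first by rewrite mxpow0 mul1mx mulmx1.
by rewrite mxpowS -mulmxA -opKS mulmxA IH -mulmxA.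
Qed.

(** Sorted by powers of [F] on [W], the two sides differ by terms that match after a shift of index,
    by [F_E_exp] and [RcoefS]; the ends vanish, the last one because [F^r0 = 0]. *)
Lemma Rtilde_coF V W : is_module r V -> is_module r W ->
  Rtilde r V W *m coF V W =
  ((opK r V 1 *m opS V) *t opF W + opF V *t 1%:M) *m Rtilde r V W.
Proof.
move=> mV mW; have [_ _ _ _ [SE SF]] := mV; have [_ _ _ [_ Fr] _] := mW.
set e := opE V; set s := opS V; set k := opK r V; set f := opF W.
pose A l := Rcoef R r l *: ((((-1) ^+ l *: (mxpow e l *m opF V) - opF V *m mxpow e l) *m mxpow
  s l) *t mxpow f l).
pose B l := Rcoef R r l *: ((((-1) ^+ l *: (k 1 *m mxpow e l) - mxpow e l *m k (-1)) *m mxpow s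
  l.+1) *t mxpow f l.+1).
have tDl (X Y : 'M[C]_(wdim V)) (Z : 'M[C]_(wdim W)) : (X - Y) *t Z = X *t Z - Y *t Z.
  by apply/matrixP => i j; rewrite !mxE mulrBl.
have tDr (c : C) (X : 'M[C]_(wdim V)) (Z : 'M[C]_(wdim W)) : (c *: X) *t Z = c *: (X *t Z).
  by apply/matrixP => i j; rewrite !mxE mulrA.
suff AB : \sum_(l < r0 r) A l = \sum_(l < r0 r) B l.
  apply/eqP; rewrite -subr_eq0 RtildeE mulmx_suml mulmx_sumr -sumrB.
  rewrite (eq_bigr (fun l : 'I_(r0 r) => A l - B l)) ?sumrB ?AB ?subrr // => l _.
  rewrite -scalemxAl -scalemxAr /A /B -!scalerBr; congr (_ *: _).
  rewrite /Rterm /coF mulmxDr mulmxDl !tensmx_mul mulmx1 mul1mx.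
  rewrite -/e -/s -/k -/f -!mulmxA !mulmxA.
  have -> : mxpow e l *m mxpow s l *m opF V = (-1) ^+ l *: (mxpow e l *m opF V) *m mxpow s l.
    by rewrite -mulmxA (S_exp_odd _ SF) -scalemxAr mulmxA scalemxAl.
  have -> : mxpow e l *m mxpow s l *m k (-1) *m s = mxpow e l *m k (-1) *m mxpow s l.+1.
    by rewrite -[_ *m k (-1)]mulmxA S_exp_K mxpowS !mulmxA.
  have -> : k 1 *m s *m mxpow e l *m mxpow s l = (-1) ^+ l *: (k 1 *m mxpow e l) *m mxpow s l.+1.
    by rewrite -(mulmxA (k 1)) (odd_exp_S _ SE) -scalemxAr -!scalemxAl mxpowSl !mulmxA.
  rewrite -!mxpowSl -!mxpowS addrB_swap -!tDl -!mulmxBl.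
  by [].
have r0S : r0 r = (r0 r).-1.+1 by rewrite prednK //; apply: leq_trans (r0_gt2 r3 r_odd).
rewrite r0S big_ord_recl [RHS]big_ord_recr /=.
have -> : A 0%N = 0 by rewrite /A !mxpow0 expr0 scale1r mul1mx mulmx1 subrr mul0mx tens0mx scaler0.
have -> : B (r0 r).-1 = 0.
  by rewrite /B -r0S (_ : mxpow f (r0 r) = 0) ?tensmx0 ?scaler0 // -mxpowE.
rewrite add0r addr0; apply: eq_bigr => l _; rewrite /A /B /bump /= add1n.
have lr : (l.+1 < r0 r)%N by move: (ltn_ord l); move: (nat_of_ord l) => x; clear -r0S; lia.
rewrite (F_E_exp r3 r_odd _ mV) opprD addrA subrr add0r -scaleNr -scalemxAl tDr scalerA.
have -> : Rcoef R r l.+1 * - (qbrace R r l.+1 / (q - q^-1)) = q ^+ l * Rcoef R r l.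
  rewrite mulrN mulrA (RcoefS R r3 r_odd lr) !mulNr opprK.
  by rewrite mulrAC mulfK // (q_sub_neq0 R r3 r_odd).
have -> : (-1) ^+ l *: (k 1 *m mxpow e l) - mxpow e l *m k (-1) =
    q ^+ l *: (((-1) ^+ l / q ^+ l) *: (opK r V 1 *m mxpow (opE V) l) -
      q ^+ l *: (opK r V (-1) *m mxpow (opE V) l)).
  rewrite scalerBr !scalerA [q ^+ l * (_ / _)]mulrC divfK ?expf_neq0 ?q_neq0 //.
  by rewrite (E_exp_opK _ _ mV) mulrN1 opprK qpowMn -[2]/(1 *+ 2) qpowMn -exprD addnn -mul2n exprM.
by rewrite -scalemxAl tDr scalerA [Rcoef R r l * _]mulrC.
Qed.

Lemma opKSE V c a b :
  (opK r V c *m opS V) a b = (qpow r (c * wt b) * (-1) ^+ par b) *+ (a == b).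
Proof.
by rewrite mul_diag_mx !mxE; case: eqP => [->|_]; rewrite ?mulr1n // !mulr0n mulr0.
Qed.

Lemma Upsilon_coF V W : is_module r V -> is_module r W ->
  Upsilon r V W *m ((opK r V 1 *m opS V) *t opF W + opF V *t 1%:M) =
  (opS V *t opF W + opF V *t opK r W (-1)) *m Upsilon r V W.
Proof.
move=> mV mW; apply/matrixP => x y; elim/tens_ind: x => i i'; elim/tens_ind: y => j j'.
rewrite Upsilon_l Upsilon_r [X in _ * X = _]mxE [X in _ =
  X * _]mxE !tensmxE opKSE !mxE !mulrDr !mulrDl.
congr (_ + _).
  have [->|n] := eqVneq (opF W i' j') 0; first by rewrite !(mulr0, mul0r).
  have [->|ij] := eqVneq i j; last by rewrite !(mulr0n, mulr0, mul0r).
  rewrite !mulr1n mul1r (wt_F mW n) !mulrA [_ / 2]mulrC.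
  have -> : wt j * wt j' / 2 = 2^-1 * (wt j * (wt j' - 2)) + wt j :> C by field.
  by rewrite qpowD; ring.
have [->|n] := eqVneq (opF V i j) 0; first by rewrite !(mulr0, mul0r).
have [->|ij] := eqVneq i' j'; last by rewrite !(mulr0n, mulr0, mul0r).
rewrite !mulr1n mulr1 (wt_F mV n).
have -> : (wt j - 2) * wt j' / 2 = -1 * wt j' + wt j * wt j' / 2 :> C by field.
by rewrite qpowD; ring.
Qed.

Lemma superflip_coF V W : is_module r V -> is_module r W ->
  superflip V W *m (opS V *t opF W + opF V *t opK r W (-1)) = coF W V *m superflip V W.
Proof.
move=> mV mW; apply/matrixP => x y; elim/tens_ind: x => i' i; elim/tens_ind: y => j j'.
have [_ _ _ _ [_ SFV]] := mV; have [_ _ _ _ [_ SFW]] := mW.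
rewrite superflip_l superflip_r /coF [X in _ * X = _]mxE [X in _ =
  X * _]mxE !tensmxE opKSE !mxE !mulrDr !mulrDl.
rewrite addrC; congr (_ + _).
  have [->|n] := eqVneq (opF V i j) 0; first by rewrite !(mulr0, mul0r).
  have [->|ij] := eqVneq i' j'; last by rewrite !(mulr0n, mulr0, mul0r).
  rewrite !mulr1n (par_odd SFV n).
  by case: (par j); case: (par j'); rewrite /= ?expr1 ?expr0; ring.
have [->|n] := eqVneq (opF W i' j') 0; first by rewrite !(mulr0, mul0r).
have [->|ij] := eqVneq i j; last by rewrite !(mulr0n, mulr0, mul0r).
rewrite !mulr1n (par_odd SFW n).
by case: (par j); case: (par j'); rewrite /= ?expr1 ?expr0; ring.
Qed.

Lemma braiding_coF V W : is_module r V -> is_module r W ->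
  braiding r V W *m coF V W = coF W V *m braiding r V W.
Proof.
move=> mV mW; rewrite /braiding -[LHS]mulmxA Rtilde_coF // -[LHS]mulmxA.
by rewrite [Upsilon r V W *m _]mulmxA Upsilon_coF // [LHS]mulmxA [superflip V W *m (_ *m _)
  in LHS]mulmxA superflip_coF // !mulmxA.
Qed.

Lemma qpow_2r0 : qpow r (2 * (r0 r)%:R : C) = 1.
Proof. by rewrite -natrM qpow_r0. Qed.

(** The part [F (x) 1] passes through the trace. The parts with [K^-1 (x) F] cancel by cyclicity:
    carrying [F] around changes the sign and the factor from [K^(1 - r0)], which homogeneity of [f]
    compensates on the first factor, using [q^(2 r0) = 1]. *)
Lemma ptr_comm V W (f : 'M[C]_(wdim V * wdim W)) : is_module r V -> is_module r W ->
  homg (gtens (gr V) (gr W)) (gtens (gr V) (gr W)) 0 f ->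
  f *m coF V W = coF V W *m f -> ptr r f *m opF V = opF V *m ptr r f.
Proof.
move=> mV mW hf cf; have [_ _ _ _ [_ SFV]] := mV; have [_ _ _ _ [_ SFW]] := mW.
pose D k : C := (-1) ^+ par k * qpow r ((1 - (r0 r)%:R) * @wt _ W k).
pose tr (g : 'M[C]_(wdim V * wdim W)) i j := \sum_k D k * g (mxtens_index (i,
  k)) (mxtens_index (j, k)).
apply/matrixP => i j.
have -> : (ptr r f *m opF V) i j = tr (f *m (opF V *t 1%:M)) i j.
  rewrite mxE /tr; under eq_bigr do rewrite mxE mulr_suml.
  rewrite exchange_big; apply: eq_bigr => k _; rewrite mxE sum_tens mulr_sumr;
    apply: eq_bigr => a _.
  rewrite (bigD1 k) //= big1 ?addr0 => [|b bk];
    last by rewrite tensmxE mxE (negPf bk) mulr0n !mulr0.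
  by rewrite tensmxE mxE eqxx mulr1 mulrA.
have -> : (opF V *m ptr r f) i j = tr ((opF V *t 1%:M) *m f) i j.
  rewrite mxE /tr; under eq_bigr do rewrite mxE mulr_sumr.
  rewrite exchange_big; apply: eq_bigr => k _; rewrite mxE sum_tens mulr_sumr;
    apply: eq_bigr => a _.
  rewrite (bigD1 k) //= big1 ?addr0 => [|b bk];
    last by rewrite tensmxE mxE eq_sym (negPf bk) mulr0n !(mulr0, mul0r).
  by rewrite tensmxE [1%:M _ _]mxE eqxx mulr1 mulrCA.
have -> : f *m (opF V *t 1%:M) = (opF V *t 1%:M) *m f +
    ((opK r V (-1) *m opS V) *t opF W *m f - f *m ((opK r V (-1) *m opS V) *t opF W)).
  move: cf; rewrite /coF mulmxDr mulmxDl => e.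
  by rewrite addrA [_ + (_ *t opF W *m f)]addrC -e addrC addKr.
suff e0 : tr ((opK r V (-1) *m opS V) *t opF W *m f) i j =
  tr (f *m ((opK r V (-1) *m opS V) *t opF W)) i j.
  rewrite /tr; under eq_bigr do rewrite mxE mulrDr.
  rewrite big_split /= -[RHS]addr0; congr (_ + _).
  under eq_bigr do rewrite mxE [X in _ + X]mxE mulrBr.
  by rewrite sumrB; apply/eqP; rewrite subr_eq0; apply/eqP.
rewrite /tr; under eq_bigr do rewrite mxE sum_tens mulr_sumr.
under [RHS]eq_bigr do rewrite mxE sum_tens mulr_sumr.
transitivity (\sum_k \sum_b D k * (qpow r (-1 * wt i) * (-1) ^+ par i * opF W k b
  * f (mxtens_index (i, b)) (mxtens_index (j, k)))).
  apply: eq_bigr => k _; rewrite (bigD1 i) //= [X in _ + X]big1 ?addr0 => [|a ai].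
    by rewrite mulr_sumr; apply: eq_bigr => b _; rewrite tensmxE opKSE eqxx mulr1n.
  by rewrite big1 ?mulr0 // => b _; rewrite tensmxE opKSE eq_sym (negPf ai) mulr0n !mul0r.
rewrite exchange_big; apply: eq_bigr => m _;
  rewrite (bigD1 j) //= [X in _ = _ + X]big1 ?addr0 => [|a ai]; last first.
  by rewrite big1 ?mulr0 // => b _; rewrite tensmxE opKSE (negPf ai) mulr0n !(mul0r, mulr0).
rewrite mulr_sumr; apply: eq_bigr => k _; rewrite tensmxE opKSE eqxx mulr1n.
have [->|nF] := eqVneq (opF W k m) 0; first by rewrite !(mulr0, mul0r).
have [->|nf] := eqVneq (f (mxtens_index (i, m)) (mxtens_index (j, k))) 0;
  first by rewrite !(mulr0, mul0r).
have := hf _ _ nf; rewrite /gtens !mxtens_indexK addr0 /= => -[].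
rewrite (wt_F mW nF) (par_odd SFW nF) => ew ep.
have {}ew : wt i = wt j - 2 by apply: (addIr (wt m)); rewrite ew; ring.
have {}ep : par i = ~~ par j.
  by move: ep; case: (par i); case: (par j); case: (par m) => // /(congr1 val).
rewrite /D (wt_F mW nF) (par_odd SFW nF) ew ep.
have -> : (1 - (r0 r)%:R) * (wt m - 2) = (1 - (r0 r)%:R) * wt m + (2 * (r0 r)%:R) - 2 :> C by ring.
rewrite !mulN1r opprB !qpowD qpow_2r0 mulr1.
have e2 : qpow r (1 : C) * qpow r 1 * qpow r (- 2) = 1 by rewrite -!qpowD subrr qpow0.
have sg b : (-1) ^+ (~~ b) = - (-1) ^+ b :> C by case: b; rewrite /= ?expr1 ?expr0 ?opprK.
rewrite !sg; move: (f _ _) (opF W k m) (qpow r 1) (qpow r (-2)) e2 (qpow r (- wt j)) (qpow r (_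
  * wt m)) ((-1) ^+ par m) ((-1) ^+ par j) => a1 a2 a3 a4 e2 a5 a6 a7 a8.
by transitivity (a7 * a6 * (a1 * (a5 * a8 * a2)) * (a3 * a3 * a4)); [ring | rewrite e2 mulr1].
Qed.

(** A substitute for Schur's lemma: distinct weights make a matrix of degree zero diagonal, and
    nonzero entries of [F] equate neighbouring diagonal entries. The disjunction covers Verma
    modules and their duals, where [F] moves the index in opposite directions. *)
Lemma scalar_endo V (A : 'M[C]_(wdim V)) :
  injective (@wt _ V) -> homg (gr V) (gr V) 0 A -> A *m opF V = opF V *m A ->
  (forall i j : 'I_(wdim V), i.+1 = j -> opF V i j != 0 \/ opF V j i != 0) ->
  forall k, A = (A k k)%:M.
Proof.
move=> wi hA cA Fn k.
have gi : injective (gr V) by move=> i j [] /wi.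
have off i j : i != j -> A i j = 0 by apply: (hom_diag_entry hA gi).
have AF i j : opF V i j != 0 -> A i i = A j j.
  move=> n; have /matrixP/(_ i j) := cA; rewrite !mxE.
  rewrite (bigD1 i) //= big1 ?addr0 => [|a ai]; last by rewrite off ?mul0r // eq_sym.
  rewrite (bigD1 j) //= big1 ?addr0 => [|a ai]; last by rewrite off ?mulr0 // eq_sym.
  by rewrite mulrC => /(mulfI n).
have step (i j : 'I_(wdim V)) : i.+1 = j -> A i i = A j j by move=> /Fn[/AF|/AF ->].
have d0 : (0 < wdim V)%N by apply: leq_ltn_trans (ltn_ord k).
have all0 m (lt : (m < wdim V)%N) : A (Ordinal lt) (Ordinal lt) = A (Ordinal d0) (Ordinal d0).
  elim: m lt => [|m IH] lt; first by congr (A _ _); apply: val_inj.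
  by rewrite -(IH (ltnW lt)); symmetry; apply: step.
apply/matrixP => i j; rewrite !mxE; case: eqP => [<-|/eqP ij]; last by rewrite mulr0n off.
by rewrite mulr1n; case: i => a la; case: k => b lb; rewrite !all0.
Qed.

End Rmatrix.

(** * Verma modules *)

Section IntegerGrading.
Variables (F : fieldType) (n : nat).
Local Notation idx := (fun i : 'I_n => i%:Z).

Lemma nilpotent_up (A : 'M[F]_n) : homg idx idx 1 A -> mxpow A n = 0.
Proof.
move=> hA; apply/matrixP => i j; rewrite [RHS]mxE; apply/eqP; apply: contraT => /(hom_pow hA).
by have := ltn_ord i; rewrite natz; lia.
Qed.

Lemma nilpotent_down (A : 'M[F]_n) : homg idx idx (-1) A -> mxpow A n = 0.
Proof.
move=> hA; apply/matrixP => i j; rewrite [RHS]mxE; apply/eqP; apply: contraT => /(hom_pow hA).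
by have := ltn_ord j; rewrite mulNrn natz; lia.
Qed.
End IntegerGrading.

Arguments verma : simpl never.
Arguments dual : simpl never.

Section Verma.
Variables (R : realType) (r : nat).
Local Notation C := R[i].
Local Notation q := (qpow r 1 : C).
Local Notation wmodule := (wmodule R).
Hypothesis r3 : (3 <= r)%N.
Hypothesis r_odd : odd r \/ exists2 p, odd p & r = (2 * p)%N.
Local Notation r0 := (r0 r).
Let q0 : q != 0 := q_neq0 R r.

Lemma r0_gt0 : (0 < r0)%N. Proof. by apply: leq_trans (r0_gt2 r3 r_odd). Qed.

Lemma sgnS m : (-1) ^+ (odd m.+1) = - (-1) ^+ (odd m) :> C.
Proof. by rewrite /= signrN. Qed.

(** The coefficient in [E F^j v = ecoef w j F^(j-1) v] for [v] of weight [w] killed by [E]. *)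
Definition ecoef (w : C) (j : nat) : C :=
  \sum_(k < j) (-1) ^+ (j.-1 - k) * qint r (w - 2 * k%:R).

Lemma ecoef0 w : ecoef w 0 = 0. Proof. by rewrite /ecoef big_ord0. Qed.

Lemma ecoefS w j : ecoef w j.+1 = qint r (w - 2 * j%:R) - ecoef w j.
Proof.
rewrite /ecoef big_ord_recr /= subnn expr0 mul1r addrC; congr (_ + _).
rewrite -sumrN; apply: eq_bigr => k _; rewrite -[RHS]mulNr -[- (_ ^+ _)]mulN1r -exprS;
  congr (_ ^+ _ * _).
by case: j k => [|j] k; [case: k | rewrite /= subSn // -ltnS].
Qed.

(** The factor [qbrace R r j] vanishes at [j = r0], which closes the module at its last basis
    vector; the sum of powers vanishes at atypical weights. *)
Lemma ecoefE w j : ecoef w j = qbrace R r j *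
  (qpow r (w + 1 - j%:R) + (-1) ^+ j * qpow r (- (w + 1 - j%:R))) / (q - q^-1).
Proof.
have qs := q_sub_neq0 R r3 r_odd.
elim: j => [|j IH]; first by rewrite ecoef0 qbrace0 !mul0r.
rewrite ecoefS IH /qint; set y := qpow r (w + 1 - j%:R).
have y0 : y != 0 by exact: qpow_neq0.
have x0 : q ^+ j != 0 by rewrite expf_neq0.
have -> : qpow r (w - 2 * j%:R) = y * q^-1 * (q ^+ j)^-1.
  by rewrite -qpow_nat -!qpowN -!qpowD; congr qpow; ring.
have -> : qpow r (- (w - 2 * j%:R)) = y^-1 * q * q ^+ j.
  by rewrite -qpow_nat -!qpowN -!qpowD; congr qpow; ring.
have -> : qpow r (w + 1 - j.+1%:R) = y * q^-1.
  by rewrite -!qpowN -!qpowD -natr1; congr qpow; ring.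
have -> : qpow r (- (w + 1 - j.+1%:R)) = y^-1 * q.
  by rewrite -!qpowN -!qpowD -natr1; congr qpow; ring.
rewrite -/y qpowN -/y -mulrBl; congr (_ / _).
have e1 := qbraceS R r3 r_odd j; have e2 := qbraceS' R r3 r_odd j.
rewrite [RHS]mulrDr [qbrace R r j.+1 * _]mulrC {1}e1 {1}e2 [(- q) ^+ j]exprNn [(-1) ^+ j.+1]exprS.
have s2 : (-1) ^+ j * (-1) ^+ j = 1 :> C by rewrite -expr2 sqrr_sign.
move: (qbrace R r j) (q ^+ j) x0 ((-1) ^+ j) s2 => b x x0 s s2.
transitivity (y / q / x - b * y - (s * s) * q * x / y - s * b / y); first by rewrite s2; field;
  rewrite ?y0 ?q0 ?x0.
by field; rewrite ?y0 ?q0 ?x0.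
Qed.

Lemma ecoef_r0 w : ecoef w r0 = 0.
Proof. by rewrite ecoefE (qbrace_r0 R r3 r_odd) !mul0r. Qed.

Lemma odd_anti (V : wmodule) (A : 'M[C]_(wdim V)) :
  (forall i j, A i j != 0 -> @par _ V i = ~~ @par _ V j) -> opS V *m A = - (A *m opS V).
Proof.
move=> h; apply/matrixP => i j; rewrite mul_diag_mx [RHS]mxE mul_mx_diag !mxE.
have [->|n] := eqVneq (A i j) 0; first by rewrite mulr0 mul0r oppr0.
by rewrite (h _ _ n) signrN mulNr mulrC.
Qed.

Lemma verma_wt (lam : C) p (i : 'I_r0) : @wt _ (verma r lam p) i = lam + r0%:R - 1 - 2 * i%:R.
Proof. by []. Qed.
Lemma verma_par (lam : C) p (i : 'I_r0) : @par _ (verma r lam p) i = p (+) odd i.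
Proof. by []. Qed.
Lemma dual_wt (V : wmodule) i : @wt _ (dual r V) i = - @wt _ V i.
Proof. by []. Qed.
Lemma dual_par (V : wmodule) i : @par _ (dual r V) i = @par _ V i.
Proof. by []. Qed.

Lemma verma_E (lam : C) p (i j : 'I_r0) : opE (verma r lam p) i j =
  if i.+1 == j :> nat then ecoef (lam + r0%:R - 1) j else 0.
Proof. by rewrite mxE. Qed.

Lemma verma_F (lam : C) p (i j : 'I_r0) : opF (verma r lam p) i j = (i == j.+1 :> nat)%:R.
Proof. by rewrite mxE. Qed.

Lemma verma_Edeg (lam : C) p :
  homg (fun i : 'I_r0 => i%:Z) (fun i : 'I_r0 => i%:Z) (-1) (opE (verma r lam p)).
Proof. by move=> i j; rewrite verma_E; case: (i.+1 =P j) => [<- _|]; [lia | rewrite eqxx]. Qed.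

Lemma verma_Fdeg (lam : C) p :
  homg (fun i : 'I_r0 => i%:Z) (fun i : 'I_r0 => i%:Z) 1 (opF (verma r lam p)).
Proof. by move=> i j; rewrite verma_F pnatr_eq0 eqb0 negbK => /eqP ->; lia. Qed.

Lemma verma_EF (lam : C) p (i j : 'I_r0) : (opE (verma r lam p) *m opF (verma r lam p)) i j =
  ecoef (lam + r0%:R - 1) i.+1 *+ (i == j).
Proof.
have [lt|ge] := ltnP i.+1 r0.
  rewrite mxE (bigD1 (Ordinal lt)) // big1 ?addr0 => [|k nk].
    by rewrite verma_E verma_F eqxx eqSS mulr_natr; apply: addr0.
  rewrite verma_E; case: eqP => [e|_]; last by rewrite mul0r.
  by case/negP: nk; apply/eqP/val_inj.
rewrite mxE big1 => [|k _].
  have -> : i.+1 = r0 by apply/eqP; rewrite eqn_leq ge (ltn_ord i).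
  by rewrite ecoef_r0 mul0rn.
rewrite verma_E; case: eqP => [e|_]; last by rewrite mul0r.
by have := ltn_ord k; rewrite -e ltnNge ge.
Qed.

Lemma verma_FE (lam : C) p (i j : 'I_r0) : (opF (verma r lam p) *m opE (verma r lam p)) i j =
  ecoef (lam + r0%:R - 1) i *+ (i == j).
Proof.
case: i => -[|i] lt.
  by rewrite ecoef0 mul0rn mxE big1 // => k _; rewrite verma_F mul0r.
have lt' : (i < r0)%N by apply: ltnW.
rewrite mxE (bigD1 (Ordinal lt')) // big1 ?addr0 => [|k nk].
  rewrite verma_E verma_F eqxx mul1r -val_eqE /=.
  by rewrite addr0; case: eqP => [<-|]; rewrite ?mulr1n ?mulr0n.
rewrite verma_F eqSS; case: eqP => [e|_]; last by rewrite mul0r.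
by case/negP: nk; apply/eqP/val_inj.
Qed.

Lemma verma_module (lam : C) p : is_module r (verma r lam p).
Proof.
split.
- apply/matrixP => i j; rewrite mxE [X in _ + X]mxE [RHS]mxE opH_l opH_r verma_E !verma_wt.
  by case: eqP => [<-|_]; rewrite ?mulr0 ?mul0r ?subrr // -natr1; ring.
- apply/matrixP => i j; rewrite mxE [X in _ + X]mxE [RHS]mxE opH_l opH_r verma_F !verma_wt.
  by case: eqP => [->|_]; rewrite ?mulr0 ?mul0r ?subrr // -natr1; ring.
- apply/matrixP => i j; rewrite mxE verma_EF verma_FE -mulrnDl ecoefS subrK !mxE.
  by case: eqP => [_|_]; rewrite ?mulr1n ?mulr0n ?subrr ?mulr0 // /qint mul1r mulN1r mulrC.
- have e1 := @nilpotent_down C r0 _ (@verma_Edeg lam p).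
  have e2 := @nilpotent_up C r0 _ (@verma_Fdeg lam p).
  by split; rewrite mxpowE; [exact: e1 | exact: e2].
- split; apply: odd_anti => i j.
    rewrite verma_E !verma_par; case: ifP => [/eqP <- _|_]; last by rewrite eqxx.
    by rewrite /= addbN negbK.
  rewrite verma_F !verma_par pnatr_eq0 eqb0 negbK => /eqP ->.
  by rewrite /= addbN.
Qed.

Lemma dual_E (V : wmodule) : opE (dual r V) = - (opK r V (-1) *m (opE V)^T *m opS V).
Proof.
apply/matrixP => j i; rewrite [RHS]mxE mul_mx_diag mxE [in RHS]mxE mul_diag_mx !mxE mulN1r.
by rewrite !mulNr; congr (- _); rewrite -mulrA mulrC.
Qed.

Lemma dual_F (V : wmodule) : opF (dual r V) = - ((opF V)^T *m opS V *m opK r V 1).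
Proof.
apply/matrixP => j i; rewrite [RHS]mxE mul_mx_diag mxE [in RHS]mxE mul_mx_diag !mxE mul1r.
by rewrite !mulNr; congr (- _); rewrite -[opF V i j * _ * _]mulrA [RHS]mulrC.
Qed.

Lemma dual_entries (V : wmodule) i j :
  (opE (dual r V) j i != 0 -> opE V i j != 0) /\ (opF (dual r V) j i != 0 -> opF V i j != 0).
Proof. by split; rewrite !mxE mulf_eq0 negb_or => /andP[]. Qed.

Lemma dual_verma_module (lam : C) p : is_module r (dual r (verma r lam p)).
Proof.
set V := verma r lam p; have mV : is_module r V by exact: verma_module.
have [HE HF EF [_ _] [SE SF]] := mV.
split.
- apply/matrixP => i j; rewrite mxE [X in _ + X]mxE [RHS]mxE opH_l opH_r !dual_wt.
  have [->|n] := eqVneq (opE (dual r V) i j) 0; first by rewrite !(mulr0, mul0r) subrr.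
  by rewrite (wt_E mV (proj1 (dual_entries _ _) n)); ring.
- apply/matrixP => i j; rewrite mxE [X in _ + X]mxE [RHS]mxE opH_l opH_r !dual_wt.
  have [->|n] := eqVneq (opF (dual r V) i j) 0; first by rewrite !(mulr0, mul0r) subrr.
  by rewrite (wt_F mV (proj2 (dual_entries _ _) n)); ring.
- have KK : opK r V 1 *m opK r V (-1) = 1%:M.
    apply/matrixP => i j; rewrite mul_diag_mx !mxE; case: eqP => [->|_]; last by rewrite mulr0.
    by rewrite !mulr1n -qpowD mul1r mulN1r subrr qpow0.
  have SFt : opS V *m (opF V)^T = - ((opF V)^T *m opS V).
    by have := congr1 trmx SF; rewrite trmx_mul linearN /= trmx_mul !tr_diag_mx => ->;
      rewrite opprK.
  have SEt : opS V *m (opE V)^T = - ((opE V)^T *m opS V).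
    by have := congr1 trmx SE; rewrite trmx_mul linearN /= trmx_mul !tr_diag_mx => ->;
      rewrite opprK.
  have -> : opE (dual r V) *m opF (dual r V) = - (opK r V (-1) *m (opF V *m opE V)^T *m opK r V 1).
    rewrite dual_E dual_F mulNmx mulmxN opprK trmx_mul -!mulmxA (mulmxA (opS V)) SFt.
    by rewrite !mulNmx !mulmxN -!mulmxA (mulmxA (opS V) (opS V)) opSS mul1mx !mulmxA.
  have -> : opK r V (-1) *m (opF V *m opE V)^T *m opK r V 1 = (opF V *m opE V)^T.
    have -> : (opF V *m opE V)^T = diag_mx (\row_(i < r0) ecoef (lam + r0%:R - 1) i).
      apply/matrixP => i j; rewrite [LHS]mxE verma_FE [RHS]mxE mxE eq_sym.
      by case: eqP => [->|_].
    by rewrite /opK -mulmxA diag_mxC mulmxA diag_mxC KK mul1mx.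
  have -> : opF (dual r V) *m opE (dual r V) = - (opE V *m opF V)^T.
    rewrite dual_E dual_F mulNmx mulmxN opprK trmx_mul -!mulmxA (mulmxA (opK r V 1)) KK mul1mx.
    by rewrite (mulmxA (opS V)) SEt mulNmx mulmxN -mulmxA opSS mulmx1.
  rewrite -opprD addrC -linearD /= EF; apply/matrixP => i j; rewrite !mxE.
  rewrite eq_sym; case: eqP => [->|_]; rewrite ?mulr0n ?subrr ?mulr0 ?oppr0 //.
  by rewrite !mulr1n -mulrN opprB !dual_wt !mulN1r !mul1r opprK.
- rewrite !mxpowE; split.
    apply: (@nilpotent_up C r0) => i j /(proj1 (dual_entries _ _))/verma_Edeg ->; lia.
  apply: (@nilpotent_down C r0) => i j /(proj2 (dual_entries _ _))/verma_Fdeg ->; lia.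
have sw b c : b = ~~ c -> c = ~~ b by move=> ->; rewrite negbK.
split; apply: odd_anti => i j n; apply: sw.
  by apply: (par_odd SE); apply: (proj1 (dual_entries _ _) n).
by apply: (par_odd SF); apply: (proj2 (dual_entries _ _) n).
Qed.

Lemma mxpowS_row0 n (A : 'M[C]_n) l i : (forall j, A i j = 0) -> forall j, mxpow A l.+1 i j = 0.
Proof. by move=> h j; rewrite mxpowSl mxE big1 // => k _; rewrite h mul0r. Qed.

Lemma mxpowS_col0 n (A : 'M[C]_n) l j : (forall i, A i j = 0) -> forall i, mxpow A l.+1 i j = 0.
Proof. by move=> h i; rewrite mxpowS mxE big1 // => k _; rewrite h mulr0. Qed.

(** Scalars are read off at extremal basis vectors, where every term of the [R]-matrix beyond the
    identity drops out. *)
Lemma Rtilde_entry (V W : wmodule) x y :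
  (forall l, Rterm V W l.+1 x y = 0) -> Rtilde r V W x y = (x == y)%:R.
Proof.
move=> h; rewrite RtildeE summxE (bigD1 (Ordinal r0_gt0)) // big1 => [|l nl].
  rewrite [LHS]addr0 mxE Rcoef0 mul1r /Rterm !mxpow0 mulmx1.
  elim/tens_ind: x {h} => i i'; elim/tens_ind: y => j j'.
  by rewrite tensmxE !mxE (can_eq (@mxtens_indexK _ _)) -natrM mulnb.
case: l nl => -[|l] lt nl; first by case/negP: nl; apply/eqP/val_inj.
by rewrite mxE h mulr0.
Qed.

Lemma Rtilde_row (V W : wmodule) i k x : (forall j, opF W k j = 0) ->
  Rtilde r V W (mxtens_index (i, k)) x = (mxtens_index (i, k) == x)%:R.
Proof.
move=> h; apply: Rtilde_entry => l; elim/tens_ind: x => j j'.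
by rewrite tensmxE (mxpowS_row0 _ h) mulr0.
Qed.

Lemma Rtilde_row' (V W : wmodule) i k x : (forall j, opE V i j = 0) ->
  Rtilde r V W (mxtens_index (i, k)) x = (mxtens_index (i, k) == x)%:R.
Proof.
move=> h; apply: Rtilde_entry => l; elim/tens_ind: x => j j'.
rewrite tensmxE mxE big1 ?mul0r // => a _.
by rewrite (mxpowS_row0 _ h) mul0r.
Qed.

Lemma Rtilde_col (V W : wmodule) i k x : (forall j, opF W j k = 0) ->
  Rtilde r V W x (mxtens_index (i, k)) = (x == mxtens_index (i, k))%:R.
Proof.
move=> h; apply: Rtilde_entry => l; elim/tens_ind: x => j j'.
by rewrite tensmxE (mxpowS_col0 _ h) mulr0.
Qed.

Lemma F_exp_diag (V : wmodule) l i : is_module r V -> mxpow (opF V) l.+1 i i = 0.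
Proof.
move=> mV; apply/eqP; apply: contraT => /(hom_pow (hom_F mV)) [e _].
have /eqP : (-2 *+ l.+1 : C) = 0.
  apply: (addrI (wt i)); rewrite addr0 [RHS]e; congr (_ + _).
  have h (x : C) (y : 'F_2) m : ((x, y) *+ m).1 = x *+ m by elim: m => // m IH;
    rewrite !mulrS /= IH.
  by rewrite h.
by rewrite mulrn_eq0 /= oppr_eq0 pnatr_eq0.
Qed.

Lemma Rtilde_diag (V W : wmodule) x : is_module r W -> Rtilde r V W x x = 1.
Proof.
move=> mW; rewrite Rtilde_entry ?eqxx // => l; elim/tens_ind: x => j j'.
by rewrite tensmxE F_exp_diag // mulr0.
Qed.

Definition dbl (V W : wmodule) := braiding r W V *m braiding r V W.

Lemma ptrZ (V W : wmodule) a (f : 'M[C]_(wdim V * wdim W)) : ptr r (a *: f) = a *: ptr r f.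
Proof.
apply/matrixP => i j; rewrite !mxE mulr_sumr; apply: eq_bigr => k _.
by rewrite mxE mulrCA.
Qed.

Lemma twist_entry (V : wmodule) i : (forall j, opF V i j = 0) ->
  twist r V i i = qpow r (wt i ^+ 2 / 2 + (1 - r0%:R) * wt i).
Proof.
move=> h; rewrite mxE (bigD1 i) // big1 => [|k ki]; last first.
  by rewrite braidingE Rtilde_row // (can_eq (@mxtens_indexK _ _)) xpair_eqE (negPf ki) !mulr0.
rewrite braidingE Rtilde_row // eqxx mulr1 [LHS]addr0 andbb qpowD -expr2.
rewrite mulrACA -expr2 sqrr_sign mul1r mulrC; by [].
Qed.

Lemma braiding_row (V W : wmodule) i k x : (forall j, opF W k j = 0) ->
  braiding r V W (mxtens_index (k, i)) x =
  (-1) ^+ (par i && par k) * qpow r (wt i * wt k / 2) * (mxtens_index (i, k) == x)%:R.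
Proof. by move=> h; rewrite braidingE Rtilde_row. Qed.

Lemma sum_delta (n : nat) (a : C) (x : 'I_n) (f : 'I_n -> C) :
  \sum_y a * (x == y)%:R * f y = a * f x.
Proof.
rewrite (bigD1 x) //= big1 ?addr0 => [|y]; first by rewrite eqxx mulr1.
by rewrite eq_sym => /negPf ->; rewrite mulr0 mul0r.
Qed.

Lemma sgn_wt (V W : wmodule) (i : 'I_(wdim V)) (k : 'I_(wdim W)) (a : C) :
  (-1) ^+ (par k && par i) * a * ((-1) ^+ (par i && par k) * a) = a * a.
Proof. by rewrite andbC mulrACA -expr2 sqrr_sign mul1r. Qed.

(** The row of the outer braiding at [i] has a single entry, so of the inner one only a diagonal
    entry of [Rtilde] enters, which is 1. *)
Lemma ptr_dbl (V W : wmodule) i : is_module r V -> is_module r W -> (forall j, opF V i j = 0) ->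
  ptr r (dbl V W) i i =
  \sum_k (-1) ^+ par k * qpow r ((1 - r0%:R + wt i) * @wt _ W k).
Proof.
move=> mV mW h; rewrite mxE; apply: eq_bigr => k _.
rewrite [(1 - _ + _) * _]mulrDl qpowD mulrA; congr (_ * _).
rewrite mxE; under eq_bigr do rewrite braiding_row //.
rewrite sum_delta braidingE Rtilde_diag // mulr1 [wt i * wt k]mulrC.
by rewrite sgn_wt -qpowD; congr qpow; field.
Qed.

Lemma superflip_K (V W : wmodule) : superflip W V *m superflip V W = 1%:M.
Proof.
apply/matrixP => x y; elim/tens_ind: x => i k.
rewrite superflip_l; elim/tens_ind: y => j l; rewrite superflipE mxE.
rewrite (can_eq (@mxtens_indexK _ _)) !xpair_eqE andbC [(k == l) && _]andbC.
case: ifP => [/andP[/eqP -> /eqP ->]|_]; last by rewrite mulr0.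
by rewrite -expr2 sqrr_sign.
Qed.

Lemma Upsilon_unit (V W : wmodule) : Upsilon r V W \in unitmx.
Proof.
rewrite unitmxE /Upsilon det_diag unitfE; apply/prodf_neq0 => x _.
by rewrite mxE qpow_neq0.
Qed.

(** The two dimensions of a braiding are equal numbers but different terms, so its inverse is
    assembled from those of the square factors. *)
Definition unbraid (V W : wmodule) : 'M[C]_(wdim V * wdim W, wdim W * wdim V) :=
  invmx (Rtilde r V W) *m invmx (Upsilon r V W) *m superflip W V.

Lemma braidingK (V W : wmodule) : Rtilde r V W \in unitmx ->
  braiding r V W *m unbraid V W = 1%:M /\ unbraid V W *m braiding r V W = 1%:M.
Proof.
have uU := Upsilon_unit V W; move=> uR; rewrite /braiding /unbraid; split.
  rewrite -!mulmxA (mulmxA (Rtilde r V W)) mulmxV // mul1mx (mulmxA (Upsilon r V W)) mulmxV //.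
  by rewrite mul1mx superflip_K.
rewrite -!mulmxA (mulmxA (superflip W V)) superflip_K mul1mx (mulmxA _ (Upsilon r V W)) mulVmx //.
by rewrite mul1mx mulVmx.
Qed.

Lemma dblK (V W : wmodule) : Rtilde r V W \in unitmx -> Rtilde r W V \in unitmx ->
  dbl V W \in unitmx /\ invmx (dbl V W) = unbraid V W *m unbraid W V.
Proof.
move=> /braidingK[a b] /braidingK[c d].
have e : dbl V W *m (unbraid V W *m unbraid W V) = 1%:M.
  by rewrite /dbl -mulmxA (mulmxA (braiding r V W)) a mul1mx c.
have [u _] := mulmx1_unit e; split=> //.
by rewrite -[LHS]mulmx1 -e mulKmx.
Qed.

(* With [e] a lowest weight vector, [dbl = B2 B1] where the row [(e, k)] of [B1]
   and the column [(e, k)] of [B2] have a single nonzero entry. *)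
Lemma ptr_dbl_inv (V W : wmodule) e : is_module r V -> is_module r W ->
  Rtilde r V W \in unitmx -> Rtilde r W V \in unitmx ->
  (forall j, opE V e j = 0) -> (forall j, opF V j e = 0) ->
  ptr r (invmx (dbl V W)) e e =
  \sum_k (-1) ^+ par k * qpow r ((1 - r0%:R - wt e) * @wt _ W k).
Proof.
move=> mV mW u1 u2 hE hF; have [_ ->] := dblK u1 u2.
have [a b] := braidingK u1; have [c d] := braidingK u2.
rewrite mxE; apply: eq_bigr => k _.
rewrite [(1 - _ - _) * _]mulrDl qpowD mulrA; congr (_ * _).
pose z : C := (-1) ^+ (par e && par k) * qpow r (wt e * wt k / 2).
have z0 : z != 0 by rewrite mulf_neq0 ?signr_eq0 ?qpow_neq0.
have B1 x : braiding r V W (mxtens_index (k, e)) x = z * (mxtens_index (e, k) == x)%:R.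
  by rewrite braidingE Rtilde_row'.
have B2 x : braiding r W V x (mxtens_index (k, e)) = z * (x == mxtens_index (e, k))%:R.
  elim/tens_ind: x => i j; rewrite braidingE Rtilde_col // !(can_eq (@mxtens_indexK _ _))
    !xpair_eqE [(j == k) && _]andbC.
  have [->|_] := eqVneq i e; last by rewrite !mulr0.
  have [->|_] := eqVneq j k; last by rewrite !mulr0.
  by rewrite /z andbC [wt k * _]mulrC.
have U1 y : unbraid V W (mxtens_index (e, k)) y = z^-1 * (mxtens_index (k, e) == y)%:R.
  have /matrixP/(_ (mxtens_index (k, e)) y) := a.
  rewrite mxE; under eq_bigr do rewrite B1; rewrite sum_delta [1%:M _ _]mxE => <-.
  by rewrite mulKf.
have U2 y : unbraid W V y (mxtens_index (e, k)) = z^-1 * (y == mxtens_index (k, e))%:R.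
  have /matrixP/(_ y (mxtens_index (k, e))) := d.
  rewrite mxE; under eq_bigr do rewrite B2 mulrC eq_sym.
  by rewrite sum_delta [1%:M _ _]mxE => <-; rewrite mulKf.
rewrite mxE; under eq_bigr do rewrite U1.
rewrite sum_delta U2 eqxx mulr1 /z invfM invr_sign mulrACA -expr2 sqrr_sign mul1r.
by rewrite -!qpowN -qpowD; congr qpow; field.
Qed.

Lemma telescope_signs (mu w : C) :
  (qpow r mu + qpow r (- mu)) * (\sum_(k < r0) (-1) ^+ odd k * qpow r (mu * (w - 2 * k%:R))) =
  qpow r (mu * (w + 1)) - qpow r (mu * (w + 1 - 2 * r0%:R)).
Proof.
pose a k := (-1) ^+ odd k * qpow r (mu * (w + 1 - 2 * k%:R)).
rewrite mulr_sumr (eq_bigr (fun k : 'I_r0 => a k - a k.+1)) => [|k _].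
  rewrite -(big_mkord xpredT (fun k => a k - a k.+1)).
  rewrite (GRing.telescope_sumr_eq (fun k => - a k)) // => [|k _]; last by rewrite opprK addrC.
  by rewrite /a r0_even /= expr0 !mul1r mulr0 subr0 opprK addrC.
rewrite /a sgnS mulNr opprK mulrCA -mulrDr mulrDl -!qpowD -natr1.
by congr (_ * (qpow r _ + qpow r _)); ring.
Qed.

(** The highest weight vector, outside the image of [F]; [bot] is the lowest one, killed by [F]. In
    the dual it is [bot] that lies outside the image of [F]. *)
Definition top : 'I_r0 := Ordinal r0_gt0.
Lemma bot_subproof : (r0.-1 < r0)%N. Proof. by rewrite prednK ?r0_gt0. Qed.
Definition bot : 'I_r0 := Ordinal bot_subproof.

Lemma botE : (bot : nat)%:R = r0%:R - 1 :> C.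
Proof. by rewrite /= -[in RHS](prednK r0_gt0) -natr1 addrK. Qed.

Lemma verma_F_top (lam : C) p (j : 'I_r0) : opF (verma r lam p) top j = 0.
Proof. by rewrite verma_F. Qed.

Lemma verma_F_bot (lam : C) p (j : 'I_r0) : opF (verma r lam p) j bot = 0.
Proof.
rewrite verma_F /= prednK ?r0_gt0 //; case: eqP => // e.
by have := ltn_ord j; rewrite e ltnn.
Qed.

Lemma verma_E_bot (lam : C) p (j : 'I_r0) : opE (verma r lam p) bot j = 0.
Proof.
rewrite verma_E /= prednK ?r0_gt0 //; case: eqP => // e.
by have := ltn_ord j; rewrite -e ltnn.
Qed.

Lemma dual_F_bot (lam : C) p (j : 'I_r0) : opF (dual r (verma r lam p)) bot j = 0.
Proof.
by apply/eqP; apply: contraT => /(proj2 (dual_entries _ _)); rewrite verma_F_bot eqxx.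
Qed.

Lemma verma_wt_inj (lam : C) p : injective (@wt _ (verma r lam p)).
Proof.
move=> i j; rewrite !verma_wt => /addrI/oppr_inj/mulfI => h; apply/val_inj/eqP.
by rewrite -(eqr_nat C); apply/eqP/h; rewrite pnatr_eq0.
Qed.

Lemma verma_F_adj (lam : C) p (i j : 'I_r0) : i.+1 = j ->
  opF (verma r lam p) j i != 0.
Proof. by rewrite verma_F => ->; rewrite eqxx oner_neq0. Qed.

Lemma dual_F_adj (lam : C) p (i j : 'I_r0) : i.+1 = j ->
  opF (dual r (verma r lam p)) i j != 0.
Proof.
by move=> /(verma_F_adj lam p) n;
  rewrite mxE mulf_neq0 // mulf_neq0 ?qpow_neq0 // oppr_eq0 signr_eq0.
Qed.

Lemma hom_ptr (V W : wmodule) (f : 'M[C]_(wdim V * wdim W)) :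
  homg (gtens (@gr R V) (@gr R W)) (gtens (@gr R V) (@gr R W)) 0 f ->
  homg (@gr R V) (@gr R V) 0 (ptr r f).
Proof.
move=> hf i j; rewrite mxE => n.
have [/existsP[k nk]|nx] := boolP [exists k, f (mxtens_index (i, k)) (mxtens_index (j, k)) != 0].
  by have := hf _ _ nk; rewrite /gtens !mxtens_indexK !addr0 /= => /addIr ->.
case/eqP: n; rewrite big1 // => k _.
have : ~~ (f (mxtens_index (i, k)) (mxtens_index (j, k)) != 0).
  by apply: contra nx => ab; apply/existsP; exists k.
by rewrite negbK => /eqP ->; rewrite mulr0.
Qed.

Lemma ptr_dbl_comm (V W : wmodule) : is_module r V -> is_module r W ->
  homg (@gr R V) (@gr R V) 0 (ptr r (dbl V W)) /\
  ptr r (dbl V W) *m opF V = opF V *m ptr r (dbl V W).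
Proof.
move=> mV mW.
have h : homg (gtens (@gr R V) (@gr R W)) (gtens (@gr R V) (@gr R W)) 0 (dbl V W).
  by rewrite /dbl -[0]addr0; apply: hom_mul; apply: hom_braiding.
split; first exact: hom_ptr.
apply: ptr_comm => //.
by rewrite /dbl -mulmxA (braiding_coF r3 r_odd) // mulmxA (braiding_coF r3 r_odd) // mulmxA.
Qed.

Lemma twist_comm (V : wmodule) : is_module r V ->
  homg (@gr R V) (@gr R V) 0 (twist r V) /\ twist r V *m opF V = opF V *m twist r V.
Proof.
move=> mV; have h := hom_braiding mV mV.
by split; [exact: hom_ptr | apply: ptr_comm => //; apply: braiding_coF].
Qed.

Definition Tpow (lam : C) : C := qpow r ((lam ^+ 2 - (r0%:R - 1) ^+ 2) / 2).

Lemma twist_verma (lam : C) p : twist r (verma r lam p) = (Tpow lam)%:M.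
Proof.
have mV := verma_module lam p; have [h c] := twist_comm mV.
rewrite (scalar_endo (@verma_wt_inj lam p) h c _ top); last first.
  by move=> i j /(verma_F_adj lam p) n; right.
rewrite twist_entry; last exact: verma_F_top.
by rewrite verma_wt /= mulr0 subr0 /Tpow; congr (_%:M); congr qpow; field.
Qed.

Lemma twist_dual_verma (lam : C) p : twist r (dual r (verma r lam p)) = (Tpow lam)%:M.
Proof.
have mV := dual_verma_module lam p; have [h c] := twist_comm mV.
rewrite (scalar_endo _ h c _ bot); first last.
- by move=> i j /(dual_F_adj lam p) n; left.
- by move=> i j; rewrite !dual_wt => /oppr_inj/verma_wt_inj.
rewrite twist_entry; last exact: dual_F_bot.
by rewrite dual_wt verma_wt botE /Tpow; congr (_%:M); congr qpow; field.
Qed.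

(** The denominator of [mdim]. It is invariant under shifts by [2Z], and its powers make up the
    torsion. *)
Definition Xd (lam : C) : C := qpow r (r0%:R * lam) - qpow r (- (r0%:R * lam)).

Lemma Xd_neq0 lam : Xd lam != 0 -> qpow r lam + qpow r (- lam) != 0.
Proof.
apply: contra => /eqP e; rewrite /Xd subr_eq0.
have -> : - (r0%:R * lam) = (- lam) *+ r0 by rewrite mulNrn mulr_natl.
have -> : r0%:R * lam = lam *+ r0 by rewrite mulr_natl.
have e' : qpow r lam = - qpow r (- lam) by apply/eqP; rewrite -addr_eq0 e.
by rewrite !qpowMn e' exprNn -signr_odd r0_even mul1r.
Qed.

Lemma mdim_neq0 lam : Xd lam != 0 -> mdim r lam != 0.
Proof. by move=> X0; rewrite /mdim mulf_neq0 ?invr_neq0 ?Xd_neq0. Qed.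

(** The open Hopf link: the alternating geometric sum telescopes, and the quotient left over is the
    inverse of the modified dimension. *)
Lemma sum_open (mu w : C) : Xd mu != 0 ->
  \sum_(k < r0) (-1) ^+ odd k * qpow r (mu * (w - 2 * k%:R)) =
  qpow r (mu * (w + 1 - r0%:R)) / mdim r mu.
Proof.
move=> X0; have d0 := Xd_neq0 X0; apply: (mulfI d0); rewrite telescope_signs /mdim.
rewrite invf_div -/(Xd mu).
have -> : (qpow r mu + qpow r (- mu)) * (qpow r (mu * (w + 1 - r0%:R)) * (Xd mu / (qpow r mu
  + qpow r (- mu)))) =
    qpow r (mu * (w + 1 - r0%:R)) * Xd mu by rewrite mulrCA [_ * (Xd mu / _)]mulrC divfK.
by rewrite /Xd [RHS]mulrBr -!qpowD; congr (qpow r _ - qpow r _); ring.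
Qed.

Lemma encircle_verma (lam mu : C) p c : Xd mu != 0 ->
  encircle r (verma r mu p) (c%:M : 'M[C]_(wdim (verma r lam false))) =
  (c * qpow r (lam * mu) / mdim r mu)%:M.
Proof.
move=> X0; set V := verma r mu p; set W := verma r lam false.
have mV : is_module r V := verma_module mu p; have mW : is_module r W := verma_module lam false.
have -> : encircle r V (c%:M : 'M[C]_(wdim W)) = c *: ptr r (dbl V W).
  rewrite /encircle -/(dbl V W) -ptrZ.
  have -> : (1%:M : 'M[C]_(wdim V)) *t (c%:M : 'M[C]_(wdim W)) = c%:M.
    apply/matrixP => x y; elim/tens_ind: x => i k; elim/tens_ind: y => j l.
    by rewrite tensmxE !mxE (can_eq (@mxtens_indexK _ _)) xpair_eqE; case: eqP => _;
      rewrite ?mul1r ?mul0r.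
  by rewrite mul_mx_scalar.
have [h cm] := ptr_dbl_comm mV mW.
rewrite (scalar_endo (@verma_wt_inj mu p) h cm _ top); last first.
  by move=> i j /(verma_F_adj mu p) n; right.
rewrite ptr_dbl //; last exact: verma_F_top.
rewrite -mul_scalar_mx -scalar_mxM -mulrA; congr (_ * _)%:M.
rewrite /V /W verma_wt /= mulr0 subr0.
rewrite (eq_bigr (fun k : 'I_r0 =>
  (-1) ^+ odd k * qpow r (mu * (lam + r0%:R - 1 - 2 * k%:R)))) => [|k _].
  by rewrite sum_open //; congr (qpow r _ / _); ring.
by congr (_ * qpow r _); ring.
Qed.

Lemma Xd_shift lam (m : int) : Xd (lam + (2 * m)%:~R) = Xd lam.
Proof.
have e (k : int) : qpow r (r0%:R * (2 * k)%:~R) = 1 :> C.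
  have /dvdnP[t tE] := r0_dvd r; rewrite /qpow {1}tE natrM.
  have -> : t%:R * r%:R * (2 * k)%:~R / r%:R = (t%:Z * (2 * k))%:~R :> C.
    rewrite [in RHS]intrM -pmulrn; field; rewrite pnatr_eq0; by move: r3; case: r.
  exact: e2pi_int.
rewrite /Xd !mulrDr opprD !qpowD e mulr1; congr (_ - _).
by rewrite [qpow r (- (_ * (2 * m)%:~R))]qpowN e invr1 mulr1.
Qed.

(* If the degenerate value occurs, some [ecoef] vanishes and [F^j v] generates a
   proper submodule. *)
Lemma verma_not_simple (lam : C) (j : nat) : (0 < j < r0)%N ->
  ecoef (lam + r0%:R - 1) j = 0 -> atypical r lam.
Proof.
move=> /andP[j0 jr] ej [_ simple].
pose U : 'M[C]_r0 := diag_mx (\row_i (j <= i)%N%:R).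
have UA (A : 'M[C]_r0) : (forall a b : 'I_r0, (j <= a)%N -> (b < j)%N -> A a b = 0) -> stablemx U A.
  move=> hA; apply/submxP; exists (U *m A); apply/matrixP => a b.
  rewrite [RHS]mxE (bigD1 b) //= big1 ?addr0 => [|c cb].
    rewrite mul_diag_mx !mxE eqxx mulr1n; have [jb|bj] := leqP j b; first by rewrite mulr1.
    by rewrite mulr0; have [ja|aj] := leqP j a; rewrite ?mul0r // hA ?mulr0.
  by rewrite [U c b]mxE (negPf cb) mulr0n mulr0.
have dA (d : 'rV[C]_r0) : stablemx U (diag_mx d)^T.
  apply: UA => a b ja bj; rewrite !mxE; case: eqP => [e|_]; last by rewrite mulr0n.
  by move: bj; rewrite e ltnNge ja.
have [||||U0|] := simple U.
- apply: UA => a b ja bj; rewrite mxE verma_E; case: ifP => // /eqP e.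
  by have -> : a = j :> nat by apply/eqP; rewrite eqn_leq ja -e bj.
- apply: UA => a b ja bj; rewrite mxE verma_F; case: eqP => // e.
  by move: (leq_ltn_trans ja (ltnW (leqnn _))); rewrite -e => jb;
    have := ltn_trans (leq_ltn_trans ja _) bj; lia.
- exact: dA.
- exact: dA.
- have /matrixP/(_ (Ordinal jr) (Ordinal jr)) := U0.
  by rewrite !mxE eqxx leqnn mulr1n => /eqP; rewrite oner_eq0.
rewrite row_full_unit => uU.
have d0 : delta_mx 0 top *m U = 0 :> 'rV[C]_r0.
  apply/matrixP => a b; rewrite mul_mx_diag !mxE.
  by case: (b =P top) => [->|_]; [rewrite leqNgt j0 mulr0 | rewrite andbF mul0r].
have /matrixP/(_ 0 top) : delta_mx 0 top = 0 :> 'rV[C]_r0 by rewrite -[LHS](mulmxK uU) d0 mul0mx.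
by rewrite !mxE !eqxx => /eqP; rewrite oner_eq0.
Qed.

(** If [Xd] vanishes, [- q^(2 (alpha + 1))] is a root of unity of order dividing [r0], hence the
    [i]-th power of the primitive root [- q ^+ 2]. Then [ecoef] vanishes at an index [j] congruent
    to [i] modulo 2, for a weight in the class of [alpha]. *)
Lemma generic_Xd (alpha : C) : ~ exceptional r alpha -> Xd (alpha + 1) != 0.
Proof.
move=> ne; apply: contra_notN ne => /eqP X0.
have X1 : (- qpow r (2 * (alpha + 1))) ^+ r0 = 1.
  rewrite exprNn -signr_odd r0_even mul1r -qpowMn.
  move/eqP: X0; rewrite subr_eq0 => /eqP e.
  have -> : (2 * (alpha + 1)) *+ r0 =
    r0%:R * (alpha + 1) + r0%:R * (alpha + 1) by rewrite -mulr_natl; ring.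
  by rewrite qpowD {1}e -qpowD addNr qpow0.
have [i e] := prim_rootP (primitive_root_q R r3 r_odd) X1.
have e2 : qpow r (2 * (alpha + 1)) = (-1) ^+ i.+1 * qpow r (2 * i%:R).
  by rewrite -[LHS]opprK e (exprNn (q ^+ 2)) -natrM qpow_nat exprM [(-1) ^+ i.+1]exprS mulN1r mulNr.
have gauss_identity (m : int) (j : nat) : (0 < j < r0)%N -> j%:Z =
  i%:Z + 2 * m -> exceptional r alpha.
  move=> jr je; exists (alpha + (2 * m)%:~R).
    by exists (- m); rewrite opprD addNKr mulrN mulrNz.
  apply: (verma_not_simple jr); rewrite ecoefE.
  set w := _ - 1; set y := qpow r (w + 1 - j%:R).
  suff e3 : y * y = (-1) ^+ j.+1.
    have y0 : y != 0 by exact: qpow_neq0.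
    rewrite qpowN -/y; have -> : y + (-1) ^+ j / y = 0; last by rewrite mulr0 mul0r.
    by apply: (mulIf y0); rewrite mulrDl divfK // e3 exprS mul0r; ring.
  rewrite -qpowD.
  have -> : w + 1 - j%:R + (w + 1 - j%:R) = 2 * (alpha + 1) + (2 * (2 * m%:~R - j%:R)).
    by rewrite /w intrM; ring.
  have -> : 2 * m%:~R - j%:R = - i%:R :> C.
    by have := congr1 (fun z : int => z%:~R : C) je; rewrite intrD intrM -!pmulrn => ->; ring.
  rewrite qpowD e2 -mulrA -qpowD mulrN subrr qpow0 mulr1.
  rewrite -signr_odd -[RHS]signr_odd /=; congr (_ ^+ ~~ _).
  by move: je; lia.
have := ltn_ord i; have r02 := r0_gt2 r3 r_odd.
(* The index [j = 0] is not admissible in [verma_not_simple]; for [i = 0] the representative of the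
   class is moved by 2 and [j = 2] is used. *)
case: (posnP i) => [i0|ip] ir; first by apply: (gauss_identity 1 2%N); rewrite ?i0.
by apply: (gauss_identity 0 i); rewrite ?ip ?ir //; lia.
Qed.

End Verma.

(* [h = 2] for odd [r] and [h = 1] for even [r]; then [r0 = 2 p], [r' = p] and
   [2 / r = h / p] treat the two congruence classes of [r] at once. *)
Section RootOrder.
Variables (R : realType) (r p h : nat) (delta j : int).
Local Notation C := R[i].
Local Notation er := (er R).
Hypothesis r3 : (3 <= r)%N.
Hypothesis po : odd p.
Hypothesis hrp : (h = 2 /\ r = p) \/ (h = 1 /\ r = (2 * p)%N).
Hypothesis delta2 : delta * delta = 1.
Hypothesis pE : p%:Z = 4 * j * h%:Z + delta.

Lemma par_r_odd : odd r \/ exists2 p, odd p & r = (2 * p)%N.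
Proof. by case: hrp => -[_ ->]; [left | right; exists p]. Qed.
Let r_odd := par_r_odd.

Lemma par_p0 : (0 < p)%N. Proof. by case: p po. Qed.
Lemma par_h0 : (0 < h)%N. Proof. by case: hrp => -[-> _]. Qed.
Let p0 := par_p0.
Let h0 := par_h0.

Lemma par_hr : (h * r = 2 * p)%N. Proof. by case: hrp => -[-> ->]; rewrite ?mul1n. Qed.

Lemma par_r0 : r0 r = (2 * p)%N.
Proof. by rewrite /r0; case: hrp => -[_ ->]; rewrite ?po // oddM. Qed.

Lemma par_r' : r' r = p.
Proof.
rewrite /r'; case: hrp => -[_ ->].
  have /eqP -> : coprime 2 p by rewrite coprime2n.
  by rewrite divn1.
by rewrite gcdnMr mulKn.
Qed.

Lemma p_neq0 (F : numDomainType) : p%:R != 0 :> F.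
Proof. by rewrite pnatr_eq0 -lt0n. Qed.

Lemma qpow_er (x : rat) : qpow r (ratr x : C) = er (x * h%:R / (2 * p%:R)).
Proof.
have r1 : r%:R != 0 :> rat by rewrite pnatr_eq0; case: r r3.
have h1 : h%:R != 0 :> rat by rewrite pnatr_eq0 -lt0n.
rewrite /qpow /er; congr e2pi.
have -> : x * h%:R / (2 * p%:R) = x / r%:R.
  by rewrite -natrM -par_hr natrM; field; rewrite r1 h1.
by rewrite fmorph_div rmorph_nat.
Qed.

(** Reciprocity for the form [(1)] of rank one: the lattice is unimodular, so the dual side is 1. *)
Lemma gauss_Zp : \sum_(i < p) er (h%:R / p%:R * i%:R ^+ 2) =
  sqrtC p%:R * er (- ((delta%:~R - 1) / 8)).
Proof.
have e1 : map_mx intr (1%:M : 'M[int]_1) *m (1%:M : 'M[rat]_1) = 1%:M.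
  by rewrite map_mx1 mulmx1.
have e2 : (1%:M : 'M[int]_1)^T *m 1%:M *m 1%:M = diag_mx (const_mx 1) :> 'M[int]_1.
  by rewrite !mulmx1 trmx1 diag_const_mx.
have := @reciprocity R 1 1%:M 1%:M e1 (trmx1 _ _) 1%:M 1%:M (const_mx 1) e1 e2 delta j h p
  delta2 h0 p0 pE 0.
rewrite (kap_unimodular R (mulmx1 1%:M)) mul1r.
rewrite big_ord1 mxE expr1 mulr1.
have b1 (x y : 'cV[int]_1) : bf 1%:M x y = (x ord0 ord0 * y ord0 ord0)%:~R.
  by rewrite /bf mulmx1 mxE big_ord1 !mxE intrM.
have -> : gauss_rhs R 1%:M delta j h (0 : 'cV[int]_1) = 1.
  rewrite /gauss_rhs; transitivity (Av (fun _ : 'cV[int]_1 => 1 : C)); last exact: Av_cst.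
  apply: eq_Av => a; transitivity (Av (fun _ : 'cV[int]_1 => 1 : C)); last exact: Av_cst.
  apply: eq_Av => f; apply: er_int_num; rewrite !b1 add0r.
  by rewrite rpredD ?rpredB ?rpredN ?rpredM ?rpred_int ?rpred_nat.
have -> : gauss_lhs R 1%:M 1%:M h p (0 : 'cV[int]_1) =
  p%:R^-1 * \sum_(i < p) er (h%:R / p%:R * i%:R ^+ 2).
  rewrite /gauss_lhs (@AvE _ _ p) // ?mean1.
    congr (_ * _); apply: eq_bigr => i _; congr er; congr (_ * _).
    by rewrite map_mx1 !b1 !mxE !mulr0 !addr0 mulr1n intrM expr2.
  move=> x y; apply: er_congr; rewrite map_mx1 !b1 !mxE !mulr0 !addr0 mulmxnE.
  set u := x _ _; set v := y _ _.
  have -> : h%:R / p%:R * ((u + v *+ p) * (u + v *+ p))%:~R - h%:R / p%:R * (u * u)%:~R =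
     h%:R * (v * (2 * u + v *+ p))%:~R :> rat.
    rewrite -[v *+ p]mulr_natr !(intrM, intrD) -!pmulrn natz; field; exact: p_neq0.
  by rewrite rpredM ?rpred_nat ?rpred_int.
rewrite mul1r => e; apply: (mulfI (invr_neq0 (p_neq0 C))); rewrite e mulrA; congr (_ * _).
rewrite ?mul1r -[X in _ = X^-1 * _]sqrtCK expr2 invfM mulfVK // sqrtC_eq0.
exact: p_neq0.
Qed.

Lemma qpow_2p (k : int) : qpow r (2 * p%:R * k%:~R : C) = 1.
Proof.
have -> : 2 * p%:R * k%:~R = ratr (2 * p%:R * k%:~R) :> C.
  by rewrite !rmorphM /= !rmorph_nat ratr_int.
rewrite qpow_er; apply: er_int_num.
have -> : 2 * p%:R * k%:~R * h%:R / (2 * p%:R) = k%:~R * h%:R :> rat by field; exact: p_neq0.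
by rewrite rpredM ?rpred_int ?rpred_nat.
Qed.

Lemma qpow_congr (k : int) (x y : C) : x = y + 2 * p%:R * k%:~R -> qpow r x = qpow r y.
Proof. by move=> ->; rewrite qpowD qpow_2p mulr1. Qed.

Lemma shift_sum (f : nat -> C) : f p = f 0%N ->
  \sum_(i < p) f i.+1 = \sum_(i < p) f i.
Proof.
move=> e; apply: (addrI (f 0%N)); rewrite -[in LHS](big_mkord xpredT (fun i => f i.+1)).
by rewrite -[LHS]big_nat_recl // big_nat_recr //= e addrC big_mkord.
Qed.

(** * The constants of stabilization *)

Definition Gp (a : int) : C := \sum_(i < p) qpow r (a%:~R * (2 * i%:R ^+ 2 + 2 * i%:R)).

Lemma Gp_sym (a : int) : \sum_(i < p) qpow r (a%:~R * (2 * i%:R ^+ 2 - 2 * i%:R)) = Gp a.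
Proof.
rewrite -(shift_sum (f := fun i => qpow r (a%:~R * (2 * i%:R ^+ 2 - 2 * i%:R)))).
  by apply: eq_bigr => i _; rewrite -natr1; congr qpow; ring.
have -> : a%:~R * (2 * p%:R ^+ 2 - 2 * p%:R) = 2 * p%:R * (a * (p%:Z - 1))%:~R :> C.
  by rewrite intrM intrD -pmulrn; ring.
by rewrite qpow_2p -[0%:R]/(0 : C) expr2 !mulr0 subr0 mulr0 qpow0.
Qed.

(** With [mu = alpha + 1] the colours [alpha + I_r i] are [mu + eps i]. *)
Let eps (i : nat) : C := - (2 * p%:R) + 2 * i%:R.

(** The dependence on [mu] splits off as the numerator of [mdim], because the two remaining
    quadratic sums agree after a shift of the index. Hence [Delta] does not depend on [mu]. *)
Lemma eps_sum (a : int) (mu : C) : a = 1 \/ a = -1 ->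
  \sum_(i < p) qpow r (a%:~R * (eps i ^+ 2 / 2)) * (qpow r (mu + eps i) + qpow r (- (mu + eps i))) =
  (qpow r mu + qpow r (- mu)) * Gp a.
Proof.
have red (b : int) (i : nat) :
    qpow r (a%:~R * (eps i ^+ 2 / 2)) * qpow r (b%:~R * eps i) =
    qpow r (a%:~R * (2 * i%:R ^+ 2) + b%:~R * (2 * i%:R)).
  rewrite -qpowD; apply: (qpow_congr (k := a * (p%:Z - 2 * i%:Z) - b)).
  by rewrite !(intrB, intrM) -!pmulrn /eps; field.
move=> ha; rewrite (eq_bigr (fun i : 'I_p =>
   qpow r mu * qpow r (a%:~R * (2 * i%:R ^+ 2) + 1%:~R * (2 * i%:R)) +
   qpow r (- mu) * qpow r (a%:~R * (2 * i%:R ^+ 2) + (-1)%:~R * (2 * i%:R)))) => [|i _].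
  rewrite big_split /= -!mulr_sumr mulrDl; congr (_ * _ + _ * _); case: ha => ->.
  - by apply: eq_bigr => i _; congr qpow; ring.
  - by rewrite -Gp_sym; apply: eq_bigr => i _; congr qpow; ring.
  - by rewrite -Gp_sym; apply: eq_bigr => i _; congr qpow; ring.
  - by apply: eq_bigr => i _; congr qpow; ring.
rewrite -!red mul1r mulN1r opprD !qpowD; ring.
Qed.

Lemma r0C : (r0 r)%:R = 2 * p%:R :> C.
Proof. by rewrite par_r0 natrM. Qed.

Lemma tens_scalar m n (a b : C) : (a%:M : 'M[C]_m) *t (b%:M : 'M[C]_n) = (a * b)%:M.
Proof.
apply/matrixP => x y; elim/tens_ind: x => i k; elim/tens_ind: y => l o.
rewrite tensmxE !mxE (can_eq (@mxtens_indexK _ _)) xpair_eqE.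
by case: (i == l); case: (k == o); rewrite ?mulr1n ?mulr0n ?mulr0 ?mul0r.
Qed.

Lemma twist_tensE (mu lam : C) :
  twist_tens r (verma r mu false) (dual r (verma r lam false)) =
  (Tpow r mu * Tpow r lam) *: dbl r (verma r mu false) (dual r (verma r lam false)).
Proof.
by rewrite /twist_tens (twist_verma r3 r_odd) (twist_dual_verma r3 r_odd) tens_scalar mul_mx_scalar.
Qed.

Lemma Xd_eps mu i : Xd r (mu + eps i) = Xd r mu.
Proof.
rewrite -(Xd_shift r3 mu (i%:Z - p%:Z)); congr Xd.
by rewrite intrM intrB -!pmulrn /eps; ring.
Qed.

Lemma mdim_opp (mu : C) : mdim r (- mu) = - mdim r mu.
Proof.
by rewrite /mdim mulrN !opprK -[RHS]mulrN -invrN opprB addrC.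
Qed.

Lemma mdim_ratio mu i : Xd r mu != 0 -> mdim r (mu + eps i) / mdim r mu =
  (qpow r (mu + eps i) + qpow r (- (mu + eps i))) / (qpow r mu + qpow r (- mu)).
Proof.
move=> X0; have d0 := Xd_neq0 X0.
by rewrite /mdim -/(Xd r mu) -/(Xd r (mu + eps i)) Xd_eps; field; rewrite d0 X0.
Qed.

(** Both twists together with the linking term have quadratic part [eps i ^+ 2 / 2]; the rest is
    [q^-a], since [(r0 - 1)^2] is 1 modulo [2 p]. *)
Lemma Tpow_prod (mu : C) i (a : int) : a = 1 \/ a = -1 ->
  qpow r (a%:~R * (((mu ^+ 2 - ((r0 r)%:R - 1) ^+ 2) / 2 +
     ((mu + eps i) ^+ 2 - ((r0 r)%:R - 1) ^+ 2) / 2) - mu * (mu + eps i))) =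
  qpow r (- a%:~R) * qpow r (a%:~R * (eps i ^+ 2 / 2)).
Proof.
move=> ha; rewrite -qpowD; apply: (qpow_congr (k := a * (2 - 2 * p%:Z))).
by rewrite r0C !(intrB, intrM) -!pmulrn; field.
Qed.

(** The defining identity holds for all modules of generic degree, so one entry of one instance
    determines [D]: the highest weight entry for the Verma module at [mu = alpha + 1]. The minus
    sign is [mdim_opp], the encircling module being a dual. *)
Lemma Delta_plus (D alpha : C) : ~ exceptional r alpha -> is_Delta r true D ->
  D = - (qpow r (-1) * Gp 1).
Proof.
move=> ne DP; set mu := alpha + 1.
have X0 : Xd r mu != 0 by exact: generic_Xd.
have X0' : Xd r (- mu) != 0 by rewrite /Xd mulrN opprK -oppr_eq0 opprB.
have d0 := Xd_neq0 X0.
have mV := verma_module r3 r_odd mu false.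
have wV i : congr2Z (@wt _ (verma r mu false) i) alpha.
  by exists (p%:Z - i%:Z); rewrite verma_wt r0C /mu !intrM intrB -!pmulrn; ring.
move: (DP _ _ ne mV wV) => /matrixP/(_ (top r3 r_odd) (top r3 r_odd)).
rewrite [RHS]mxE eqxx mulr1n => <-; rewrite summxE.
rewrite (eq_bigr (fun i : 'I_(r' r) => 
    - (qpow r (- 1%:~R) / (qpow r mu
      + qpow r (- mu)) * (qpow r (1%:~R * (eps i ^+ 2 / 2)) * (qpow r (mu + eps i)
        + qpow r (- (mu + eps i))))))) => [|i _].
  rewrite sumrN -mulr_sumr par_r' eps_sum; last by left.
  by congr (- _); rewrite mulrA divfK.
have -> : alpha + I_r R i = mu + eps i by rewrite /I_r r0C /mu /eps; ring.
cbv zeta; rewrite twist_tensE ptrZ mxE [X in _ * X]mxE.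
have mW := dual_verma_module r3 r_odd (mu + eps i) false.
rewrite ptr_dbl //; last exact: verma_F_top.
rewrite (eq_bigr (fun k : 'I_(r0 r) =>
  (-1) ^+ odd k * qpow r (- mu * (mu + eps i + (r0 r)%:R - 1 - 2 * k%:R)))) => [|k _]; last first.
  by rewrite dual_wt dual_par !verma_wt verma_par /= ?addFb mulr0 subr0; congr (_ * qpow r _); ring.
rewrite sum_open // mdim_opp.
have -> : - mu * (mu + eps i + (r0 r)%:R - 1 + 1 - (r0 r)%:R) = - (mu * (mu + eps i)) by ring.
have e := mdim_ratio i X0; have m0 := mdim_neq0 X0.
transitivity (- ((Tpow r mu * Tpow r (mu + eps i) * qpow r (- (mu * (mu + eps i)))) *
    (mdim r (mu + eps i) / mdim r mu))); first by field.
have := @Tpow_prod mu i 1 (or_introl erefl).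
rewrite e /Tpow -!qpowD !mul1r => ->.
by congr (- _); rewrite qpowD; field.
Qed.

Lemma mxtens_lt m n (i k : 'I_m) (i' k' : 'I_n) :
  (mxtens_index (i, i') < mxtens_index (k, k'))%N -> (i <= k)%N.
Proof.
move=> /= lt; rewrite leqNgt; apply/negP => ki; move: lt; rewrite ltnNge => /negP; apply.
apply: (@leq_trans (k.+1 * n)); first by rewrite mulSn addnC leq_add2r ltnW.
by apply: leq_trans (leq_addr _ _); rewrite leq_mul2r ki orbT.
Qed.

Lemma Rtilde_off (s : int) (V W : wmodule R) i i' k k' :
  homg (fun i : 'I_(wdim V) => i%:Z) (fun i => i%:Z) s (opE V) ->
  mxtens_index (i, i') != mxtens_index (k, k') ->
  (forall l : nat, i%:Z <> k%:Z + s *+ l.+1) ->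
  Rtilde r V W (mxtens_index (i, i')) (mxtens_index (k, k')) = 0.
Proof.
move=> hs ne nl; rewrite (Rtilde_entry r3 r_odd) => [|l]; first by rewrite (negPf ne).
rewrite tensmxE mxE big1 ?mul0r // => a _.
have [->|n] := eqVneq (mxpow (opE V) l.+1 i a) 0; first by rewrite mul0r.
have [->|n'] := eqVneq (mxpow (opS V) l.+1 a k) 0; first by rewrite mulr0.
case: (nl l); rewrite (hom_pow hs n); congr (_ + _).
have hS : homg (fun i : 'I_(wdim V) => i%:Z) (fun i => i%:Z) 0 (opS V) by exact: hom_diag.
by rewrite (hom_pow hS n') mul0rn addr0.
Qed.

(** In the lexicographic order of the tensor basis [Rtilde] is unitriangular, lower or upper
    according to the direction [s] in which [E] moves the index. *)
Lemma Rtilde_unit (s : int) (V W : wmodule R) : s = 1 \/ s = -1 -> is_module r W ->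
  homg (fun i : 'I_(wdim V) => i%:Z) (fun i => i%:Z) s (opE V) -> Rtilde r V W \in unitmx.
Proof.
move=> hs mW hE; rewrite unitmxE unitfE.
suff -> : \det (Rtilde r V W) = 1 by rewrite oner_neq0.
have tr1 : \prod_x Rtilde r V W x x = 1 by rewrite big1 // => x _; rewrite (Rtilde_diag r3 r_odd).
case: hs => es; last rewrite -det_tr.
  rewrite det_trig //; apply/is_trig_mxP => x y.
  elim/tens_ind: x => i i'; elim/tens_ind: y => k k' lt.
  apply: (Rtilde_off hE) => [|l]; first by rewrite neq_ltn lt.
  by have := mxtens_lt lt; rewrite es natz; lia.
rewrite det_trig; first by under eq_bigr do rewrite mxE.
apply/is_trig_mxP => x y; rewrite mxE.
elim/tens_ind: x => i i'; elim/tens_ind: y => k k' lt.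
apply: (Rtilde_off hE) => [|l]; first by rewrite neq_ltn lt orbT.
by have := mxtens_lt lt; rewrite es mulNrn natz; lia.
Qed.

(** The inverse twist is read at the lowest weight vector, where [ptr_dbl_inv] applies. *)
Lemma Delta_minus (D alpha : C) : ~ exceptional r alpha -> is_Delta r false D ->
  D = qpow r 1 * Gp (-1).
Proof.
move=> ne DP; set mu := alpha + 1.
have X0 : Xd r mu != 0 by exact: generic_Xd.
have d0 := Xd_neq0 X0.
have mV := verma_module r3 r_odd mu false.
have wV i : congr2Z (@wt _ (verma r mu false) i) alpha.
  by exists (p%:Z - i%:Z); rewrite verma_wt r0C /mu !intrM intrB -!pmulrn; ring.
move: (DP _ _ ne mV wV) => /matrixP/(_ (bot r3 r_odd) (bot r3 r_odd)).
rewrite [RHS]mxE eqxx mulr1n => <-; rewrite summxE.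
rewrite (eq_bigr (fun i : 'I_(r' r) => 
    (qpow r (- (-1)%:~R) / (qpow r mu
      + qpow r (- mu)) * (qpow r ((-1)%:~R * (eps i ^+ 2 / 2)) * (qpow r (mu + eps i)
        + qpow r (- (mu + eps i))))))) => [|i _].
  rewrite -mulr_sumr par_r' eps_sum; last by right.
  by rewrite mulrA divfK // mulrNz opprK.
have -> : alpha + I_r R i = mu + eps i by rewrite /I_r r0C /mu /eps; ring.
have mW := dual_verma_module r3 r_odd (mu + eps i) false.
have u1 : Rtilde r (verma r mu false) (dual r (verma r (mu + eps i) false)) \in unitmx.
  apply: (@Rtilde_unit (-1)) => //; first by right.
  by move=> a b; apply: verma_Edeg.
have u2 : Rtilde r (dual r (verma r (mu + eps i) false)) (verma r mu false) \in unitmx.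
  apply: (@Rtilde_unit 1) => //; first by left.
  move=> a b /(proj1 (dual_entries _ _))/verma_Edeg e; symmetry.
  exact: (etrans (congr1 (fun z : int => z + 1) (e r3 r_odd)) (subrK _ _)).
have [uD _] := dblK u1 u2.
cbv zeta; rewrite twist_tensE invmxZ; last by rewrite unitmxZ // unitfE mulf_neq0 ?qpow_neq0.
rewrite ptrZ mxE [X in _ * X]mxE ptr_dbl_inv //; first last.
- exact: verma_F_bot.
- exact: verma_E_bot.
rewrite (eq_bigr (fun k : 'I_(r0 r) =>
  (-1) ^+ odd k * qpow r (mu * (mu + eps i + (r0 r)%:R - 1 - 2 * k%:R)))) => [|k _]; last first.
  rewrite dual_wt dual_par !verma_wt verma_par botE /= ?addFb; congr (_ * qpow r _); ring.
rewrite sum_open //.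
have -> : mu * (mu + eps i + (r0 r)%:R - 1 + 1 - (r0 r)%:R) = (mu * (mu + eps i)) by ring.
have e := mdim_ratio i X0; have m0 := mdim_neq0 X0.
transitivity ((qpow r (- ((mu ^+ 2 - ((r0 r)%:R - 1) ^+ 2) / 2)) * qpow r (- (((mu
  + eps i) ^+ 2 - ((r0 r)%:R - 1) ^+ 2) / 2)) * qpow r (mu * (mu + eps i))) *
    (mdim r (mu + eps i) / mdim r mu)).
  by rewrite invfM /Tpow -!qpowN; field.
have := @Tpow_prod mu i (-1) (or_intror erefl); set T := qpow r _ => eT.
have -> : qpow r (- ((mu ^+ 2 - ((r0 r)%:R - 1) ^+ 2) / 2)) *
    qpow r (- (((mu + eps i) ^+ 2 - ((r0 r)%:R - 1) ^+ 2) / 2)) * qpow r (mu * (mu + eps i)) = T.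
  by rewrite -!qpowD /T; congr qpow; ring.
by rewrite e eT; field.
Qed.

Lemma shift_sumn (f : nat -> C) c : (forall i, f (i + p)%N = f i) ->
  \sum_(i < p) f (i + c)%N = \sum_(i < p) f i.
Proof.
move=> fp; elim: c => [|c IH]; first by apply: eq_bigr => i _; rewrite addn0.
rewrite -IH -[RHS](shift_sum (f := fun i => f (i + c)%N)); last by rewrite addnC fp.
by apply: eq_bigr => i _; rewrite addnS.
Qed.

Lemma Gp_term (a : int) (i : nat) : qpow r (a%:~R * (2 * i%:R ^+ 2 + 2 * i%:R)) =
  er (a%:~R * (h%:R / p%:R * (i%:R ^+ 2 + i%:R))).
Proof.
have nE (F : pzSemiRingType) : 2 * i%:R ^+ 2 + 2 * i%:R = (2 * i ^ 2 + 2 * i)%:R :> F.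
  by rewrite natrD 2!natrM natrX.
have -> : a%:~R * (2 * i%:R ^+ 2 + 2 * i%:R) = ratr (a%:~R * (2 * i%:R ^+ 2 + 2 * i%:R)) :> C.
  by rewrite !nE rmorphM /= ratr_int ratr_nat.
by rewrite qpow_er; congr er; field; exact: p_neq0.
Qed.

Lemma Gp_er (a : int) : a = 1 \/ a = -1 ->
  Gp a = sqrtC p%:R * er (a%:~R * (h%:R * p%:R / 4 - h%:R / (4 * p%:R) - (delta%:~R - 1) / 8)).
Proof.
have p1 := p_neq0 rat.
have one : Gp 1 = sqrtC p%:R * er (h%:R * p%:R / 4 - h%:R / (4 * p%:R) - (delta%:~R - 1) / 8).
  rewrite [er _](_ : _ = er (h%:R * p%:R / 4 - h%:R / (4 * p%:R))
    * er (- ((delta%:~R - 1) / 8))); last by rewrite -erD.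
  rewrite mulrCA -gauss_Zp.
  (* [c] is one half modulo [p], so [i^2 + i] is completed to [(i + c)^2] by a translation of the
     summation index. *)
  pose c := p.+1./2; have cE : p%:R = 2 * c%:R - 1 :> rat.
    by rewrite -natrM mul2n /c -[p.+1./2.*2]add0n -[0%N]/(false : nat) -[false]/(~~ true) -po
      -oddS odd_double_half -natr1 addrK.
  rewrite -(shift_sumn (f := fun i => er (h%:R / p%:R * i%:R ^+ 2)) c) => [|i]; last first.
    apply: er_congr; rewrite natrD.
    have -> : h%:R / p%:R * (i%:R + p%:R) ^+ 2 - h%:R / p%:R * i%:R ^+ 2 =
      h%:R * (2 * i%:R + p%:R) :> rat by field.
    by rewrite rpredM ?rpredD ?rpredM ?rpred_nat.
  rewrite /Gp mulr_sumr; apply: eq_bigr => i _; rewrite Gp_term -erD; apply: er_congr.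
  rewrite natrD mul1r.
  have -> : h%:R / p%:R * (i%:R ^+ 2 + i%:R) -
    (h%:R * p%:R / 4 - h%:R / (4 * p%:R) + h%:R / p%:R * (i%:R + c%:R) ^+ 2) =
      - (h%:R * i%:R + h%:R * c%:R) :> rat.
    have -> : c%:R = (p%:R + 1) / 2 :> rat by rewrite cE; field.
    by field.
  by rewrite rpredN rpredD ?rpredM ?rpred_nat.
case=> ->; first by rewrite mul1r.
rewrite mulN1r -conj_er -[sqrtC _](_ : (sqrtC p%:R)^* = _); last first.
  by apply/CrealP; rewrite realE sqrtC_ge0 ler0n.
rewrite -rmorphM /= -one /Gp rmorph_sum; apply: eq_bigr => i _.
rewrite !Gp_term -[RHS]/((er _)^*) conj_er.
by rewrite mul1r mulN1r.
Qed.

Lemma Delta_plus_er (D alpha : C) : ~ exceptional r alpha -> is_Delta r true D ->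
  D = - (sqrtC p%:R * er (h%:R * p%:R / 4 - 3 * h%:R / (4 * p%:R) - (delta%:~R - 1) / 8)).
Proof.
move=> /Delta_plus h1 /h1 ->; rewrite Gp_er; last by left.
rewrite mulrCA; congr (- (_ * _)).
have -> : -1 = ratr (-1) :> C by rewrite rmorphN rmorph1.
rewrite qpow_er -erD; congr er; field; exact: p_neq0.
Qed.

Lemma Delta_minus_er (D alpha : C) : ~ exceptional r alpha -> is_Delta r false D ->
  D = sqrtC p%:R * er (- (h%:R * p%:R / 4 - 3 * h%:R / (4 * p%:R) - (delta%:~R - 1) / 8)).
Proof.
move=> /Delta_minus h1 /h1 ->; rewrite Gp_er; last by right.
rewrite mulrCA; congr (_ * _).
have -> : 1 = ratr 1 :> C by rewrite rmorph1.
rewrite qpow_er -erD; congr er; field; exact: p_neq0.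
Qed.

End RootOrder.

(** * Evaluation on the tree *)

Section Tree.
Variable G : plumbing.
Local Notation n := (nv G).
Local Notation adj := (@adj G).

Lemma adj_sym : symmetric adj. Proof. by case: G. Qed.
Lemma adj_irr : irreflexive adj. Proof. by case: G. Qed.
Lemma adj_connect v w : connect adj v w. Proof. by case: G v w. Qed.
Lemma adj_acyclic p : ucycle adj p -> (size p <= 2)%N. Proof. by case: G p. Qed.

Definition avoiding (v : 'I_n) : rel 'I_n := fun x y => [&& adj x y, x != v & y != v].

Lemma avoiding_sym v : connect_sym (avoiding v).
Proof. by apply: sym_connect_sym => x y; rewrite /avoiding adj_sym [(x != v) && _]andbC. Qed.

(** A path joining two neighbours of [v] and missing [v] would close up through [v] to a cycle of
    length at least 3. *)
Lemma neighbours_separated v w w' : adj v w -> adj v w' -> w != w' ->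
  ~~ connect (avoiding v) w w'.
Proof.
move=> vw vw' ww'; apply/negP => /connectP[p0 pth lst].
have := pth; case/shortenP: pth lst => p pth up _ lst _.
have wv : w != v by apply: contraTneq vw => ->; rewrite adj_irr.
have av : path adj w p by apply: sub_path pth => x y /and3P[].
have nv : v \notin p.
  elim: p w {up lst vw ww' wv av} pth => // a p IH w /= /andP[/and3P[_ _ av] /IH].
  by rewrite inE negb_or eq_sym av.
have : ucycle adj [:: v, w & p].
  rewrite /ucycle /= vw rcons_path av -lst adj_sym vw' /=.
  by move: up => /= ->; rewrite inE negb_or eq_sym wv nv.
move=> /adj_acyclic /=; case: p lst {pth up av nv} => [/= e|//].
by rewrite e eqxx in ww'.
Qed.

Variable root : 'I_n.

Definition reach (k : nat) (v : 'I_n) :=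
  [exists p : k.-tuple 'I_n, path adj root p && (last root p == v)].

Lemma reachP k v : reflect (exists p, [/\ path adj root p,
  last root p = v & size p = k]) (reach k v).
Proof.
apply: (iffP existsP) => [[p /andP[pp /eqP lp]]|[p [pp lp /eqP sp]]].
  by exists p; rewrite size_tuple.
by exists (Tuple sp); rewrite /= pp lp eqxx.
Qed.

Lemma reach_ex v : exists k, reach k v.
Proof.
by have /connectP[p pp ->] := adj_connect root v; exists (size p); apply/reachP; exists p.
Qed.

Definition dist v := ex_minn (reach_ex v).

Lemma dist_le k v : reach k v -> (dist v <= k)%N.
Proof. by rewrite /dist; case: ex_minnP => m _; apply. Qed.

Lemma dist_reach v : reach (dist v) v.
Proof. by rewrite /dist; case: ex_minnP. Qed.

Lemma dist_lt v : (dist v < n)%N.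
Proof.
have /connectP[p0 pth lst] := adj_connect root v; case/shortenP: pth lst => p pp up _ lst.
apply: (@leq_ltn_trans (size p)); first by apply: dist_le; apply/reachP; exists p.
by have := card_uniqP up; rewrite /= => <-; rewrite -[X in (_ <= X)%N]card_ord; apply: max_card.
Qed.

Lemma dist0 v : (dist v == 0%N) = (v == root).
Proof.
apply/eqP/eqP => [d|->].
  have /reachP[p [_ lp sp]] := dist_reach v; rewrite d in sp.
  by case: p sp lp.
by apply/eqP; rewrite -leqn0; apply: dist_le; apply/reachP; exists [::].
Qed.

Lemma dist_adj v w : adj v w -> (dist w <= (dist v).+1)%N.
Proof.
move=> vw; have /reachP[p [pp lp sp]] := dist_reach v; apply: dist_le; apply/reachP.
by exists (rcons p w); rewrite rcons_path pp lp vw last_rcons size_rcons sp.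
Qed.

Lemma dist_pred v : v != root -> exists2 u, adj u v & dist v = (dist u).+1.
Proof.
rewrite -dist0 => dv; have /reachP[p [pp lp sp]] := dist_reach v.
case/lastP: p pp lp sp => [|p w]; first by move=> _ _ e; rewrite -e in dv.
rewrite rcons_path last_rcons size_rcons => /andP[pp aw] ew sp.
exists (last root p); first by rewrite -ew.
apply/eqP; rewrite eqn_leq -{2}sp ltnS dist_adj -?ew //=.
by apply: dist_le; apply/reachP; exists p.
Qed.

(** Descending to the root strictly lowers the distance, so the path cannot meet [v]. *)
Lemma connect_root v x : x != v -> (dist x <= dist v)%N -> connect (avoiding v) x root.
Proof.
have [k] := ubnP (dist x); elim: k x => // k IH x; rewrite ltnS => xk xv xd.
have [->|xr] := eqVneq x root; first exact: connect0.
have [u ux dx] := dist_pred xr.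
have uv : u != v by apply: contraTneq xd => <-; rewrite dx ltnn.
apply: (@connect_trans _ _ u); first by apply: connect1; rewrite /avoiding adj_sym ux xv.
by apply: IH => //; rewrite -ltnS -dx // ltnW.
Qed.

Definition child v w := adj v w && (dist w == (dist v).+1).

(** Two such neighbours would be joined through the root without meeting [v], against
    [neighbours_separated]. So every vertex has at most one parent. *)
Lemma close_unique v w w' : adj v w -> adj v w' -> (dist w <= dist v)%N -> (dist w' <= dist v)%N ->
  w = w'.
Proof.
move=> vw vw' dw dw'; apply/eqP; apply: contraT => ne; have := neighbours_separated vw vw' ne.
have nv x : adj v x -> x != v by move=> vx; apply: contraTneq vx => ->; rewrite adj_irr.
by rewrite (connect_trans (connect_root (nv _ vw) dw)) // avoiding_sym connect_root // nv.
Qed.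

Lemma adj_child v w : adj v w = child v w || child w v.
Proof.
rewrite /child [adj w v]adj_sym; case vw: (adj v w) => //=; symmetry.
have wv : adj w v by rewrite adj_sym.
have := dist_adj vw; have := dist_adj wv.
case: (ltngtP (dist v) (dist w)) => [lt _ le|lt le _|e _ _].
- by rewrite eqn_leq le lt.
- by rewrite [dist v == _]eqn_leq le lt orbT.
(* Equal distances: [w] and the predecessor of [v] would both be neighbours of [v] no farther from
   the root than [v], hence equal, but they lie at different distances. *)
have vr : v != root.
  by apply: contraTneq vw => vr; move: e;
    rewrite vr (eqP (etrans (dist0 root) (eqxx _))) => /esym/eqP; rewrite dist0 => /eqP ->;
      rewrite adj_irr.
have [u uv du] := dist_pred vr.
have : w = u by apply: (close_unique vw); rewrite ?e ?[adj v u]adj_sym // -e du.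
by move=> wu; move: du; rewrite -wu e => /eqP; rewrite eqn_leq ltnn andbF.
Qed.

Lemma child_asym v w : child v w -> child w v = false.
Proof. by move=> /andP[_ /eqP e]; rewrite /child e (ltn_eqF (leqW (leqnn _))) andbF. Qed.

Lemma child_unique v v' w : child v w -> child v' w -> v = v'.
Proof.
move=> /andP[vw /eqP d] /andP[vw' /eqP d']; apply: (@close_unique w).
- by rewrite adj_sym.
- by rewrite adj_sym.
- by rewrite d.
- by rewrite d'.
Qed.

Definition parent w := odflt root [pick v | child v w].

Lemma parentE v w : child v w -> parent w = v.
Proof.
by move=> vw; rewrite /parent; case: pickP => [u /child_unique/(_ vw)|/(_ v)] //; rewrite vw.
Qed.

Lemma parentP w : w != root -> child (parent w) w.
Proof.
by case/dist_pred => u uw du; rewrite (@parentE u) // /child uw du eqxx.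
Qed.

Definition up v := if v == root then None else Some (parent v).

Lemma up_child v w : adj v w && (Some w != up v) = child v w.
Proof.
rewrite /up; have [->|vr] := eqVneq v root.
  rewrite andbT adj_child [child w root]andbC; move/eqP: (etrans (dist0 root) (eqxx _)) => ->.
  by rewrite orbF.
rewrite adj_child; case vw: (child v w) => /=.
  apply/eqP => -[e]; have := parentP vr; rewrite -e.
  by rewrite (child_asym vw).
case wv: (child w v) => //=; by rewrite (parentE wv) eqxx.
Qed.

Lemma child_parent v w : dist w = (dist v).+1 -> child v w = (parent w == v).
Proof.
move=> d; have wr : w != root by rewrite -dist0 d.
apply/idP/eqP => [/parentE //|<-]; exact: parentP.
Qed.

Lemma card_children v : (\sum_w child v w + (v != root))%N = deg v.
Proof.
rewrite /deg cardsE -sum1_card [RHS]big_mkcond /=.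
transitivity (\sum_w (child v w + child w v))%N.
  rewrite big_split /=; congr (_ + _)%N.
  have [->|vr] := eqVneq v root.
    by rewrite big1 // => w _; rewrite /child andbC; move/eqP: (etrans (dist0 root) (eqxx _)) => ->.
  rewrite (bigD1 (parent v)) //= parentP // big1 // => w wp.
  by case c: (child w v) => //; rewrite (parentE c) eqxx in wp.
apply: eq_bigr => w _; rewrite (_ : (w \in adj v) = adj v w) // adj_child.
by case c: (child v w) => //=; rewrite (child_asym c).
Qed.

Section Levels.
Variable F : fieldType.
Variables (a0 : 'I_n -> F) (b : 'I_n -> 'I_n -> F) (t : nat -> option 'I_n -> 'I_n -> F).
Hypothesis tS : forall m u v, t m.+1 u v =
  a0 v * \prod_(w | adj v w && (Some w != u)) (b v w * t m (Some v) w).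

Let a v := a0 v * \prod_(w | child v w) b v w.

Let level k := \prod_(v | dist v == k) t (n - k) (up v) v.

(* The branches cut at distance [k] from the root unfold into their root factors
   and the branches cut at distance [k + 1]. *)
Lemma level_step k : (k < n)%N -> level k = \prod_(v | dist v == k) a v * level k.+1.
Proof.
move=> kn; rewrite /level.
have -> : \prod_(v | dist v == k.+1) t (n - k.+1) (up v) v =
    \prod_(v | dist v == k) \prod_(w | child v w) t (n - k.+1) (Some v) w.
  rewrite (partition_big parent (fun v => dist v == k)) /=; last first.
    move=> w /eqP dw; have wr : w != root by rewrite -dist0 dw.
    by have /andP[_] := parentP wr; rewrite dw eqSS eq_sym.
  apply: eq_bigr => v /eqP dv; apply: eq_big => [w|w /andP[/eqP dw /eqP <-]].
    case: eqP => [dw|dw] /=; first by rewrite child_parent // dv.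
    by rewrite /child dv; case: eqP dw => //; rewrite andbF.
  by rewrite /up -dist0 dw.
rewrite -big_split /=; apply: eq_bigr => v /eqP dv.
have -> : (n - k = (n - k.+1).+1)%N by rewrite subnSK.
rewrite tS /a -mulrA -big_split /=; congr (_ * _).
by apply: eq_bigl => w; rewrite up_child.
Qed.

(** All distances are below [n], so level [n] is empty and the fuel [n] reaches every vertex. *)
Lemma tree_product : t n None root = \prod_v (a0 v * \prod_(w | child v w) b v w).
Proof.
rewrite -/(a _).
have -> : t n None root = level 0.
  rewrite /level (big_pred1 root) => [|v]; last exact: dist0.
  by rewrite subn0 /up eqxx.
have all k : (k <= n)%N -> level 0 = (\prod_(v | (dist v < k)%N) a v) * level k.
  elim: k => [|k IH] kn; first by rewrite big1 ?mul1r // => v; rewrite ltn0.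
  rewrite IH ?(ltnW kn) // level_step // mulrA; congr (_ * _).
  rewrite [RHS](bigID (fun v => (dist v < k)%N)) /=; congr (_ * _); apply: eq_bigl => v.
    by case: (ltnP (dist v) k) => // h; rewrite ?andbF // ?andbT ltnW // ltnS ltnW.
  by rewrite -leqNgt ltnS -eqn_leq.
rewrite (all n) // [level n]big1 ?mulr1 => [|v /eqP d]; last by have := dist_lt v; rewrite d ltnn.
by apply: eq_bigl => v; rewrite dist_lt.
Qed.
End Levels.
End Tree.

(** * The invariant of a coloured plumbing link *)

Section Invariant.
Variables (R : realType) (r : nat).
Local Notation C := R[i].
Hypothesis r3 : (3 <= r)%N.
Hypothesis r_odd : odd r \/ exists2 p, odd p & r = (2 * p)%N.
Variable G : plumbing.
Local Notation n := (nv G).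
Variables (root : 'I_n) (lam : 'I_n -> C).
Hypothesis X0 : forall v, Xd r (lam v) != 0.

Let Texp (x : C) : C := (x ^+ 2 - ((r0 r)%:R - 1) ^+ 2) / 2.
Let col v := verma r (lam v) false.

Lemma twist_powE (x : C) p (f : int) :
  twist_pow r (verma r x p) f = (qpow r (f%:~R * Texp x))%:M.
Proof.
have e m : twist r (verma r x p) ^+ m = (qpow r (m%:R * Texp x))%:M.
  by rewrite (twist_verma r3 r_odd) mxpowE mxpow_scalar /Tpow -qpowMn mulr_natl.
case: f => m; rewrite /twist_pow e //.
by rewrite NegzE mulrNz mulNr qpowN invmx_scalar.
Qed.

Fixpoint stangle (fuel : nat) (u : option 'I_n) (v : 'I_n) : C :=
  if fuel is m.+1 then
    qpow r ((framing v)%:~R * Texp (lam v)) *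
    \prod_(w | adj v w && (Some w != u))
      (qpow r (lam v * lam w) / mdim r (lam v) * stangle m (Some v) w)
  else 1.

Lemma prod_scalar_mx m (I : finType) (P : pred I) (F : I -> C) :
  \big[*%R/1]_(i | P i) ((F i)%:M : 'M[C]_m) = (\prod_(i | P i) F i)%:M.
Proof.
by rewrite (big_morph (fun a : C => a%:M : 'M[C]_m) (id1 := 1) (op1 := *%R)) // => x y;
  rewrite scalar_mxM.
Qed.

Lemma tangleE m u v : tangle r col m u v = (stangle m u v)%:M.
Proof.
elim: m u v => [|m IH] u v //=.
rewrite (eq_bigr (fun w => (qpow r (lam v * lam w) / mdim r (lam v)
  * stangle m (Some v) w)%:M)) => [|w _].
  by rewrite prod_scalar_mx twist_powE -scalar_mxM mulrC.
have -> : qpow r (lam v * lam w) / mdim r (lam v) * stangle m (Some v) w =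
    stangle m (Some v) w * qpow r (lam w * lam v) / mdim r (lam v).
  by rewrite [lam w * _]mulrC [LHS]mulrC mulrA.
by rewrite IH; exact: encircle_verma.
Qed.

Lemma child_pairs (f : 'I_n -> 'I_n -> C) : (forall v w, f v w = f w v) ->
  \sum_v \sum_(w | child root v w) f v w = (\sum_v \sum_(w | adj v w) f v w) / 2.
Proof.
move=> fs; set s := \sum_v _; suff -> : \sum_v \sum_(w | adj v w) f v w = s + s by field.
transitivity (\sum_v (\sum_(w | child root v w) f v w + \sum_(w | child root w v) f v w)).
  apply: eq_bigr => v _; rewrite [LHS]big_mkcond [in RHS]big_mkcond /= [X
    in _ + X]big_mkcond /= -big_split /=.
  apply: eq_bigr => w _; rewrite (adj_child root).
  by case c: (child root v w); rewrite ?(child_asym c) /= ?addr0 ?add0r.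
rewrite big_split /=; congr (_ + _).
rewrite (exchange_big_dep xpredT) //=; apply: eq_bigr => v _; apply: eq_bigr => w _; exact: fs.
Qed.

Lemma linking_form (x : 'I_n -> C) :
  \sum_v \sum_w (linking G v w)%:~R * x v * x w =
  \sum_v (framing v)%:~R * x v ^+ 2 + \sum_v \sum_(w | adj v w) x v * x w.
Proof.
rewrite -big_split /=; apply: eq_bigr => v _.
rewrite (bigD1 v) //= [X in _ = _ + X]big_mkcond (bigD1 v (F := fun w =>
  if adj v w then _ else _)) //=.
rewrite adj_irr add0r mxE eqxx expr2 mulrA; congr (_ + _).
apply: eq_bigr => w wv; rewrite mxE eq_sym (negPf wv).
by case: (adj v w); rewrite ?mul1r ?mul0r.
Qed.

(** Each vertex has one factor [mdim] from its Kirby colour, the root a second one from the modified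
    trace, and every child removes one. By [card_children] the exponent is [2 - deg v] in all cases,
    independently of the root. *)
Lemma Fprime_tree : (\prod_v mdim r (lam v)) * Fprime r root lam =
  (\prod_v (mdim r (lam v)) ^ (2 - (deg v)%:Z)) *
  qpow r ((\sum_v \sum_w (linking G v w)%:~R * lam v * lam w) / 2
          - (\tr (linking G))%:~R * ((r0 r)%:R - 1) ^+ 2 / 2).
Proof.
have d0 v : mdim r (lam v) != 0 by exact: mdim_neq0.
rewrite /Fprime -/col tangleE /scalar_of mxtrace_scalar -[_ *+ wdim _]mulr_natr mulfK; last first.
  by rewrite pnatr_eq0 -lt0n; exact: r0_gt0.
rewrite (@tree_product G root _ (fun v => qpow r ((framing v)%:~R * Texp (lam v)))
   (fun v w => qpow r (lam v * lam w) / mdim r (lam v)) stangle) //.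
have -> : \prod_v (qpow r ((framing v)%:~R * Texp (lam v)) *
      \prod_(w | child root v w) (qpow r (lam v * lam w) / mdim r (lam v))) =
   qpow r ((\sum_v \sum_w (linking G v w)%:~R * lam v * lam w) / 2
          - (\tr (linking G))%:~R * ((r0 r)%:R - 1) ^+ 2 / 2) *
   \prod_v \prod_(w | child root v w) (mdim r (lam v))^-1.
  rewrite linking_form mulrDl -child_pairs; last by move=> v w; rewrite mulrC.
  rewrite big_split /= -qpow_sum; under [X in _ * X]eq_bigr do rewrite big_split /= -qpow_sum.
  rewrite big_split /= -qpow_sum mulrA -qpowD; congr (qpow r _ * _).
  rewrite addrAC; congr (_ + _).
  have -> : (\tr (linking G))%:~R = \sum_(v : 'I_n) (framing v)%:~R :> C.
    by rewrite /mxtrace rmorph_sum; apply: eq_bigr => v _; rewrite mxE eqxx.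
  rewrite !mulr_suml -sumrB; apply: eq_bigr => v _; by rewrite /Texp; field.
rewrite [mdim r (lam root) * _]mulrCA [LHS]mulrCA [RHS]mulrC; congr (_ * _).
have -> : mdim r (lam root) = \prod_v (if v == root then mdim r (lam v) else 1).
  by rewrite -big_mkcond big_pred1_eq.
rewrite -!big_split /=; apply: eq_bigr => v _.
rewrite prodr_const -(card_children root v).
have -> : #|[pred w | child root v w]| = (\sum_w child root v w)%N.
  by rewrite -sum1_card big_mkcond; apply: eq_bigr => w _; rewrite inE; case: (child _ _ _).
set c := (\sum_w _)%N; have x0 := d0 v; move: (mdim r (lam v)) x0 => x x0.
have -> : 2 - (c + (v != root))%:Z = (v == root)%:Z + 1 - c%:Z by case: (v == root) => /=; lia.
rewrite !expfzDr // expr1z -exprnN exprVn.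
by case: (v == root); rewrite ?expr1z ?expr0z ?mul1r // mulrA.
Qed.

End Invariant.

(** * Summation over lattice points *)

Section Summation.
#[local] Existing Instance totally_filter.
Local Open Scope quotient_scope.
Variables (R : realType) (I : choiceType).
Local Notation C := R[i].

Lemma cvg_real_complex (T : Type) (F : set_system T) {FF : Filter F} (f : T -> R) (l : R) :
  f @ F --> l -> ((f t)%:C%C : C^o) @[t --> F] --> (l%:C%C : C^o).
Proof.
move=> fl; apply/cvgrPdist_lt => e e0.
have [e1 [e2 eE]] : exists e1, 0 < e1 /\ e = e1%:C%C.
  by case: e e0 => a b; rewrite ltcE /= => /andP[/eqP -> a0]; exists a.
rewrite eE; move/cvgrPdist_lt: fl => /(_ e1 e2); apply: filterS => t.
by rewrite -rmorphB /= normc_def /= expr0n /= addr0 sqrtr_sqr ltcR.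
Qed.

Lemma cvg_nonneg (y : I -> R) (M : R) : (forall i, 0 <= y i) ->
  (forall J : {fset I}, partial_sum y J <= M) ->
  exists l : R, partial_sum y J @[J --> totally] --> l.
Proof.
move=> y0 yM; pose S := [set partial_sum y J | J in [set: {fset I}]].
have hS : has_sup S.
  by split; [exists (partial_sum y fset0), fset0 | exists M => _ [J _ <-]].
have mono (A B : {fset I}) : (A `<=` B)%fset -> partial_sum y A <= partial_sum y B.
  move=> AB; rewrite /partial_sum -!(big_seq_fsetE _ _ xpredT) /=.
  have -> : \sum_(i <- A) y i = \sum_(i <- B) (if i \in A then y i else 0).
    rewrite -(big_fset_incl _ AB) => [|i _ /negPf -> //].
    by apply: eq_big_seq => i iA; rewrite iA.
  by apply: ler_sum => i _; case: ifP.
exists (sup S); apply/cvgrPdist_lt => e e0.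
have [_ [A _ <-] lt] := sup_adherent e0 hS.
exists A => // B AB /=; rewrite ger0_norm ?subr_ge0; last by apply: sup_ubound hS.2 _ _; exists B.
by rewrite ltrBlDr -ltrBlDl; apply: lt_le_trans (mono _ _ AB).
Qed.

(** [csum] is a limit with a default value; existence of the limit is what makes it linear. *)
Definition csummable (x : I -> C) :=
  exists l : C, (partial_sum x J : C^o) @[J --> totally] --> (l : C^o).

Lemma csumE (x : I -> C) (l : C) :
  (partial_sum x J : C^o) @[J --> totally] --> (l : C^o) -> csum x = l.
Proof. by move=> h; rewrite /csum /summability.sum; exact: (@cvg_lim C^o). Qed.

Lemma csummableZ (a : C) (x : I -> C) : csummable x ->
  csummable (fun i => a * x i) /\ csum (fun i => a * x i) = a * csum x.
Proof.
case=> l xl; have e : (partial_sum (fun i => a * x i) J : C^o) @[J --> totally] --> (a * l : C^o).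
  have -> : (fun J => partial_sum (fun i => a * x i) J : C^o) = (fun J =>
    a *: (partial_sum x J : C^o)).
    by apply/funext => J; rewrite /partial_sum -mulr_sumr.
  exact: (@cvgZ C C^o _ totally _ (fun=> a) _ a (l : C^o) (cvg_cst _) xl).
by split; [exists (a * l) | rewrite (csumE e) (csumE xl)].
Qed.

Lemma csummableD (x y : I -> C) : csummable x -> csummable y ->
  csummable (fun i => x i + y i) /\ csum (fun i => x i + y i) = csum x + csum y.
Proof.
move=> [l xl] [m ym]; have e : (partial_sum (fun i =>
  x i + y i) J : C^o) @[J --> totally] --> (l + m : C^o).
  have -> : (fun J => partial_sum (fun i => x i + y i) J : C^o) = (fun J =>
    (partial_sum x J : C^o) + partial_sum y J).
    by apply/funext => J; rewrite /partial_sum big_split.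
  exact: (@cvgD C C^o _ totally _ _ _ _ _ xl ym).
by split; [exists (l + m) | rewrite (csumE e) (csumE xl) (csumE ym)].
Qed.

Lemma csummable0 : csummable (fun=> 0) /\ csum (fun _ : I => 0 : C) = 0.
Proof.
have e : (partial_sum (fun _ : I => 0 : C) J : C^o) @[J --> totally] --> (0 : C^o).
  have -> : (fun J => partial_sum (fun _ : I => 0 : C) J : C^o) = (fun=> 0).
    by apply/funext => J; rewrite /partial_sum big1.
  exact: cvg_cst.
by split; [exists 0 | rewrite (csumE e)].
Qed.

Lemma csum_lin (s : Type) (r : seq s) (a : s -> C) (x : s -> I -> C) :
  (forall k, csummable (x k)) ->
  csum (fun l => \sum_(k <- r) a k * x k l) = \sum_(k <- r) a k * csum (x k).
Proof.
move=> h; suff [] : csummable (fun l => \sum_(k <- r) a k * x k l) /\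
   csum (fun l => \sum_(k <- r) a k * x k l) = \sum_(k <- r) a k * csum (x k) by [].
elim: r => [|k r [IH1 IH2]].
  by have [h1 h2] := csummable0; split; rewrite ?big_nil; under eq_fun do rewrite big_nil.
have [h1 h2] := csummableZ (a k) (h k); have [h3 h4] := csummableD h1 IH1.
by split; rewrite ?big_cons; under eq_fun do rewrite big_cons; rewrite // h4 h2 IH2.
Qed.

(** The real and imaginary parts are split into positive and negative parts; each is dominated by
    the absolute value and converges by monotonicity. *)
Lemma abs_csummable (x : I -> C) : abs_summable x -> csummable x.
Proof.
case=> M xM.
have re_bound (z : I -> R) : (forall i, 0 <= z i) -> (forall i, (z i)%:C%C <= `|x i|) ->
    csummable (fun i => (z i)%:C%C).
  move=> z0 zx; have [|l zl] := @cvg_nonneg z (complex.Re M) z0.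
    move=> J; rewrite -lecR; apply: le_trans (_ : M <= _); last first.
      have : 0 <= M by apply: le_trans (xM fset0); apply: sumr_ge0 => i _; exact: normr_ge0.
      by case: M {xM} => u v; rewrite !lecE /= => /andP[/eqP -> _]; rewrite eqxx lexx.
    apply: le_trans (xM J); rewrite /partial_sum rmorph_sum; apply: ler_sum => i _; exact: zx.
  exists l%:C%C.
  have -> : (fun J => partial_sum (fun i => (z i)%:C%C) J : C^o) = (fun J =>
    (partial_sum z J)%:C%C).
    by apply/funext => J; rewrite /partial_sum rmorph_sum.
  exact: cvg_real_complex.
pose pos (f : I -> R) i := (`|f i| + f i) / 2; pose neg (f : I -> R) i := (`|f i| - f i) / 2.
have bnd (f : I -> R) : (forall i, `|f i|%:C%C <= `|x i|) -> csummable (fun i => (f i)%:C%C).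
  move=> fx.
  have [a b] : csummable (fun i => (pos f i)%:C%C) /\ csummable (fun i => (neg f i)%:C%C).
    split; apply: re_bound => i; rewrite /pos /neg;
      have h1 := ler_norm (f i); have h2 := ler_norm (- f i); rewrite normrN in h2.
    - by lra.
    - by apply: le_trans (fx i); rewrite lecR; lra.
    - by lra.
    - by apply: le_trans (fx i); rewrite lecR; lra.
  have [c _] := csummableZ (-1) b; have [d _] := csummableD a c.
  have -> // : (fun i => (f i)%:C%C) = (fun i => (pos f i)%:C%C + -1 * (neg f i)%:C%C).
  by apply/funext => i; rewrite mulN1r -rmorphB /=; congr (_%:C)%C; rewrite /pos /neg; lra.
have [a b] : csummable (fun i => (complex.Re (x i))%:C%C) /\ csummable (fun i =>
  (complex.Im (x i))%:C%C).
  by split; apply: bnd => i; case: (x i) => u v;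
    rewrite normc_def lecR /= -sqrtr_sqr ler_sqrt ?lerDl ?lerDr ?addr_ge0 ?sqr_ge0.
have [c _] := csummableZ 'i%C b; have [d _] := csummableD a c.
have -> // : x = (fun i => (complex.Re (x i))%:C%C + 'i%C * (complex.Im (x i))%:C%C).
by apply/funext => i; rewrite -complexE.
Qed.
End Summation.

(** * Spin and Spin^c structures *)

Section Mod2.
Local Open Scope quotient_scope.
Variable G : plumbing.
Local Notation n := (nv G).
Local Notation B := (linking G).

Lemma linking_sym : B^T = B.
Proof.
apply/matrixP => i j; rewrite !mxE eq_sym; case: eqP => [->//|_].
by rewrite adj_sym.
Qed.

Lemma F2E (x : 'F_2) : x * x = x /\ x + x = 0.
Proof. by split; case: x => -[|[|]] // i; apply: val_inj. Qed.

Lemma F2_intr (z : int) : (z%:~R == 0 :> 'F_2) = (2 %| z)%Z.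
Proof. by rewrite -(@dvdz_pcharf 'F_2 2) // pchar_Fp. Qed.

(** Modulo 2 the symmetric off-diagonal terms cancel in pairs and squares are linear. *)
Lemma quad_F2 m (A : 'M['F_2]_m) (v : 'cV['F_2]_m) : A^T = A ->
  (v^T *m A *m v) 0 0 = \sum_i A i i * v i 0.
Proof.
move=> As; have sA i j : A i j = A j i by rewrite -{1}As mxE.
rewrite -mulmxA mxE; pose f i j := v i 0 * (A i j * v j 0).
transitivity (\sum_i \sum_j f i j).
  by apply: eq_bigr => i _; rewrite !mxE mulr_sumr.
have -> : \sum_i \sum_j f i j =
  \sum_i (f i i + (\sum_(j : 'I_m | (i < j)%N) f i j + \sum_(j : 'I_m | (j < i)%N) f i j)).
  apply: eq_bigr => i _; rewrite (bigD1 i) //=; congr (_ + _).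
  rewrite (bigID (fun j : 'I_m => (i < j)%N)) /=; congr (_ + _); apply: eq_bigl => j.
    by rewrite andb_idl // => ij; rewrite -val_eqE gtn_eqF.
  by rewrite -leqNgt ltn_neqAle.
rewrite !big_split /= [X in _ + (_ + X)](exchange_big_dep xpredT) //=.
have -> : \sum_(j : 'I_m) \sum_(i : 'I_m | (j < i)%N) f i j =
  \sum_(i : 'I_m) \sum_(j : 'I_m | (i < j)%N) f i j.
  by apply: eq_bigr => i _; apply: eq_bigr => j _; rewrite /f sA; ring.
rewrite (F2E _).2 addr0; apply: eq_bigr => i _.
by rewrite /f mulrCA (F2E _).1.
Qed.

(** The diagonal of a symmetric matrix over ['F_2] lies in its image: by [quad_F2] it pairs with a
    kernel vector [v] to [v^T A v = 0]. *)
Lemma spin_nonempty : exists s, s \in spin G.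
Proof.
pose A : 'M['F_2]_n := map_mx intr B; pose d : 'cV['F_2]_n := \col_i (B i i)%:~R.
have As : A^T = A by rewrite /A map_trmx linking_sym.
have : (d^T <= A)%MS.
  rewrite submxE; apply/eqP/matrixP => i j; rewrite ord1 [RHS]mxE.
  pose v := col j (cokermx A).
  have Av0 : A *m v = 0 by rewrite /v colE mulmxA mulmx_coker mul0mx.
  have := quad_F2 v As; rewrite -mulmxA Av0 mulmx0 mxE => ->.
  by rewrite mxE; apply: eq_bigr => k _; rewrite !mxE.
case/submxP => D e; exists D^T; rewrite inE; apply/eqP.
by rewrite -/A -As -trmx_mul -e trmxK.
Qed.

Lemma spin_liftK (s : 'cV['F_2]_n) : map_mx intr (spin_lift s) = s.
Proof. by apply/matrixP => i j; rewrite !mxE ord1 -pmulrn natr_Zp. Qed.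

Lemma spinc_presentation (K : latq (B *+ 2)) : @spinc G K ->
  exists b s, s \in spin G /\ sigma b s = K.
Proof.
move=> KP; have [s sP] := spin_nonempty.
have dv i : (2 %| (rep K - B *m spin_lift s) i 0%R)%Z.
  rewrite -F2_intr mxE intrD mxE rmorphN /=.
  have -> : (((B *m spin_lift s) i 0)%:~R : 'F_2) = (B i i)%:~R.
    move: sP; rewrite inE => /eqP/matrixP/(_ i 0); rewrite [RHS]mxE => <-.
    by rewrite -[in RHS](spin_liftK s) -map_mxM [RHS]mxE.
  by rewrite subr_eq0 -subr_eq0 -intrB F2_intr -eqz_mod_dvd; apply: KP.
pose b0 : 'cV[int]_n := \col_i divz ((rep K - B *m spin_lift s) i 0%R) 2.
have b0E : b0 *+ 2 = rep K - B *m spin_lift s.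
  apply/matrixP => i j; rewrite mulmxnE ord1 -mulr_natr natz.
  have -> : b0 i 0 = divz ((rep K - B *m spin_lift s) i 0%R) 2 by rewrite mxE.
  exact: divzK (dv i).
exists (\pi_(H1 G) b0), s; split=> //.
rewrite /sigma -[RHS]reprK; apply/eqP/latqP.
have : \pi_(latq B) (rep (\pi_(H1 G) b0)) == \pi_(latq B) b0 by rewrite /rep reprK.
case/latqP => z e; exists z; rewrite -/(rep K).
have -> : rep K = b0 *+ 2 + B *m spin_lift s by rewrite b0E subrK.
by rewrite opprD addrACA subrr addr0 -mulrnBl e !mulr2n mulmxDl.
Qed.

Lemma rokhlin_cong (s : 'cV['F_2]_n) (R : realType) : exists k : int,
  ((rokhlin R s : nat)%:Z = signature R G - ((spin_lift s)^T *m B *m spin_lift s) 0 0 + 16 * k)%R.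
Proof.
set z := signature R G - _.
have h (x : int) : x%:~R = 0 :> 'Z_16 -> (16 %| x)%Z.
  have hn (m : nat) : m%:R = 0 :> 'Z_16 -> (16 %| m)%N.
    by move=> e; have := val_Zp_nat (isT : (1 < 16)%N) m; rewrite e /dvdn => <-.
  case: x => m; first by move=> /hn.
  by rewrite NegzE rmorphN /= => /eqP; rewrite oppr_eq0 => /eqP /hn; rewrite dvdzE.
have : ((rokhlin R s : nat)%:Z - z)%:~R = 0 :> 'Z_16.
  by rewrite rmorphB /= -pmulrn natr_Zp subrr.
move=> /h /dvdzP[k e]; exists k; rewrite [16 * k]mulrC -e addrC subrK //.
Qed.
End Mod2.

(** * The theorem *)

Section RationalForm.
Variable n : nat.
Implicit Types (S : 'M[rat]_n) (x y : 'cV[rat]_n).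

Definition qf S x y : rat := (x^T *m S *m y) 0 0.

Lemma qfDl S x x' y : qf S (x + x') y = qf S x y + qf S x' y.
Proof. by rewrite /qf linearD /= !mulmxDl mxE. Qed.
Lemma qfDr S x y y' : qf S x (y + y') = qf S x y + qf S x y'.
Proof. by rewrite /qf mulmxDr mxE. Qed.
Lemma qfZl S a x y : qf S (a *: x) y = a * qf S x y.
Proof. by rewrite /qf linearZ /= -!scalemxAl mxE. Qed.
Lemma qfZr S a x y : qf S x (a *: y) = a * qf S x y.
Proof. by rewrite /qf -scalemxAr mxE. Qed.
Lemma qfC S x y : S^T = S -> qf S x y = qf S y x.
Proof. by move=> e; rewrite /qf -[in LHS](trmxK (_ *m _)) [LHS]mxE !trmx_mul trmxK e mulmxA. Qed.
Lemma bf_qf S (x y : 'cV[int]_n) : bf S x y = qf S (map_mx intr x) (map_mx intr y).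
Proof. by []. Qed.
End RationalForm.

Section CompleteSquare.
Variables (n : nat) (B Bi : 'M[rat]_n).
Hypotheses (BBi : B *m Bi = 1%:M) (BiB : Bi *m B = 1%:M) (Bs : B^T = B) (Bis : Bi^T = Bi).

Lemma qf_inv_l (x y : 'cV[rat]_n) : qf B (Bi *m x) y = qf 1%:M x y.
Proof. by rewrite /qf trmx_mul Bis -(mulmxA _ Bi) BiB. Qed.

(** The factor 2 is the step of the colours, so that [w] runs through a translate of the integral
    lattice. *)
Lemma complete_square (w l lam : 'cV[rat]_n) : lam + Bi *m l = 2 *: w ->
  qf B lam lam / 2 + qf 1%:M l lam = 2 * qf B w w - qf Bi l l / 2.
Proof.
move=> e; have {e}-> : w = 2^-1 *: (lam + Bi *m l) by rewrite e scalerA mulVf ?scale1r.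
have e1 : qf B lam (Bi *m l) = qf 1%:M l lam by rewrite qfC // qf_inv_l.
have e2 : qf 1%:M l (Bi *m l) = qf Bi l l by rewrite /qf mulmx1 mulmxA.
by rewrite qfZl qfZr !(qfDl, qfDr) !qf_inv_l e1 e2; field.
Qed.

Lemma square_expand (i c s : 'cV[rat]_n) (t : rat) :
  qf B (i + Bi *m c + t *: s) (i + Bi *m c + t *: s) =
  qf B i i + 2 * qf 1%:M i c + qf Bi c c + 2 * t * (qf B i s + qf 1%:M c s) + t ^+ 2 * qf B s s.
Proof.
have e1 : qf B i (Bi *m c) = qf 1%:M i c by rewrite qfC // qf_inv_l qfC // trmx1.
have e2 : qf 1%:M c (Bi *m c) = qf Bi c c by rewrite /qf mulmx1 mulmxA.
have e3 : qf 1%:M c i = qf 1%:M i c by rewrite qfC // trmx1.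
have e4 : qf B s (Bi *m c) = qf 1%:M c s by rewrite qfC // qf_inv_l.
rewrite !(qfDl, qfDr, qfZl, qfZr) !qf_inv_l e1 e2 e3 e4 (qfC s i Bs); ring.
Qed.
End CompleteSquare.

(** * Gauss sums over the colours *)

Section GaussSums.
Variables (R : realType) (p h : nat) (delta j : int).
Local Notation C := R[i].
Local Notation er := (er R).
Hypothesis po : odd p.
Hypothesis p0 : (0 < p)%N.
Hypothesis h0 : (0 < h)%N.
Hypothesis delta2 : delta * delta = 1.
Hypothesis pE : p%:Z = 4 * j * h%:Z + delta.
Variables (n : nat) (B : 'M[int]_n) (Bi : 'M[rat]_n).
Local Notation BQ := (map_mx intr B : 'M[rat]_n).
Hypothesis BBi : BQ *m Bi = 1%:M.
Hypothesis Bsym : B^T = B.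

Let BQs : BQ^T = BQ. Proof. by rewrite map_trmx Bsym. Qed.
Let Bis : Bi^T = Bi. Proof. exact: sym_inv BBi Bsym. Qed.
Let BiB : Bi *m BQ = 1%:M. Proof. exact: mulVmx_int BBi. Qed.
Let pr0 : p%:R != 0 :> rat. Proof. by rewrite pnatr_eq0 -lt0n. Qed.

Lemma gauss_period (c : 'cV[int]_n) : period p (fun i =>
  er (h%:R / p%:R * (bf BQ i i + 2 * bf (map_mx intr (1%:M : 'M[int]_n)) i c + bf Bi c c))).
Proof.
move=> x z; apply: er_congr; rewrite !(bfDl, bfDr) !bfMnl !bfMnr.
set one := map_mx intr 1%:M.
rewrite -!(mulr_natr (bf _ _ _) p) -(mulr_natr (bf _ _ _ * _) p).
have i1 : bf BQ x z \is a Num.int by exact: bf_int.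
have i2 : bf BQ z x \is a Num.int by exact: bf_int.
have i3 : bf BQ z z \is a Num.int by exact: bf_int.
have i4 : bf one z c \is a Num.int by exact: bf_int.
move: (bf BQ x x) (bf BQ x z) (bf BQ z x) (bf BQ z z) (bf one x c) (bf one z c) (bf Bi c c) i1
  i2 i3 i4 => a1 a2 a3 a4 a5 a6 a7 i1 i2 i3 i4.
rewrite (_ : _ - _ = h%:R * (a2 + a3 + a4 * p%:R + 2 * a6)); last by field.
by rewrite rpredM ?rpredD ?rpredM ?rpred_nat.
Qed.

Variables (m b s y : 'cV[int]_n).
Let l : 'cV[int]_n := b *+ 2 + B *m s - B *m const_mx 1 + (B *m y) *+ 2.
Let c : 'cV[int]_n := m + b.

(* The colours [alpha_v - r0 + 1 + 2 k_v], with [alpha = 2 B^-1 m] and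
   [r0 = 2 p]. *)
Definition colour_weights (k : 'cV[int]_n) : 'cV[rat]_n :=
  2 *: (Bi *m map_mx intr m) + const_mx (1 - 2 * p%:R) + 2 *: map_mx intr k.

Let phi (i : 'cV[int]_n) : C := er (h%:R / p%:R * (bf BQ i i
  + 2 * bf (map_mx intr (1%:M : 'M[int]_n)) i c + bf Bi c c)).

Lemma sum_box (f : 'cV[int]_n -> C) z : period p f ->
  \sum_(k : {ffun 'I_n -> 'I_p}) f (box k + z) = p%:R ^+ n * Av f.
Proof.
move=> pf; have pp : per f by exists p.
rewrite -(Av_transl z pp) (@AvE _ _ p) // ?/mean; last by move=> u v; rewrite addrAC pf.
by rewrite mulrA mulfV ?mul1r // expf_neq0 // pnatr_eq0 -lt0n.
Qed.

Let half := p./2.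
Let pE2 : p%:R = 2 * half%:R + 1 :> rat.
Proof. by rewrite -[in LHS](odd_double_half p) po natrD -mul2n natrM addrC. Qed.

(** [B s] in [l] contributes [s / 2] to the centre of the square. As [p] is odd this is [p s / 2]
    minus the integral vector [half s]; after division by [p] the cross terms with [p s / 2] are
    integers, so [s] survives only through its norm. *)
Let z : 'cV[int]_n := y - const_mx p%:Z - s *+ half.

Lemma lamv_square k : colour_weights k + Bi *m map_mx intr l =
  2 *: (map_mx intr (k + z) + Bi *m map_mx intr c + (p%:R / 2) *: map_mx intr s).
Proof.
have -> : Bi *m map_mx intr l =
  2 *: (Bi *m map_mx intr b) + map_mx intr s - const_mx 1 + 2 *: map_mx intr y.
  have intr2 (x : 'cV[int]_n) : map_mx intr (x *+ 2) = 2 *: map_mx intr x :> 'cV[rat]_n.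
    by rewrite raddfMn scaler_nat.
  rewrite /l map_mxD intr2 map_mxB map_mxD intr2 !map_mxM mulmxDr mulmxBr mulmxDr -!scalemxAr
    !mulmxA BiB !mul1mx.
  by congr (_ + _ - _ + _); apply/matrixP => i1 i2; rewrite !mxE.
have -> : Bi *m map_mx intr c =
  Bi *m map_mx intr m + Bi *m map_mx intr b by rewrite /c map_mxD mulmxDr.
apply/matrixP => u v; rewrite /colour_weights /z;
  move: (Bi *m map_mx intr m) (Bi *m map_mx intr b) => X Y.
rewrite !mxE !(intrD, rmorphN) /= mulmxnE -[s u v *+ half]mulr_natr intrM -!pmulrn natz pE2 -pmulrn.
by field.
Qed.

Lemma gauss_term k :
  er ((qf BQ (colour_weights k) (colour_weights k) / 2
    + qf 1%:M (map_mx intr l) (colour_weights k)) * h%:R / (2 * p%:R)) =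
  er (- (h%:R / (4 * p%:R) * bf Bi l l) + h%:R * p%:R / 4 * bf BQ s s) * phi (k + z).
Proof.
rewrite -erD; apply: er_congr; rewrite (complete_square BiB BQs Bis (lamv_square k)).
rewrite (square_expand BiB BQs Bis) -!bf_qf.
have -> : (1%:M : 'M[rat]_n) = map_mx intr (1%:M : 'M[int]_n) by rewrite map_mx1.
set one := map_mx intr 1%:M.
rewrite (_ : _ - _ = h%:R * (bf BQ (k + z) s + bf one c s)); last by field.
by rewrite rpredM ?rpredD ?rpred_nat ?bf_int.
Qed.

Variables (U : 'M[int]_n) (Ui : 'M[rat]_n) (d : 'rV[int]_n).
Hypothesis UUi : map_mx intr U *m Ui = 1%:M.
Hypothesis UBU : U^T *m B *m U = diag_mx d.

Lemma gauss_sum_total :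
  kap R B * \sum_(k : {ffun 'I_n -> 'I_p})
    er ((qf BQ (colour_weights (box k)) (colour_weights (box k)) / 2
      + qf 1%:M (map_mx intr l) (colour_weights (box k))) * h%:R / (2 * p%:R)) =
  er (- (h%:R / (4 * p%:R) * bf Bi l l) + h%:R * p%:R / 4 * bf BQ s s
      - (delta%:~R - 1) * (\sum_i sgz (d 0 i))%:~R / 8) *
  sqrtC p%:R ^+ n * gauss_rhs R Bi delta j h c.
Proof.
under eq_bigr do rewrite gauss_term; rewrite -mulr_sumr sum_box; last exact: gauss_period.
have := reciprocity R BBi Bsym UUi UBU delta2 h0 p0 pE c; rewrite /gauss_lhs -/phi => rec.
have -> : (delta%:~R - 1) * (\sum_i sgz (d 0 i))%:~R / 8 =
    \sum_i (delta%:~R - 1) * (sgz (d 0 i))%:~R / 8 :> rat.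
  by rewrite -mulr_suml -mulr_sumr rmorph_sum.
rewrite [er (_ - _)]erD mulrCA [kap R B * _]mulrCA rec.
have pn : p%:R ^+ n = sqrtC p%:R ^+ n * sqrtC p%:R ^+ n :> C.
  by rewrite -exprMn -expr2 sqrtCK.
have q0 : sqrtC (p%:R : C) ^+ n != 0 by rewrite expf_neq0 // sqrtC_eq0 pnatr_eq0 -lt0n.
rewrite pn; move: (sqrtC (p%:R : C) ^+ n) q0 (gauss_rhs _ _ _ _ _ _) (er _) (er _) => q q0 g e1 e2.
by field.
Qed.
End GaussSums.

Section RokhlinPhase.
Local Open Scope quotient_scope.
Variables (p : nat) (delta j : int).
(** The coefficient sees the Rokhlin invariant modulo 2 here and modulo 4 in [rokhlin_phase_even],
    where [p] is [delta] modulo 4. *)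
Lemma rokhlin_phase_odd (S Q k : int) : odd p ->
  (S - Q + 16 * k)%:~R / 2 - 2 * p%:R / 4 * (Q - S)%:~R \is a (@Num.int rat).
Proof.
move=> po; rewrite (_ : _ - _ = ((S - Q) * (p./2).+1%:Z + 8 * k)%:~R) ?intr_int //.
rewrite -[in LHS](odd_double_half p) po -addnn -[(p./2).+1]addn1; move: (p./2) => t.
rewrite [(true + (t + t))%:R](_ : _ = 1 + 2 * t%:R); last by rewrite !natrD /=; ring.
by rewrite PoszD !(intrD, intrM, intrN) -!pmulrn; field.
Qed.
Lemma rokhlin_phase_even (S Q k : int) : p%:Z = 4 * j + delta ->
  - (delta%:~R * (S - Q + 16 * k)%:~R / 4) - p%:R / 4 * (Q - S)%:~R \is a (@Num.int rat).
Proof.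
move=> pE; rewrite (_ : _ - _ = (- (4 * k * delta) - j * (Q - S))%:~R) ?intr_int //.
have -> : p%:R = (4 * j + delta)%:~R :> rat by rewrite -pE.
by rewrite !(intrD, intrM, intrN); field.
Qed.
End RokhlinPhase.

Section Topology.
Local Open Scope quotient_scope.
Variables (R : realType) (r h : nat) (delta j : int) (G : plumbing).
Local Notation C := R[i].
Local Notation er := (er R).
Local Notation p := (r' r).
Local Notation n := (nv G).
Local Notation B := (linking G).
Local Notation Bi := (linking_inv G).
Local Notation BQ := (map_mx intr B : 'M[rat]_n).
Local Notation sigma_ := (signature R G).
Hypothesis r3 : (3 <= r)%N.
Hypothesis po : odd p.
Hypothesis hrp : (h = 2 /\ r = p) \/ (h = 1 /\ r = (2 * p)%N).
Hypothesis delta_pm1 : delta = 1 \/ delta = -1.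
Hypothesis pE : p%:Z = 4 * j * h%:Z + delta.
Hypothesis det_neq0 : \det B != 0.

Lemma delta_square : delta * delta = 1. Proof. by case: delta_pm1 => ->. Qed.
Let delta2 := delta_square.
Let p0 := par_p0 po.
Let h0 := par_h0 hrp.
Let pr0 : p%:R != 0 :> rat. Proof. by rewrite pnatr_eq0 -lt0n. Qed.

Lemma linking_mulV : BQ *m Bi = 1%:M.
Proof. by rewrite /linking_inv mulmxV // unitmxE det_map_mx unitfE intr_eq0. Qed.
Let BBi := linking_mulV.
Let Bsym : B^T = B := linking_sym G.
Let BQs : BQ^T = BQ. Proof. by rewrite map_trmx Bsym. Qed.
Let BiB : Bi *m BQ = 1%:M. Proof. exact: mulVmx_int BBi. Qed.

Lemma bf_Bl (z y : 'cV[int]_n) : bf Bi (B *m z) y \is a Num.int.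
Proof. rewrite bf_mull BQs BBi.
have -> : (1%:M : 'M[rat]_n) = map_mx intr (1%:M : 'M[int]_n) by rewrite map_mx1.
exact: bf_int. Qed.

Lemma bf_Br (x z : 'cV[int]_n) : bf Bi x (B *m z) \is a Num.int.
Proof. rewrite bf_mulr BiB.
have -> : (1%:M : 'M[rat]_n) = map_mx intr (1%:M : 'M[int]_n) by rewrite map_mx1.
exact: bf_int. Qed.

Lemma double_latq_sum (A : 'cV[int]_n -> 'cV[int]_n -> C) :
  (forall a f z, A (a + B *m z) f = A a f) -> (forall a f z, A a (f + B *m z) = A a f) ->
  \sum_(a \in [set: H1 G]) \sum_(f \in [set: H1 G]) A (rep a) (rep f) =
  (card_H1 G)%:R ^+ 2 * Av (fun a => Av (A a)).
Proof.
move=> Aa Af; have k0 := kap_gt0 R det_neq0; have kc := kap_card R det_neq0.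
have S (f : 'cV[int]_n -> C) : (forall x z, f (x + B *m z) = f x) ->
    \sum_(a \in [set: H1 G]) f (rep a) = (card_H1 G)%:R * Av f.
  move=> fB; rewrite -(sum_latq det_neq0 fB) mulrA [_ * kap R B]mulrC.
  by rewrite [X in X * _](_ : _ = 1) ?mul1r // -[RHS]kc.
rewrite (eq_fsbigr (fun a : H1 G => (card_H1 G)%:R * Av (A (rep a)))) => [|a _]; last first.
  by apply: S => x z; apply: Af.
rewrite (S (fun a => (card_H1 G)%:R * Av (A a))) => [|x z]; last by congr (_ * _);
  apply: eq_Av => f.
rewrite AvZ ?mulrA -?expr2 //; apply: (per_lat det_neq0) => x z.
by apply: eq_Av => f.
Qed.

Variables (alpha : 'I_n -> C) (m : 'cV[int]_n).
Hypothesis alphaE : forall v, alpha v = ratr ((2 *: (Bi *m map_mx intr m)) v 0).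

Lemma half_classE a : half_class alpha a = ratr (bf Bi a m).
Proof.
rewrite /half_class /bf -mulmxA mxE rmorph_sum mulr_suml; apply: eq_bigr => v _.
transitivity ((a v 0)%:~R * ratr ((Bi *m map_mx intr m) v 0) : C).
  rewrite alphaE mxE rmorphM /= ratr_nat; move: (ratr _) => x.
  by rewrite [2 * x]mulrC mulrA mulfK // pnatr_eq0.
by rewrite rmorphM /= [(_^T) _ _]mxE [map_mx intr a _ _]mxE ratr_int.
Qed.

Let double_summand (c a f : 'cV[int]_n) : C :=
  er (- (j%:~R * bf Bi a a) - bf Bi a (c + f) + h%:R * delta%:~R * bf Bi f f).

Lemma double_summand_l c a f z : double_summand c (a + B *m z) f = double_summand c a f.
Proof.
apply: er_congr; rewrite !bfDl !bfDr.
rewrite (_ : _ - _ = - (j%:~R * (bf Bi a (B *m z) + (bf Bi (B *m z) a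
  + bf Bi (B *m z) (B *m z)))) - (bf Bi (B *m z) c + bf Bi (B *m z) f)); last by ring.
by rewrite rpredB ?rpredN ?rpredM ?rpredD ?bf_Bl ?bf_Br ?rpred_int.
Qed.

Lemma double_summand_r c a f z : double_summand c a (f + B *m z) = double_summand c a f.
Proof.
apply: er_congr; rewrite !(bfDr Bi a) !(bfDl Bi f) !(bfDr Bi f) !(bfDr Bi (B *m z)).
rewrite (_ : _ - _ = - bf Bi a (B *m z) + h%:R * delta%:~R * (bf Bi f (B *m z)
  + (bf Bi (B *m z) f + bf Bi (B *m z) (B *m z)))); last by ring.
by rewrite rpredD ?rpredN ?rpredM ?rpredD ?bf_Bl ?bf_Br ?rpred_int ?rpred_nat.
Qed.

Hypothesis hc : (h = 2 /\ (r == delta %[mod 8])%Z) \/ (h = 1 /\ (r == delta %[mod 8])%Z = false).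

Let emu (s : 'cV['F_2]_n) : C := er (h%:R * p%:R / 4 *
  (((spin_lift s)^T *m B *m spin_lift s) 0 0 - sigma_)%:~R).

Lemma residue_quotient : ((if (r == delta %[mod 8])%Z then r%:Z - delta else r%:Z - 2
  * delta)%:~R = 8 * j%:~R :> C).
Proof.
case: hc => -[hE ->]; case: hrp => -[hE' rE]; have rZ := congr1 Posz rE; rewrite hE // in hE'.
  by rewrite rZ pE hE (_ : _ - _ = 8 * j) ?intrM //; ring.
by rewrite rZ PoszM pE hE (_ : _ - _ = 8 * j) ?intrM //; ring.
Qed.

(** Both coefficient formulas become one average, and [card_H1^2 / card_H1] leaves one factor
    [card_H1]. For even [r] the variable [f] is replaced by [delta f], which leaves [lk f f] and the
    average unchanged. *)
Lemma c_formulaE b s : c_formula r delta alpha b s =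
  emu s * torsion alpha (2 * h) * (card_H1 G)%:R * gauss_rhs R Bi delta j h (m + rep b).
Proof.
have [k kE] := rokhlin_cong s R; rewrite /emu; move: (((spin_lift s)^T *m _ *m _) 0 0) kE => Q kE.
have rokE : (rokhlin R s : nat)%:R = ratr (sigma_ - Q + 16 * k)%:~R :> C.
  by rewrite -kE ratr_int.
have cr : (card_H1 G)%:R != 0 :> C.
  apply/negP => /eqP e; have := kap_card R det_neq0.
  by rewrite -[X in _ * X]/((card_H1 G)%:R) e mulr0 => /esym/eqP; rewrite oner_eq0.
have S2 := double_latq_sum (@double_summand_l (m + rep b)) (@double_summand_r (m + rep b)).
have S3 : \sum_(a \in [set: H1 G]) \sum_(f \in [set: H1 G]) double_summand (m
  + rep b) (rep a) (rep f *~ delta) =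
    (card_H1 G)%:R ^+ 2 * gauss_rhs R Bi delta j h (m + rep b).
  rewrite (@double_latq_sum (fun a f => double_summand (m + rep b) a (f *~ delta))) =>
    [|a f z|a f z]; last 2 first.
  - exact: double_summand_l.
  - rewrite (_ : (f + B *m z) *~ delta = f *~ delta + B *m (z *~ delta)) ?double_summand_r //.
    by rewrite mulrzDl; case: delta_pm1 => ->; rewrite ?mulrNz ?mulr1z ?mulmxN.
  rewrite /gauss_rhs; apply: (congr1 (fun z : C => (card_H1 G)%:R ^+ 2 * z)).
  apply: (@eq_Av R n) => a.
  case: delta_pm1 => e; first by apply: eq_Av => f; rewrite {1}e mulr1z.
  rewrite -[RHS]Av_opp; first by apply: eq_Av => f; rewrite {1}e mulrNz mulr1z.
  by apply: (per_lat det_neq0) => x z; apply: double_summand_r.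
have fin (u u' t c T T' v : C) : c != 0 -> T' = c ^+ 2 * v -> u = u' -> T = T' ->
    u * t / c * T = u' * t * c * v.
  by move=> c0 -> -> ->; field.
have jE := residue_quotient.
rewrite /c_formula; case: hc => -[hE hr]; rewrite hr in jE *.
  have tE : torsion alpha (2 * h) = torsion alpha 4 by rewrite hE.
  rewrite /c_odd tE.
  apply: (fin _ _ _ _ _ _ _ cr S2).
    transitivity (er ((sigma_ - Q + 16 * k)%:~R / 2)).
      by rewrite /er rokE [in RHS]rmorphM /= fmorphV /= ratr_nat.
    apply: er_congr.
    by rewrite hE; apply: rokhlin_phase_odd.
  apply: eq_fsbigr => a _; apply: eq_fsbigr => f _; rewrite /double_summand /er half_classE;
    congr e2pi.
  rewrite jE /lk -!/(bf _ _ _) !(bfDr Bi (rep a)) !rmorphD !rmorphN !rmorphM /= !ratr_int hE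
    ratr_nat.
  rewrite !rmorphD /=; by field.
have tE : torsion alpha (2 * h) = torsion alpha 2 by rewrite hE.
rewrite /c_even tE.
apply: (fin _ _ _ _ _ _ _ cr S3).
  transitivity (er (- (delta%:~R * (sigma_ - Q + 16 * k)%:~R / 4))).
    by rewrite /er rokE [in RHS]rmorphN !rmorphM /= fmorphV /= ratr_nat [in RHS]ratr_int.
  apply: er_congr.
  by rewrite hE mul1r; apply: rokhlin_phase_even; rewrite pE hE mulr1.
apply: eq_fsbigr => a _; apply: eq_fsbigr => f _; rewrite /double_summand /er half_classE;
  congr e2pi.
rewrite jE /lk -!/(bf _ _ _) !(bfDr Bi (rep a)) bfMzl !(bfMzr Bi) [delta%:~R * (delta%:~R
  * _)]mulrA -intrM delta2 !rmorphD !rmorphN !rmorphM /= !ratr_int hE ratr_nat.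
rewrite !rmorphD /= rmorph1; by field.
Qed.

End Topology.

Lemma Delta_powers (F : fieldType) (s e T : F) (b c : nat) : s != 0 -> e != 0 ->
  (- (s * e)) ^- b * (s * e^-1) ^- c * ((-1) ^+ b * T) * (s ^+ b * s ^+ c) = T * (e ^- b * e ^+ c).
Proof.
move=> s0 e0; rewrite -[- (s * e)]mulN1r !exprMn exprVn.
have a0 := expf_neq0 b s0; have b0 := expf_neq0 c s0.
have u0 := expf_neq0 b e0; have v0 := expf_neq0 c e0.
have c0 : (-1) ^+ b != 0 :> F by rewrite signr_eq0.
move: ((-1) ^+ b) (s ^+ b) (s ^+ c) (e ^+ b) (e ^+ c) c0 a0 b0 u0 v0 => w x y z t *.
by field; do ?[apply/andP; split].
Qed.

(** * Comparison of the coefficients *)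

Section LatticeSum.
Variables (R : realType) (r h : nat) (delta j : int) (G : plumbing).
Local Notation C := R[i].
Local Notation er := (er R).
Local Notation p := (r' r).
Local Notation n := (nv G).
Local Notation B := (linking G).
Local Notation Bi := (linking_inv G).
Local Notation BQ := (map_mx intr B : 'M[rat]_n).
Local Notation sigma_ := (signature R G).
Hypothesis r3 : (3 <= r)%N.
Hypothesis po : odd p.
Hypothesis hrp : (h = 2 /\ r = p) \/ (h = 1 /\ r = (2 * p)%N).
Hypothesis delta_pm1 : delta = 1 \/ delta = -1.
Hypothesis pE : p%:Z = 4 * j * h%:Z + delta.
Hypothesis det_neq0 : \det B != 0.

Let delta2 := delta_square delta_pm1.
Let p0 := par_p0 po.
Let h0 := par_h0 hrp.
Let pr0 : p%:R != 0 :> rat. Proof. by rewrite pnatr_eq0 -lt0n. Qed.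
Let BBi := linking_mulV det_neq0.
Let Bsym : B^T = B := linking_sym G.
Let r0E : (r0 r)%:R = 2 * p%:R :> C := r0C R po hrp.

Lemma class_lift (alpha : 'I_n -> C) : is_class alpha ->
  exists m : 'cV[int]_n, forall v, alpha v = ratr ((2 *: (Bi *m map_mx intr m)) v 0).
Proof.
move=> /boolp.choice[m mE]; exists (\col_v m v) => v.
pose a : 'cV[C]_n := \col_w alpha w.
have BC : map_mx intr B = map_mx ratr BQ :> 'M[C]_n.
  by apply/matrixP => x y; rewrite !mxE ratr_int.
have eB : map_mx intr B *m a = map_mx intr (2 *: \col_w m w).
  apply/matrixP => x y; rewrite !mxE -mE; apply: eq_bigr => w _.
  by rewrite !mxE.
have -> : alpha v = a v 0 by rewrite mxE.
have -> : a = map_mx ratr (Bi *m map_mx intr (2 *: \col_w m w)).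
  have mI : map_mx ratr (map_mx intr (2 *: \col_w m w) : 'cV[rat]_n) =
    map_mx intr (2 *: \col_w m w) :> 'cV[C]_n.
    by apply/matrixP => x y; rewrite !mxE ratr_int.
  rewrite map_mxM mI -eB BC mulmxA -map_mxM (mulVmx_int BBi) map_mx1 mul1mx //.
rewrite [LHS]mxE; congr (ratr (_ v 0)).
by rewrite scalemxAr; congr (_ *m _); apply/matrixP => x y; rewrite !mxE intrM.
Qed.

Variables (alpha : 'I_n -> C) (m : 'cV[int]_n).
Hypothesis alphaE : forall v, alpha v = ratr ((2 *: (Bi *m map_mx intr m)) v 0).

Local Notation lam k v := (alpha v + I_r R (k v)).
Local Notation lamq k := (colour_weights p Bi m (box k)).

Lemma colour_weight (k : {ffun 'I_n -> 'I_p}) v : lam k v = ratr (lamq k v 0).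
Proof.
rewrite alphaE /I_r r0E /colour_weights [in RHS]mxE [X in ratr (X + _)]mxE [X
  in ratr (_ + X + _)]mxE.
rewrite [(2 *: map_mx intr (box k)) v 0]mxE [map_mx intr (box k) v 0]mxE [box k v 0]mxE -pmulrn.
rewrite !rmorphD /= rmorphN rmorphM /= rmorph1 !ratr_nat rmorphM /= !ratr_nat.
by rewrite -!addrA; congr (_ + _); ring.
Qed.

Definition weight (k : {ffun 'I_n -> 'I_p}) : C :=
  qpow r ((\sum_v \sum_w (B v w)%:~R * lam k v * lam k w) / 2
          - (\tr B)%:~R * ((r0 r)%:R - 1) ^+ 2 / 2).
Local Notation W := weight.

(** Modulo 1 the trace term retains only [- h tr B / (4 p)], because [(2 p - 1)^2] is 1 modulo
    [4 p]; this is the [- tr B] in the prefactor of [zhat]. *)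
Lemma weight_er (k : {ffun 'I_n -> 'I_p}) (l : 'cV[int]_n) :
  W k * \prod_v qpow r ((l v 0)%:~R * lam k v) =
  er ((qf BQ (lamq k) (lamq k) / 2 + qf 1%:M (map_mx intr l) (lamq k)) * h%:R / (2 * p%:R))
  * er (- ((\tr B)%:~R * h%:R / (4 * p%:R))).
Proof.
have qE : \sum_v \sum_w (B v w)%:~R * lam k v * lam k w = ratr (qf BQ (lamq k) (lamq k)) :> C.
  rewrite /qf mxE rmorph_sum exchange_big; apply: eq_bigr => w _ /=.
  rewrite rmorphM /= mxE rmorph_sum mulr_suml; apply: eq_bigr => v _.
  by rewrite !colour_weight rmorphM /= [(_^T) _ _]mxE [map_mx intr B _ _]mxE ratr_int [_
    * ratr (lamq k v 0)]mulrC.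
have lE : \sum_v (l v 0)%:~R * lam k v = ratr (qf 1%:M (map_mx intr l) (lamq k)) :> C.
  rewrite /qf mulmx1 mxE rmorph_sum; apply: eq_bigr => v _ /=.
  by rewrite !colour_weight rmorphM /= [(_^T) _ _]mxE [map_mx intr l _ _]mxE ratr_int.
rewrite -qpow_sum lE /weight qE r0E -qpowD.
set u := qf BQ _ _; set w := qf _ _ _.
have -> : ratr u / 2 - (\tr B)%:~R * (2 * p%:R - 1) ^+ 2 / 2 + ratr w =
  ratr (u / 2 - (\tr B)%:~R * (2 * p%:R - 1) ^+ 2 / 2 + w) :> C.
  have -> : (2 * p%:R - 1 : C) =
    ratr (2 * p%:R - 1) by rewrite rmorphB /= rmorphM /= rmorph1 !ratr_nat.
  have -> : (2 : C)^-1 = ratr 2^-1 by rewrite fmorphV /= ratr_nat.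
  by rewrite [RHS]rmorphD [in RHS]rmorphB !expr2 !rmorphM /= ratr_int.
rewrite (qpow_er R r3 hrp) -erD; apply: er_congr.
rewrite (_ : _ - _ = ((\tr B) * h%:Z * (1 - p%:Z))%:~R) ?intr_int // !(intrM, intrB) -!pmulrn.
by field.
Qed.

Hypothesis hc : (h = 2 /\ (r == delta %[mod 8])%Z) \/ (h = 1 /\ (r == delta %[mod 8])%Z = false).
Variables (root : 'I_n) (Dp Dm : C).
Hypothesis generic : forall v, ~ exceptional r (alpha v).
Hypothesis DpP : is_Delta r true Dp.
Hypothesis DmP : is_Delta r false Dm.
Let r_odd := par_r_odd po hrp.

(** The sign undoes the one inside [torsion] and leaves the product of the powers of [Xd]. *)
Definition prefactor : C := Dp ^- bplus R G * Dm ^- bminus R G * ((-1) ^+ bplus R G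
  * torsion alpha (2 * h)).
Local Notation Z := prefactor.

Lemma Xd_lam (k : {ffun 'I_n -> 'I_p}) v : Xd r (lam k v) = Xd r (alpha v + 1).
Proof.
rewrite -[RHS](Xd_shift r3 _ ((k v : nat)%:Z - p%:Z)) /I_r r0E intrM intrB -!pmulrn.
by congr (Xd r); ring.
Qed.

(** Since [r0 = h r], the powers [q^(r0 x)] are [e2pi (h x)]; so the torsion is taken at [2 h], that
    is 4 or 2. *)
Lemma Xd_torsion v : Xd r (alpha v + 1) =
  e2pi ((2 * h)%:R * alpha v / 2) - e2pi (- ((2 * h)%:R * alpha v / 2)).
Proof.
have rr : r%:R != 0 :> C by rewrite pnatr_eq0; case: r r3.
have e : (r0 r)%:R = h%:R * r%:R :> C by rewrite r0E -!natrM (par_hr hrp).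
have E (x : C) : qpow r ((r0 r)%:R * x) = e2pi (h%:R * x) by rewrite /qpow e; congr e2pi; field.
rewrite /Xd -mulrN !E; congr (_ - _).
  by rewrite mulrDr e2piD mulr1 e2pi_nat mulr1 natrM; congr e2pi; field.
rewrite mulrN mulrDr opprD e2piD mulr1 e2piN e2piN e2pi_nat invr1 mulr1 natrM -!e2piN;
  congr e2pi; by field.
Qed.

(** The denominators of the modified dimensions do not depend on the colour and leave the sum as the
    torsion; the numerators are the factors of [Fplus]. *)
Lemma N_rE : N_r r root Dp Dm alpha =
  Z * \sum_(k : {ffun 'I_n -> 'I_p}) W k * Fplus (fun v => qpow r (lam k v)).
Proof.
rewrite /N_r /prefactor -[RHS]mulrA; congr (_ * _); rewrite mulr_sumr; apply: eq_bigr => k _.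
have X0 v : Xd r (lam k v) != 0 by rewrite Xd_lam; exact: generic_Xd.
rewrite (Fprime_tree r3 r_odd root X0) -/(weight k) [_ * weight k]mulrC [RHS]mulrCA; congr (_ * _).
rewrite /torsion mulrA -expr2 -exprM mulnC exprM sqrrN expr1n expr1n mul1r /Fplus -big_split.
apply: eq_bigr => v _; rewrite -Xd_torsion -(Xd_lam k) /mdim -/(Xd r (lam k v)) expfzMl qpowN
  mulrC; congr (_ * _).
by rewrite exprz_inv opprB.
Qed.

Lemma n_signature : (bplus R G + bminus R G)%N = n /\
  forall U (Ui : 'M[rat]_n) d, map_mx intr U *m Ui = 1%:M -> U^T *m B *m U = diag_mx d ->
  \sum_i sgz (d 0 i) = sigma_.
Proof.
have H U (Ui : 'M[rat]_n) d : map_mx intr U *m Ui = 1%:M -> U^T *m B *m U = diag_mx d ->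
    (bplus R G + bminus R G)%N = n /\ \sum_i sgz (d 0 i) = sigma_.
  move=> UUi UBU; have [bp bm] := signature_diag R Bsym UUi UBU.
  have d0 i : d 0 i != 0.
    have : \det (diag_mx d) != 0.
      rewrite -UBU !det_mulmx det_tr !mulf_neq0 //; apply: contraTneq (oner_neq0 rat) => e;
      by rewrite -(det1 _ n) -UUi det_mulmx det_map_mx e mul0r eqxx.
    by rewrite det_diag => /prodf_neq0 /(_ i isT).
  have cE (P : pred 'I_n) : #|[set i | P i]%SET| = (\sum_(i : 'I_n) P i)%N.
    by rewrite -sum1dep_card big_mkcond; apply: eq_bigr => i _; case: (P i).
  rewrite /signature bp bm !cE; split.
    rewrite -big_split /= -[RHS]card_ord -sum1_card; apply: eq_bigr => i _.
    by have := d0 i; case: ltgtP.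
  rewrite (big_morph Posz PoszD erefl) (big_morph Posz PoszD erefl) -sumrB; apply: eq_bigr => i _.
  by case: sgzP (d0 i).
have [U [Ui UUi [d UBU]]] := int_diagonalize Bsym.
by split=> [|U' Ui' d' e1 e2]; [case: (H U Ui d UUi UBU)|case: (H U' Ui' d' e1 e2)].
Qed.

Let X : rat := h%:R * p%:R / 4 - 3 * h%:R / (4 * p%:R) - (delta%:~R - 1) / 8.

(** The sign of [Delta_+] absorbs the one in [prefactor], and [b_+ + b_- = n] cancels all square
    roots of [p]. *)
Lemma prefactor_er : Z * sqrtC p%:R ^+ n = torsion alpha (2 * h) * er (- (sigma_%:~R * X)).
Proof.
have [nE _] := n_signature.
have -> : sqrtC p%:R ^+ n = sqrtC p%:R ^+ bplus R G
  * sqrtC p%:R ^+ bminus R G :> C by rewrite -exprD nE.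
rewrite /prefactor.
rewrite (Delta_plus_er r3 po hrp delta2 pE (@generic root) DpP).
rewrite (Delta_minus_er r3 po hrp delta2 pE (@generic root) DmP) -/X erN.
have -> : er (- (sigma_%:~R * X)) = er X ^- bplus R G * er X ^+ bminus R G.
  rewrite -!erMn -erN -erD; congr er; rewrite /signature intrB -!pmulrn -!(mulr_natl X).
  by ring.
have s0 : sqrtC p%:R != 0 :> C by rewrite sqrtC_eq0 pnatr_eq0 -lt0n.
exact: Delta_powers (er_neq0 R X).
Qed.

Lemma tau_rE : tau_r R r = ratr (h%:R / p%:R).
Proof.
have rr : r%:R != 0 :> C by rewrite pnatr_eq0; case: r r3.
have pC : p%:R != 0 :> C by rewrite pnatr_eq0 -lt0n.
rewrite fmorph_div /= !ratr_nat /tau_r; apply/eqP; rewrite eqr_div // -!natrM.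
by rewrite (par_hr hrp).
Qed.

(* Equates the coefficients of [F^+_l] in the two sides of the theorem. *)
Lemma gauss_identity b s y (l : 'cV[int]_n) :
  l = rep b *+ 2 + B *m spin_lift s - B *m const_mx 1 + (B *m y) *+ 2 ->
  c_formula r delta alpha b s * e2pi (tau_r R r * (3 * sigma_ - \tr B)%:~R / 4)
    * e2pi (- (tau_r R r * ratr (lk l l) / 4))
  = Z * \sum_(k : {ffun 'I_n -> 'I_p}) W k * \prod_v qpow r ((l v 0)%:~R * lam k v).
Proof.
move=> lE.
have k0 : kap R B != 0 by rewrite gt_eqF // kap_gt0.
have kc : kap R B * (card_H1 G)%:R = 1 by exact: kap_card.
have [U [Ui UUi [d UBU]]] := int_diagonalize Bsym.
have [nE /(_ U Ui d UUi UBU) sE] := n_signature.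
have gE := gauss_sum_total R po p0 h0 delta2 pE BBi Bsym m (rep b) (spin_lift s) y UUi UBU.
rewrite -lE sE in gE.
have -> : Z * \sum_(k : {ffun 'I_n -> 'I_p}) W k * \prod_v qpow r ((l v 0)%:~R * lam k v) =
    Z * er (- ((\tr B)%:~R * h%:R / (4 * p%:R))) * (card_H1 G)%:R * (kap R B
      * \sum_(k : {ffun 'I_n -> 'I_p})
     er ((qf BQ (lamq k) (lamq k) / 2 + qf 1%:M (map_mx intr l) (lamq k)) * h%:R / (2 * p%:R))).
  rewrite -[_ * (kap R B * _)]mulrA [(card_H1 G)%:R * (kap R B * _)]mulrA [_%:R
    * kap R B]mulrC kc mul1r -mulrA; apply: (congr1 (fun x => Z * x)); rewrite mulr_sumr.
  by apply: eq_bigr => k _; rewrite weight_er mulrC.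
rewrite gE (c_formulaE po hrp delta_pm1 pE det_neq0 alphaE hc).
have rE (x : rat) : e2pi (ratr (h%:R / p%:R) * ratr x / 4) = er (h%:R / p%:R * x / 4).
  rewrite /er; congr e2pi; rewrite [RHS]fmorph_div /= ratr_nat; congr (_ / _).
  by rewrite [RHS]rmorphM.
have iE : (3 * sigma_ - \tr B)%:~R = ratr (3 * sigma_ - \tr B)%:~R :> C by rewrite ratr_int.
rewrite e2piN tau_rE (rE (lk l l)) iE rE -erN.
rewrite /lk -/(bf Bi l l).
set Q := (_ *m _) 0 0; have QE : bf BQ (spin_lift s) (spin_lift s) = Q%:~R.
  by rewrite /bf map_trmx -!map_mxM mxE.
rewrite QE; set g := gauss_rhs _ _ _ _ _ _; set E := er (- _ + _ - _).
have -> : Z * er (- ((\tr B)%:~R * h%:R / (4 * p%:R))) * (card_H1 G)%:R * (E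
  * sqrtC p%:R ^+ n * g) =
   (Z * sqrtC p%:R ^+ n) * (card_H1 G)%:R * g * (er (- ((\tr B)%:~R * h%:R / (4 * p%:R)))
     * E) by ring.
rewrite prefactor_er.
transitivity (torsion alpha (2 * h) * (card_H1 G)%:R * g * (er (h%:R * p%:R / 4
  * (Q - sigma_)%:~R) * er (h%:R / p%:R * (3 * sigma_ - \tr B)%:~R / 4) * er (- (h%:R / p%:R
    * bf Bi l l / 4)))).
  by ring.
have -> : er (h%:R * p%:R / 4 * (Q - sigma_)%:~R) * er (h%:R / p%:R * (3
  * sigma_ - \tr B)%:~R / 4) * er (- (h%:R / p%:R * bf Bi l l / 4))
   = er (- (sigma_%:~R * X)) * (er (- ((\tr B)%:~R * h%:R / (4 * p%:R))) * E).
  rewrite /E -!erD; congr er; rewrite /X.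
  move: (bf Bi l l) (sigma_) (\tr B) => x y0 t.
  by rewrite !intrB intrM; move: (Q%:~R) (y0%:~R) (t%:~R) => z y1 t1; field.
move: (torsion _ _) (er _) (er _) => x y0 z; ring.
Qed.

End LatticeSum.

Lemma cvg_lincomb (R : realType) (T S : Type) (F : set_system T) {FF : Filter F}
    (s : seq S) (a : S -> R[i]) (f : S -> T -> R[i]) (l : S -> R[i]) :
  (forall k, (f k t : R[i]^o) @[t --> F] --> (l k : R[i]^o)) ->
  (\sum_(k <- s) a k * f k t : R[i]^o) @[t --> F] --> (\sum_(k <- s) a k * l k : R[i]^o).
Proof.
move=> fl; elim: s => [|k s IH].
  by rewrite big_nil; under eq_fun do rewrite big_nil; apply: cvg_cst.
rewrite big_cons; under eq_fun do rewrite big_cons.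
apply: (@cvgD R[i] R[i]^o _ F _ _ _ _ _ _ IH).
exact: (@cvgZ R[i] R[i]^o _ F _ (fun=> a k) _ (a k) (l k : R[i]^o) (cvg_cst _) (fl k)).
Qed.

(** * Exchange of sums and passage to the limit *)

Section Assembly.
Local Open Scope quotient_scope.
Variables (R : realType) (r h : nat) (delta j : int) (G : plumbing).
Local Notation C := R[i].
Local Notation er := (er R).
Local Notation p := (r' r).
Local Notation n := (nv G).
Local Notation B := (linking G).
Local Notation Bi := (linking_inv G).
Hypothesis r3 : (3 <= r)%N.
Hypothesis po : odd p.
Hypothesis hrp : (h = 2 /\ r = p) \/ (h = 1 /\ r = (2 * p)%N).
Hypothesis delta_pm1 : delta = 1 \/ delta = -1.
Hypothesis pE : p%:Z = 4 * j * h%:Z + delta.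
Hypothesis det_neq0 : \det B != 0.
Hypothesis hc : (h = 2 /\ (r == delta %[mod 8])%Z) \/ (h = 1 /\ (r == delta %[mod 8])%Z = false).
Variables (alpha : 'I_n -> C) (root : 'I_n) (Dp Dm : C).
Hypothesis alpha_class : is_class alpha.
Hypothesis generic : forall v, ~ exceptional r (alpha v).
Hypothesis DpP : is_Delta r true Dp.
Hypothesis DmP : is_Delta r false Dm.

Local Notation lam k v := (alpha v + I_r R (k v)).
Local Notation W := (@weight R r G alpha).
Local Notation Z := (@prefactor R h G alpha Dp Dm).
Let P (k : {ffun 'I_n -> 'I_p}) (l : 'cV[int]_n) : C := \prod_v qpow r ((l v 0)%:~R * lam k v).
Let E : C := e2pi (tau_r R r * (3 * signature R G - \tr B)%:~R / 4).
Let e (l : 'cV[int]_n) : C := e2pi (- (tau_r R r * ratr (lk l l) / 4)).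

Lemma double_mulmx (z : 'cV[int]_n) : (B *+ 2) *m z = (B *m z) *+ 2.
Proof. by rewrite !mulr2n mulmxDl. Qed.

Lemma entry_shift (a b c : 'cV[int]_n) v : (a - b + c *+ 2) v 0 = a v 0 - b v 0 + 2 * c v 0.
Proof. by rewrite mulr2n !mxE; ring. Qed.

Lemma gauss_identity_sigma b s (l y : 'cV[int]_n) : l =
  rep (sigma b s) - B *m const_mx 1 + (B *m y) *+ 2 ->
  c_formula r delta alpha b s * E * e l = Z * \sum_k W k * P k l.
Proof.
move=> lE; have [m mE] := class_lift det_neq0 alpha_class.
have : \pi_(latq (B *+ 2)) (rep b *+ 2 + B *m spin_lift s) == \pi_(latq (B *+ 2)) (rep (sigma b s)).
  by rewrite {2}/rep reprK.
case/latqP => z zE.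
apply: (@gauss_identity R r h delta j G r3 po hrp delta_pm1 pE det_neq0 alpha m mE hc root Dp
  Dm generic DpP DmP b s (y - z)).
have zE' : rep (sigma b s) = rep b *+ 2 + B *m spin_lift s - (B *m z) *+ 2.
  by rewrite -double_mulmx -zE opprB addrC subrK.
rewrite lE zE' mulmxBr mulrnBl [(B *m y) *+ 2 - _]addrC [RHS]addrA; congr (_ + _).
by rewrite addrAC.
Qed.

(* In [gauss_identity] only the coefficient depends on [(b, s)], the other terms
   depending on [l] alone. *)
Lemma c_omega_formula b s : s \in spin G ->
  c_omega r delta alpha (sigma b s) = c_formula r delta alpha b s.
Proof.
move=> sS; rewrite /c_omega; set q := xget _ _.
have [qS qE] : q.2 \in spin G /\ sigma q.1 q.2 =
  sigma b s by apply: (@xgetPex _ _ [set p : H1 G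
    * 'cV['F_2]_n | p.2 \in spin G /\ sigma p.1 p.2 = sigma b s]); exists (b, s).
pose l := rep (sigma b s) - B *m const_mx 1 + (B *m 0) *+ 2.
have := @gauss_identity_sigma q.1 q.2 l 0; rewrite qE => /(_ erefl).
rewrite -(@gauss_identity_sigma b s l 0 erefl) => /(mulIf (e2pi_neq0 _))/(mulIf (e2pi_neq0 _)) //.
Qed.

Let parity (l : 'cV[int]_n) := forall v, (l v 0%R == deg v %[mod 2])%Z.

Let x (F : 'cV[int]_n -> C) (K : latq (B *+ 2)) (l : 'cV[int]_n) : C :=
  if `[< exists y, l = rep K - B *m const_mx 1 + (B *m y) *+ 2 >] then F l * e l else 0.

Lemma diag_deg (v : 'I_n) : (B *m const_mx 1 : 'cV[int]_n) v 0 = B v v + (deg v)%:Z.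
Proof.
rewrite mxE (bigD1 v) //= [const_mx 1 v 0]mxE mulr1; congr (_ + _).
rewrite /deg -sum1_card (big_morph Posz PoszD erefl) big_mkcond [RHS]big_mkcond.
apply: eq_bigr => w _; rewrite inE !mxE eq_sym mulr1; case: eqP => [->|_] /=.
  by rewrite adj_irr.
by case: (adj v w).
Qed.

Lemma mod2P (a b : int) : (a == b %[mod 2])%Z = (2 %| a - b)%Z.
Proof. by rewrite eqz_mod_dvd. Qed.

(** [B] applied to the all-ones vector is the diagonal plus the degrees, so [l] has the parity of
    the degrees exactly when [l + B 1] is characteristic. *)
Lemma index_class l : parity l ->
  let K := \pi_(latq (B *+ 2)) (l + B *m const_mx 1) in
  spinc K /\ forall K', `[< exists y, l = rep K' - B *m const_mx 1 + (B *m y) *+ 2 >] = (K' == K).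
Proof.
move=> lp K; have H K' : `[< exists y, l = rep K' - B *m const_mx 1 + (B *m y) *+ 2 >] = (K' == K).
  apply/asboolP/eqP => [[y yE]|->].
    rewrite -[K']reprK /K; apply/eqP/latqP; exists (- y).
    by rewrite {1}yE -/(rep K') mulmxN double_mulmx addrAC subrK opprD addrA subrr add0r.
  have : \pi_(latq (B *+ 2)) (l
    + B *m const_mx 1) == \pi_(latq (B *+ 2)) (rep K) by rewrite /rep reprK.
  by case/latqP => z zE; exists z; rewrite -double_mulmx -zE [RHS]addrC addrA subrK addrK.
split=> // i; have /asboolP[y yE] : `[< exists y,
  l = rep K - B *m const_mx 1 + (B *m y) *+ 2 >] by rewrite H.
have -> : rep K i 0 = l i 0 + (B i i + (deg i)%:Z) - 2 * (B *m y) i 0.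
  by rewrite {1}yE entry_shift diag_deg; ring.
have := lp i; rewrite !mod2P => d1.
rewrite (_ : _ - _ = (l i 0 - (deg i)%:Z) + 2 * ((deg i)%:Z - (B *m y) i 0)); last by ring.
by apply: rpredD => //; apply: dvdz_mulr.
Qed.

Lemma norm_lattice_phase k l : `|P k l| = 1 /\ `|e l| = 1.
Proof.
have [m mE] := class_lift det_neq0 alpha_class; split.
  rewrite /P normr_prod big1 // => v _; rewrite (colour_weight po hrp mE).
  by rewrite -(ratr_int C) -rmorphM /= (qpow_er R r3 hrp) norm_er.
rewrite /e (tau_rE R r3 po hrp).
have -> : - (ratr (h%:R / p%:R) * ratr (lk l l) / 4) = ratr (- (h%:R / p%:R * lk l l / 4)) :> C.
  by rewrite [RHS]rmorphN [in RHS]fmorph_div /= ratr_nat [in RHS]rmorphM.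
exact: norm_er.
Qed.

(** Both sides are compared coefficientwise in [F l]: an [l] of the right parity meets a single
    class [K], for which the Gauss identity trades the coefficient for a finite sum over the
    colours. *)
Lemma zhat_sum_tau (F : 'cV[int]_n -> C) :
  (forall l, ~ parity l -> F l = 0) ->
  (forall k, abs_summable (fun l => F l * P k l)) ->
  zhat_sum r delta alpha F (tau_r R r) = \sum_k Z * W k * csum (fun l => F l * P k l).
Proof.
move=> F0 Fs.
(* Any colouring serves as a bound: all phases have modulus 1, so summability for one [k] dominates
   every series [x F K]. *)
have k0 : {ffun 'I_n -> 'I_p} by exact: [ffun=> Ordinal (par_p0 po)].
have x_summable K : csummable (x F K).
  apply: abs_csummable; have [M FM] := Fs k0; exists M => J.
  apply: le_trans (FM J); apply: ler_sum => l _.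
  have [a b] := norm_lattice_phase k0 (\val l).
  by rewrite normrM a mulr1 /x; case: ifP => _; rewrite ?normrM ?b ?mulr1 // normr0 normr_ge0.
have d2 : \det (B *+ 2) != 0.
  by rewrite -scaler_nat detZ mulf_neq0 // expf_neq0.
have fin : finite_set (@spinc G) by apply: sub_finite_set (latq_finite d2).
rewrite /zhat_sum fsbig_finite //=.
transitivity (\sum_(K <- fset_set (@spinc G)) c_omega r delta alpha K * E * csum (x F K)).
  by apply: eq_bigr => K _; rewrite -mulrA.
rewrite -csum_lin // -csum_lin => [|k]; last exact: abs_csummable.
congr csum; apply/funext => l.
case: (pselect (parity l)) => [lp|/F0 e0]; last first.
  rewrite !big1 // => [k _|K _]; first by rewrite e0 mul0r mulr0.
  by rewrite /x e0 mul0r; case: ifP => _; rewrite mulr0.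
have [] := index_class lp; set K := \pi_(latq _) _ => sK KE.
have Kin : K \in fset_set (@spinc G) by rewrite in_fset_set //; apply: mem_set.
rewrite (bigD1_seq K Kin (fset_uniq _)) /= big1 => [|K' KK']; last first.
  by rewrite /x KE (negPf KK') mulr0.
rewrite addr0 /x KE eqxx.
have [b [s [sS sE]]] := spinc_presentation sK.
have /asboolP[y yE] : `[< exists y, l = rep K - B *m const_mx 1 + (B *m y) *+ 2 >] by rewrite KE.
rewrite mulrCA -sE c_omega_formula // (@gauss_identity_sigma b s l y) ?sE // 2!mulr_sumr.
by apply: eq_bigr => k _; ring.
Qed.

Lemma limit_at_root : regularization r delta alpha ->
  (zhat_sum r delta alpha (@Fplus_coef R G) tau : C^o) @[tau --> to_root r]
    --> (N_r r root Dp Dm alpha : C^o).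
Proof.
move=> [Ft [_ F0 Fs [L [L1 L2]]]].
(* [L] is also the limit of the regularized sums at the root itself, where [zhat_sum_tau] is an
   exact formula; uniqueness of limits then identifies [L]. *)
suff Nlim : (zhat_sum r delta alpha (Ft t) (tau_r R r) : C^o) @[t --> (1 : R)^'-] --> (N_r r
  root Dp Dm alpha : C^o).
  by have <- // : L = N_r r root Dp Dm alpha; apply: (cvg_unique _ L2 Nlim); exact: norm_hausdorff.
rewrite (N_rE r3 po hrp root Dp Dm generic) mulr_sumr.
under eq_bigr do rewrite mulrA.
have FF : Filter (1 : R)^'- by exact: _.
have H := @cvg_lincomb R R _ ((1 : R)^'-) FF (index_enum _) (fun k => Z * W k)
  (fun k t => csum (fun l => Ft t l * P k l)) _ (fun k => (Fs k).2).
apply: cvg_trans H.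
apply: near_eq_cvg.
have Fs' : \forall t \near (1 : R)^'-, forall k, abs_summable (fun l => Ft t l * P k l).
  by apply: filter_forall => k; exact: (Fs k).1.
near=> t; apply/esym/zhat_sum_tau; last by near: t.
by near: t.
Unshelve. all: by end_near.
Qed.

End Assembly.

(** [j] is [(r - delta) / 8] or [(r - 2 delta) / 8], the factor of [lk a a] in the coefficient; the
    two cases differ in the parity of [r]. *)
Lemma residue_parameters (r : nat) (delta : int) : (3 <= r)%N -> delta = 1 \/ delta = -1 ->
  (r == delta %[mod 8])%Z || (r == 2 * delta %[mod 8])%Z ->
  exists p h j, [/\ odd p, (h = 2 /\ r = p) \/ (h = 1 /\ r = (2 * p)%N),
    p%:Z = 4 * j * h%:Z + delta
    & (h = 2 /\ (r == delta %[mod 8])%Z) \/ (h = 1 /\ (r == delta %[mod 8])%Z = false)].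
Proof.
move=> r3 dE; have odd4 (p : nat) (k : int) : p%:Z = 4 * k + delta -> odd p.
  by move=> pE; case: dE pE => ->; lia.
case: (boolP (r == delta %[mod 8])%Z) => [r1 _|/negPf r1 /= r2].
  move: (r1); rewrite eqz_mod_dvd => /dvdzP[j rE].
  exists r, 2%N, j; split=> //; [|by left| |by left].
    by apply: (odd4 _ (2 * j)); lia.
  by lia.
move: r2; rewrite eqz_mod_dvd => /dvdzP[j rE].
have pE : (r./2)%:Z = 4 * j + delta by lia.
exists r./2, 1%N, j; split=> //; [exact: odd4 pE|right; split=> //; lia|by lia|by right].
Qed.

Unset Implicit Arguments.
Set Strict Implicit.
Set Printing Implicit Defensive.

Theorem theorem4 (R : realType) (delta : int) (r : nat) (G : plumbing)
    (alpha : 'I_(nv G) -> R[i]) (root : 'I_(nv G)) (Dplus Dminus : R[i])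
    (delta_pm1 : delta = 1 \/ delta = -1)
    (r_ge3 : (3 <= r)%N)
    (r_mod8 : (r == delta %[mod 8])%Z || (r == 2 * delta %[mod 8])%Z)
    (det_neq0 : \det (linking G) != 0)
    (wnd : weakly_negative_definite G R)
    (alpha_class : is_class alpha)
    (alpha_generic : forall v, ~ exceptional r (alpha v))
    (DplusP : is_Delta r true Dplus)
    (DminusP : is_Delta r false Dminus)
    (reg : regularization r delta alpha) :
  (forall (b : H1 G) (s : 'cV['F_2]_(nv G)), s \in spin G ->
     c_omega r delta alpha (sigma b s) = c_formula r delta alpha b s) /\
  (zhat_sum r delta alpha (@Fplus_coef R G) tau : R[i]^o)
    @[tau --> to_root r]
    --> (N_r r root Dplus Dminus alpha : R[i]^o).
Proof.
have [p [h [j [po hrp pE hc]]]] := residue_parameters r_ge3 delta_pm1 r_mod8.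
have p' := par_r' po hrp; rewrite -p' in po hrp pE.
split; first exact: (c_omega_formula r_ge3 po hrp delta_pm1 pE det_neq0 hc root
  alpha_class alpha_generic DplusP DminusP).
exact: (limit_at_root r_ge3 po hrp delta_pm1 pE det_neq0 hc alpha_class
  alpha_generic DplusP DminusP reg).
Qed.
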